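(* Let $\mathbb F=\mathbb R$ or $\mathbb F=\mathbb C$, let $\beta>0$, let $V$ satisfy the potential assumption stated in the context, and let $U\subset\mathbb F$ be a Borel set satisfying the regularity condition stated in the context. Let $(\lambda_1,\dots,\lambda_n)$ have law $\mathbf P^{\mathbb F}_{n,\beta}$ and let $$\frac1n\mathcal X^{\mathbb F}_{n,\beta}(U)=\frac1n\sum_{k=1}^n\delta_{\lambda_k}(U)$$ be the fraction of the points lying in $U$. Then the sequence of laws of $\{n^{-1}\mathcal X^{\mathbb F}_{n,\beta}(U)\}$ satisfies the following large deviation type bounds with speed $n^2$ and rate $\gamma:[0,1]\to[0,\infty]$, and $\gamma$ is a good rate function on $[0,1]$. (i) For any open set $O\subseteq[0,1]$, $$\liminf_{n\to\infty}\frac1{n^2}\log\mathbf P^{\mathbb F}_{n,\beta}\big(n^{-1}\mathcal X^{\mathbb F}_{n,\beta}(U)\in O\big)\ge-\inf_{x\in O}\gamma(x).$$ (ii) For $\mathbb F=\mathbb R$ and any closed set $F\subseteq[0,1]$, $$\limsup_{n\to\infty}\frac1{n^2}\log\mathbf P^{\mathbb R}_{n,\beta}\big(n^{-1}\mathcal X^{\mathbb R}_{n,\beta}(U)\in F\big)\le-\inf_{x\in F}\gamma(x).$$ For $\mathbb F=\mathbb C$, the same inequality (with $\mathbb R$ replaced by $\mathbb C$) holds for every closed set $F\subseteq[0,1]$ such that, for some $0\le\alpha<2$ and all large $n$, $$\mathbf P^{\mathbb C}_{n,\beta}\big(L_n\in\mathcal S_F\cap M_1^*(\mathbb C)^c\big)\le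 e^{n^\alpha}\,\mathbf P^{\mathbb C}_{n,\beta}\big(L_n\in\mathcal S_F\cap M_1^*(\mathbb C)\big),$$ where $\mathcal S_F=\{\mu\in M_1(\mathbb C):\mu(U)\in F\}$ and $L_n=\frac1n\sum_{k=1}^n\delta_{\lambda_k}$.
   Context: $m$ is Lebesgue measure on $\mathbb F$ (on $\mathbb C\cong\mathbb R^2$ when $\mathbb F=\mathbb C$); $\delta_\lambda$ is the Dirac measure at $\lambda$. Potential assumption: $V:\mathbb F\to\mathbb R_+$ is continuous and, for some $\beta'>1$ with $\beta'>\beta$, $\liminf_{|x|\to\infty}\frac{V(x)}{\beta'\log|x|}>1$. If $\mathbb F=\mathbb C$, in addition $V\in C^{1,1}_{\rm loc}(\mathbb C)$, i.e. $V$ is $C^1$ on $\mathbb R^2$ with locally Lipschitz gradient. The $\beta$-ensemble: $\mathbf P^{\mathbb F}_{n,\beta}$ is the probability measure on $\mathbb F^n$ $$\mathbf P^{\mathbb F}_{n,\beta}(d\lambda_1,\dots,d\lambda_n)=\frac1{Z^{\mathbb F}_{n,\beta}}\prod_{1\le i<j\le n}|\lambda_i-\lambda_j|^\beta e^{-n\sum_{i=1}^nV(\lambda_i)}\prod_{i=1}^ndm(\lambda_i),$$ with $Z^{\mathbb F}_{n,\beta}$ the normalizing constant. Regularity condition on $U$: if $\mathbb F=\mathbb R$, the boundary $\partial U$ is a polar set (every nonzero finite compactly supported Borel measure on it has infinite logarithmic energy, i.e. it has logarithmic capacity zero); if $\mathbb F=\mathbb C$, $U$ is a bounded domain whose boundary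 $\partial U$ is a closed $1$-rectifiable set with $\mathcal H^1(\partial U)<\infty$, where $\mathcal H^1$ is $1$-dimensional Hausdorff measure. A $1$-rectifiable set is a set of finite $\mathcal H^1$ measure that is covered, up to an $\mathcal H^1$-null set, by a countable union of images of Lipschitz functions defined on $\mathbb R$. $M_1(\mathbb F)$ is the set of Borel probability measures on $\mathbb F$ (weak topology). For $A\subset\mathbb F$ and $\epsilon>0$, $A_\epsilon=\bigcup_{x\in A}\{y\in\mathbb F:|x-y|<\epsilon\}$. Define $$M_1^*(\mathbb R)=\{\mu\in M_1(\mathbb R):\mu(\partial U)=0\},\qquad M_1^*(\mathbb C)=\{\mu\in M_1(\mathbb C):\mu((\partial U)_\epsilon)\le c\,\epsilon\ \text{for all }0<\epsilon\le\delta_0\},$$ where $c,\delta_0$ are two fixed positive constants, with $c=2\mathcal H^1(\partial U)$. Non-commutative entropy: $\Sigma(\mu)=\iint\log|x-y|\,d\mu(x)d\mu(y)$ if $\int\log(|x|+1)\,d\mu(x)<\infty$, and $\Sigma(\mu)=-\infty$ otherwise. Let $c_\beta=\inf_{\mu\in M_1(\mathbb F)}\{\int V\,d\mu-\frac\beta2\Sigma(\mu)\}$ and $$I_\beta(\mu)=\int V\,d\mu-\tfrac\beta2\Sigma(\mu)-c_\beta\ \text{ if }\int V\,d\mu<\infty,\qquad I_\beta(\mu)=\infty\ \text{ otherwise}.$$ For $x\in[0,1]$, $\gamma(x)=\inf\{I_\beta(\mu):\mu\in M_1^*(\mathbb F),\ \mu(U)=x\}$, with $\inf\emptyset=+\infty$.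 A rate function is a lower semicontinuous function with values in $[0,\infty]$; it is good if all its level sets $\{I\le\alpha\}$, $\alpha\in[0,\infty)$, are compact. *)

(* Defs.v *)
From HB Require Import structures.
From mathcomp Require Import all_boot all_order all_algebra.
From mathcomp Require Import all_classical all_reals all_analysis.
Set Implicit Arguments.
Unset Strict Implicit.
Unset Printing Implicit Defensive.
Import Order.TTheory GRing.Theory Num.Theory.
Import numFieldNormedType.Exports.
Local Open Scope classical_set_scope.
Local Open Scope ring_scope.

Section sf_product.
Context d1 d2 (T1 : measurableType d1) (T2 : measurableType d2) (R : realType).
Variables (m1 : {sigma_finite_measure set T1 -> \bar R})
  (m2 : {sigma_finite_measure set T2 -> \bar R}).

(* Type inference finds sigma-finiteness of [m1 \x m2] only when m1 and m2 are
   subprobabilities, hence this alias carrying the general instance. *)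
Definition sf_product : set (T1 * T2) -> \bar R := (m1 \x m2)%E.

HB.instance Definition _ := Measure.on sf_product.
HB.instance Definition _ := Measure_isSigmaFinite.Build _ _ _ sf_product
  (lebesgue_integral_fubini.product_measure_sigma_finite_subproof m1 m2).

End sf_product.

Section cons_measure.
Context d (T : measurableType d) (R : realType) (n : nat).
Variables (m : {sigma_finite_measure set T -> \bar R})
  (mn : {sigma_finite_measure set (n.-tuple T) -> \bar R}).

Definition tuple_cons (p : T * n.-tuple T) : n.+1.-tuple T :=
  [tuple of p.1 :: p.2].

Lemma measurable_tuple_cons : measurable_fun [set: T * n.-tuple T] tuple_cons.
Proof. exact: (measurable_cons measurable_fst measurable_snd). Qed.

Definition cons_measure : set (n.+1.-tuple T) -> \bar R :=
  pushforward (sf_product m mn) tuple_cons.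

Let mf := measurable_tuple_cons.

Let cons_measure0 : cons_measure set0 = 0%E.
Proof. by rewrite /cons_measure /pushforward preimage_set0 measure0. Qed.

Let cons_measure_ge0 A : (0 <= cons_measure A)%E.
Proof. exact: measure_ge0. Qed.

Let cons_measure_sigma_additive : semi_sigma_additive cons_measure.
Proof.
exact: (@measure_semi_sigma_additive _ _ _ (pushforward (sf_product m mn) tuple_cons)).
Qed.

HB.instance Definition _ := isMeasure.Build _ _ _ cons_measure
  cons_measure0 cons_measure_ge0 cons_measure_sigma_additive.

Let cons_measure_sigma_finite : sigma_finite setT cons_measure.
Proof.
have [F FT Foo] := sigma_finiteT (sf_product m mn).
pose uncons (t : n.+1.-tuple T) := (thead t, [tuple of behead t] : n.-tuple T).
have unconsK : cancel tuple_cons uncons.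
  by move=> [x t]; rewrite /uncons /tuple_cons; congr pair; apply: val_inj.
have mu : measurable_fun setT uncons.
  apply/measurable_fun_pairP; split; first exact: measurable_tnth.
  exact: measurable_behead.
exists (fun k => uncons @^-1` F k).
  by rewrite -preimage_bigcup -FT preimage_setT.
move=> k; have [mF Fk] := Foo k; split.
  by rewrite -[X in measurable X]setTI; exact: mu.
rewrite /cons_measure /pushforward -comp_preimage.
by rewrite (_ : uncons \o tuple_cons = id) //; exact/funext.
Qed.

HB.instance Definition _ := Measure_isSigmaFinite.Build _ _ _
  cons_measure cons_measure_sigma_finite.

End cons_measure.

Fixpoint tuple_measure d (T : measurableType d) (R : realType)
    (m : {sigma_finite_measure set T -> \bar R}) (n : nat) :
    {sigma_finite_measure set (n.-tuple T) -> \bar R} :=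
  match n with
  | 0 => @dirac _ (0.-tuple T) [tuple] R
  | k.+1 => cons_measure m (tuple_measure m k)
  end.

Section empirical.
Context d (T : measurableType d) (R : realType) (n : nat).
Variable x : n.+1.-tuple T.
Local Open Scope ereal_scope.

Definition empirical (A : set T) : \bar R :=
  (n.+1%:R^-1 : R)%R%:E * \sum_(k < n.+1) \d_(tnth x k) A.

Let empiricalE : empirical =
  mscale ((n.+1%:R^-1 : R)%:nng)%R (msum (fun k => \d_(tnth x (inord k))) n.+1).
Proof.
apply/funext => A; rewrite /empirical /mscale /msum/=.
by congr *%E; apply: eq_bigr => k _; rewrite inord_val.
Qed.

Let empirical0 : empirical set0 = 0.
Proof. by rewrite empiricalE measure0. Qed.

Let empirical_ge0 A : 0 <= empirical A.
Proof. by rewrite empiricalE measure_ge0. Qed.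

Let empirical_sigma_additive : semi_sigma_additive empirical.
Proof. by rewrite empiricalE; exact: measure_semi_sigma_additive. Qed.

HB.instance Definition _ := isMeasure.Build _ _ _ empirical
  empirical0 empirical_ge0 empirical_sigma_additive.

Let empirical_setT : empirical setT = 1.
Proof.
rewrite /empirical (eq_bigr (fun=> 1)); last by move=> k _; rewrite diracT.
by rewrite sumEFin big_const_ord iter_addr_0 -EFinM mulVf ?pnatr_eq0.
Qed.

HB.instance Definition _ := Measure_isProbability.Build _ _ _
  empirical empirical_setT.

End empirical.
Arguments empirical {d T R n} x A.

(* [modulus x] is |x| and [dist x y] is |x - y|. *)
Record ambient (R : realType) := Ambient {
  ambient_display : measure_display ;
  ambient_point :> measurableType ambient_display ;
  vol : {sigma_finite_measure set ambient_point -> \bar R} ;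
  modulus : ambient_point -> R ;
  dist : ambient_point -> ambient_point -> R }.

Definition real_line (R : realType) : ambient R :=
  @Ambient R _ (measurableTypeR R) lebesgue_measure
    (fun x : R => `|x|) (fun x y : R => `|x - y|).

(* The complex number a + ib is the pair (a, b). The norm which the library puts
   on [R * R] is the sup norm: it serves below only for notions that are the same
   for all norms of the plane; distances and diameters use [cmod]. *)
Definition cmod (R : realType) (z : R * R) : R :=
  Num.sqrt (z.1 ^+ 2 + z.2 ^+ 2).

Definition complex_plane (R : realType) : ambient R :=
  @Ambient R _ (measurableTypeR R * measurableTypeR R)%type
    (sf_product lebesgue_measure lebesgue_measure)
    (fun z : R * R => cmod z) (fun z w : R * R => cmod (z - w)).

Section beta_ensemble.
Context (R : realType) (F : ambient R) (beta : R) (V : F -> R).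

Definition ensemble_weight (n : nat) (x : n.-tuple F) : R :=
  (\prod_(i < n) \prod_(j < n | (i < j)%N)
      dist (tnth x i) (tnth x j) `^ beta)
  * expR (- (n%:R * \sum_(i < n) V (tnth x i))).

Definition partition_function (n : nat) : \bar R :=
  (\int[tuple_measure (vol F) n]_x (ensemble_weight x)%:E)%E.

(* When the partition function is infinite, which the assumptions on V allow
   only on the complex plane and for finitely many n, [fine] makes this 0. *)
Definition ensemble (n : nat) (A : set (n.-tuple F)) : \bar R :=
  (((fine (partition_function n))^-1)%:E *
   \int[tuple_measure (vol F) n]_(x in A) (ensemble_weight x)%:E)%E.

End beta_ensemble.

Section rate_functions.
Context (R : realType) (F : ambient R) (beta : R) (V : F -> R).
Local Open Scope ereal_scope.
Implicit Type mu : probability F R.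

(* [lne], unlike [ln], is -oo at 0: the diagonal is not discarded. *)
Definition entropy mu : \bar R :=
  if \int[mu]_x (ln (modulus x + 1))%:E < +oo
  then \int[mu \x mu]_p lne (dist p.1 p.2)%:E
  else -oo.

Definition energy mu : \bar R :=
  \int[mu]_x (V x)%:E - (beta / 2)%:E * entropy mu.

Definition min_energy : \bar R := ereal_inf (energy @` setT).

Definition I_beta mu : \bar R :=
  if \int[mu]_x (V x)%:E < +oo then energy mu - min_energy else +oo.

Definition gamma (M : set (probability F R)) (U : set F) (x : R) : \bar R :=
  ereal_inf [set I_beta mu | mu in [set mu | M mu /\ mu U = x%:E]].

End rate_functions.

Definition good_rate_function (R : realType) (T : topologicalType)
    (A : set T) (I : T -> \bar R) : Prop :=
  [/\ forall x, A x -> (0 <= I x)%E,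
      lower_semicontinuous (I : subspace A -> \bar R) &
      forall a : R, 0 <= a ->
        compact ([set x | A x /\ (I x <= a%:E)%E] : set (subspace A))].

Section large_deviations.
Context (R : realType) (F : ambient R) (beta : R) (V : F -> R).
Context (M : set (probability F R)) (U : set F).
Local Open Scope ereal_scope.

Definition fraction_in_U (n : nat) (x : n.+1.-tuple F) : R :=
  fine (@empirical _ _ R _ x U).

(* Sequences are indexed from 0, so the n-th term is about n.+1 points. *)
Definition log_prob_fraction (A : set R) (n : nat) : \bar R :=
  (n.+1%:R ^- 2 : R)%R%:E *
  lne (ensemble beta V [set x : n.+1.-tuple F | A (fraction_in_U x)]).

Definition ld_lower_bound (O : set R) : Prop :=
  - ereal_inf (gamma beta V M U @` O) <= limn_einf (log_prob_fraction O).

Definition ld_upper_bound (C : set R) : Prop :=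
  limn_esup (log_prob_fraction C) <= - ereal_inf (gamma beta V M U @` C).

Definition measures_with_fraction_in (C : set R) : set (probability F R) :=
  [set mu | C (fine (mu U))].

Definition prob_empirical (S : set (probability F R)) (n : nat) : \bar R :=
  ensemble beta V
    [set x : n.+1.-tuple F | S (empirical x : probability F R)].

Definition negligible_outside (C : set R) : Prop :=
  let S := measures_with_fraction_in C in
  exists alpha : R, (0 <= alpha < 2)%R /\
    \forall n \near \oo,
      prob_empirical (S `&` ~` M) n <=
      (expR (n.+1%:R `^ alpha))%:E * prob_empirical (S `&` M) n.

End large_deviations.

Definition confining (R : realType) (T : topologicalType) (md : T -> R)
    (beta : R) (V : T -> R) : Prop :=
  [/\ forall x, 0 <= V x,
      continuous V &
      exists beta' : R, [/\ 1 < beta', beta < beta' &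
        (1 < limf_einf (fun x => (V x / (beta' * ln (md x)))%:E)
               (filter_from [set: R] (fun r => [set x | r < md x])%R))%E]].

Definition gradient (R : realType) (V : R * R -> R) (z : R * R) : R * R :=
  ('D_(1, 0) V z, 'D_(0, 1) V z).

Definition C11_loc (R : realType) (V : R * R -> R) : Prop :=
  [/\ forall z, differentiable V z,
      continuous (gradient V) &
      forall z, exists2 r : R, 0 < r &
        [lipschitz gradient V w | w in ball z r]].

Definition boundary (T : topologicalType) (A : set T) : set T :=
  closure A `\` interior A.

Definition polar (R : realType) (A : set R) : Prop :=
  forall mu : {finite_measure set (measurableTypeR R) -> \bar R},
    (exists K : set R, [/\ compact K, K `<=` A & mu (~` K) = 0%E]) ->
    mu setT != 0%E ->
    (\int[mu \x mu]_p (- lne (`|p.1 - p.2|)%:E) = +oo)%E.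

Section hausdorff.
Context (R : realType).
Local Open Scope ereal_scope.
Implicit Types A E : set (R * R).

(* 0 is thrown in because the supremum of the empty set is -oo. *)
Definition cdiam E : \bar R :=
  ereal_sup (0 |` [set (cmod (p.1 - p.2))%:E | p in E `*` E]).

Definition hausdorff1_pre (delta : R) A : \bar R :=
  ereal_inf [set \sum_(0 <= i <oo) cdiam (E i) | E in
    [set E : (set (R * R))^nat | A `<=` \bigcup_i E i /\
                                  forall i, cdiam (E i) <= delta%:E]].

Definition hausdorff1 A : \bar R :=
  ereal_sup [set hausdorff1_pre delta A | delta in [set delta | 0 < delta]%R].

Definition rectifiable1 A : Prop :=
  hausdorff1 A < +oo /\
  exists f : (R -> R * R)^nat,
    (forall i, lipschitz (f i)) /\
    hausdorff1 (A `\` \bigcup_i range (f i)) = 0.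

End hausdorff.

Definition bounded_domain (R : realType) (U : set (R * R)) : Prop :=
  [/\ U !=set0, open U, connected U & bounded_set U].

Definition thickening (R : realType) (A : set (R * R)) (e : R) : set (R * R) :=
  \bigcup_(x in A) [set y | cmod (x - y) < e].

Definition M1star_real (R : realType) (U : set R) :
    set (probability (real_line R) R) :=
  [set mu | mu (boundary U) = 0%E].

Definition M1star_complex (R : realType) (U : set (R * R)) (delta0 : R) :
    set (probability (complex_plane R) R) :=
  [set mu | forall e : R, 0 < e <= delta0 ->
    (mu (thickening (boundary U) e) <=
     (2 * fine (hausdorff1 (boundary U)) * e)%:E)%E].

(* Main.v *)
Require Import Defs.
From HB Require Import structures.
From mathcomp Require Import all_boot all_order all_algebra.
From mathcomp Require Import all_classical all_reals all_analysis.
From mathcomp Require Import measurable_realfun lra ring.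
Set Implicit Arguments.
Unset Strict Implicit.
Unset Printing Implicit Defensive.
Import Order.TTheory GRing.Theory Num.Theory.
Import numFieldNormedType.Exports.
Local Open Scope classical_set_scope.
Local Open Scope ring_scope.

(** Write [log1 x = ln (1 + |x|)].  Splitting [ln |x - y|] into [log1 x + log1 y] minus a
nonnegative kernel [k], the weight of a configuration of [n] points is, up to terms of lower
order in the exponent, [exp (n^2 (C0 - E))], where [E] is the energy of the empirical measure
without its diagonal terms, [E mu] being the integral of a nonnegative coercive potential plus
the double integral of [k]; moreover [I_beta = E - inf E].

Upper bound: cutting [k] off at level [M] gives continuous energies [E_M] that increase to
[E] and are finite on empirical measures.  If [E_j (nu_j) <= a] for all [j], then along an
ultrafilter the [nu_j] have a limit [mu] with [E mu <= a], which on an open set has at most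
the limit mass; it is the law of a function of a uniform variable whose bits, telling for
each rational [q] whether a coordinate is below [q], have the limit joint distributions.

Lower bound: a measure of finite energy is truncated and convolved with a small uniform
noise; this costs little energy and yields a bounded density, so that Markov's and
Chebyshev's inequalities apply to independent samples.

The mass of [U] passes to the limit at measures which do not charge the boundary of [U]: on
the line these are all measures of finite energy because the boundary is polar, and on the
plane [M1*] is closed and consists of such measures. *)

(** An empirical measure has atoms, so its energy [E] is infinite, while the rate concerns limits of
    finite energy. The cut-off reconciles the two: at a fixed level [M] the diagonal costs order
    [n * M] in an exponent of order [n^2], and compactness provides one level that serves all
    configurations of an event. Integrability over an unbounded space is also cheap: since
    [beta < beta'], a fraction of order [1 / n] of the energy yields an integrable factor for every
    point. All that is asked of a limit measure are upper bounds on double integrals of nonnegative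
    lower semicontinuous functions; the mass of [U] is squeezed between those of open sets inside
    [U] and inside its complement. In the lower bound the difficulty is the diagonal, where [k] is
    infinite: smoothing adds at most a fixed multiple of [beta] on pairs closer than a small [s],
    and finite energy makes such pairs rare. The line enters as a retract of the plane, so that the
    two cases differ only in their noise and in their behaviour at the boundary of [U]. *)

(** * Domination of integrals and integrals over tuples *)

Section domination.
Local Open Scope ereal_scope.
Context d (T : measurableType d) (R : realType).
Implicit Types (m nu : {measure set T -> \bar R}) (f : T -> \bar R).
Import HBNNSimple.

(** Simple functions below [f] are compared value by value, with [m] rescaled by [c]. *)
Lemma ge0_integral_dominated m nu (c : R) f : (0 <= c)%R ->
  (forall A, measurable A -> nu A <= c%:E * m A) ->
  measurable_fun setT f -> (forall x, 0 <= f x) ->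
  \int[nu]_x f x <= c%:E * \int[m]_x f x.
Proof.
move=> c0 numu mf f0.
pose cm : {measure set T -> \bar R} := mscale (NngNum c0) m.
rewrite -(ge0_integral_mscale m measurableT (NngNum c0) mf) //.
rewrite !ge0_integralTE//; apply: ub_ereal_sup => _ [h /= hf <-].
apply: (@le_trans _ _ (sintegral cm h)); last by apply: ereal_sup_ubound; exists h.
rewrite (sintegralE nu) (sintegralE cm).
rewrite !fsbig_finite//=; apply: lee_sum => r _.
have [r0|r0] := ltP r 0%R.
  by rewrite preimage_nnfun0// !measure0 !mule0.
by apply: lee_wpmul2l; rewrite ?lee_fin//; exact: numu.
Qed.

Lemma ge0_markov m f (a : R) : (0 < a)%R -> measurable_fun setT f ->
  (forall x, 0 <= f x) -> a%:E * m [set x | a%:E <= f x] <= \int[m]_x f x.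
Proof.
move=> a0 mf f0; have := le_integral_abse m measurableT mf a0.
rewrite setTI (_ : [set x | _] = [set x | a%:E <= f x]); last first.
  by apply/seteqP; split => x /=; rewrite gee0_abs.
by move=> /le_trans; apply; apply: ge0_le_integral => // *;
  rewrite ?gee0_abs//; exact: measurableT_comp.
Qed.

End domination.

Section tuple_integral.
Local Open Scope ereal_scope.
Context d (T : measurableType d) (R : realType).
Implicit Types m : {sigma_finite_measure set T -> \bar R}.

Lemma integral_tuple_cons m n (h : n.+1.-tuple T -> \bar R) :
  measurable_fun setT h -> (forall x, 0 <= h x) ->
  \int[tuple_measure m n.+1]_x h x =
  \int[m]_a \int[tuple_measure m n]_t h [tuple of a :: t].
Proof.
move=> mh h0.
transitivity (\int[pushforward (sf_product m (tuple_measure m n)) (@tuple_cons _ T n)]_x h x).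
  by [].
rewrite (ge0_integral_pushforward (@measurable_tuple_cons _ T n))//.
rewrite preimage_setT.
rewrite -(@fubini_tonelli1 _ _ _ _ _ m (tuple_measure m n) (h \o @tuple_cons _ T n))//.
  by apply: measurableT_comp mh _; exact: measurable_tuple_cons.
by move=> x; exact: h0.
Qed.

Lemma integral_tuple0 m (h : 0.-tuple T -> \bar R) :
  measurable_fun setT h -> \int[tuple_measure m 0]_x h x = h [tuple].
Proof. by move=> mh; rewrite integral_dirac// diracT mul1e. Qed.

Lemma measurable_cons_tuple n (a : T) :
  measurable_fun [set: n.-tuple T] (fun t => [tuple of a :: t]).
Proof. exact: measurable_cons. Qed.

Lemma measurable_integral_cons m n (h : n.+1.-tuple T -> \bar R) :
  measurable_fun setT h -> (forall x, 0 <= h x) ->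
  measurable_fun setT (fun a => \int[tuple_measure m n]_t h [tuple of a :: t]).
Proof.
move=> mh h0.
apply: (measurable_fun_fubini_tonelli_F (m2 := tuple_measure m n)
  (h \o @tuple_cons _ T n)).
  by apply: measurableT_comp mh _; exact: measurable_tuple_cons.
by move=> x; exact: h0.
Qed.

(** Each coordinate costs one factor [c]. The total [c ^+ n] is only exponential in [n], hence
    invisible at speed [n^2]: a bounded density is therefore a sufficient regularity for
    sampling. *)
Lemma tuple_measure_dominated m m' (c : R) n (h : n.-tuple T -> \bar R) :
  (0 <= c)%R -> (forall A, measurable A -> m A <= c%:E * m' A) ->
  measurable_fun setT h -> (forall x, 0 <= h x) ->
  \int[tuple_measure m n]_x h x <= (c ^+ n)%:E * \int[tuple_measure m' n]_x h x.
Proof.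
move=> c0 mm'; elim: n h => [|n ih] h mh h0.
  by rewrite !integral_tuple0// expr0 mul1e.
rewrite !integral_tuple_cons//.
apply: (@le_trans _ _ (\int[m]_a ((c ^+ n)%:E *
    \int[tuple_measure m' n]_t h [tuple of a :: t]))).
  apply: ge0_le_integral => //.
  - by move=> a _; exact: integral_ge0.
  - exact: measurable_integral_cons.
  - by apply: measurable_funeM; exact: measurable_integral_cons.
  - move=> a _; apply: ih => //.
    by apply: measurableT_comp mh _; exact: measurable_cons_tuple.
rewrite ge0_integralZl//; last 3 first.
- exact: measurable_integral_cons.
- by move=> a _; exact: integral_ge0.
- by rewrite lee_fin exprn_ge0.
rewrite exprSr EFinM -muleA; apply: lee_wpmul2l; first by rewrite lee_fin exprn_ge0.
apply: ge0_integral_dominated => //; first exact: measurable_integral_cons.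
by move=> a; exact: integral_ge0.
Qed.

Lemma tuple_measure_prob (P : probability T R) n : tuple_measure P n setT = 1.
Proof.
elim: n => [|n ih]; first by rewrite /= diracT.
have <- : \int[tuple_measure P n.+1]_x (cst 1) x = tuple_measure P n.+1 setT.
  by rewrite integral_cst// mul1e.
rewrite integral_tuple_cons//.
rewrite (eq_integral (cst 1)); last first.
  by move=> a _ /=; rewrite (integral_cst _ measurableT 1) mul1e; exact: ih.
rewrite integral_cst// mul1e; exact: probability_setT.
Qed.

End tuple_integral.

(** * Limits of probability measures from random bits *)

Section bits.
Implicit Types (om : nat -> bool) (w : seq bool).

(* The newest bit is at the head. *)
Fixpoint bit_prefix om n : seq bool :=
  if n is m.+1 then om m :: bit_prefix om m else [::].

(** Beyond the end of the word all bits are [false], in agreement with [trunc_bits]. *)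
Definition bits_of w (i : nat) : bool := nth false (rev w) i.

Definition trunc_bits N om (i : nat) : bool := (i < N)%N && om i.

Lemma size_bit_prefix om n : size (bit_prefix om n) = n.
Proof. by elim: n => //= n ->. Qed.

Lemma bits_of_prefix om n : bits_of (bit_prefix om n) = trunc_bits n om.
Proof.
apply/funext => i; rewrite /bits_of /trunc_bits.
elim: n => [|n ih] /=; first by rewrite nth_nil.
rewrite rev_cons nth_rcons size_rev size_bit_prefix ltnS.
case: ltngtP => [i_n|i_n|->]; rewrite ?eqxx//=.
by rewrite ih i_n.
Qed.

Definition determined_bits (X : Type) N (psi : (nat -> bool) -> X) :=
  forall om, psi om = psi (trunc_bits N om).

End bits.

Section bits_expectation.
Local Open Scope ereal_scope.
Context d (T : measurableType d) (R : realType) (P : probability T R).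
Variable om : T -> nat -> bool.
Hypothesis mom : forall i, measurable [set t | om t i].

Definition word_prob (w : seq bool) : R :=
  fine (P [set t | bit_prefix (om t) (size w) = w]).

Lemma measurable_word n w : measurable [set t | bit_prefix (om t) n = w].
Proof.
elim: n w => [|n ih] w /=.
  by case: (pselect ([::] = w)) => h; [rewrite (_ : mkset _ = setT)|
    rewrite (_ : mkset _ = set0)] => //; apply/seteqP; split.
case: w => [|b w]; first by rewrite (_ : mkset _ = set0) //; apply/seteqP; split.
rewrite (_ : mkset _ = [set t | bit_prefix (om t) n = w] `&`
   (if b then [set t | om t n] else ~` [set t | om t n])).
  by apply: measurableI => //; case: b => //; exact: measurableC.
apply/seteqP; split => t /=.
  by move=> [<- <-]; split => //; case h: (om t n) => /=; rewrite h.
by move=> [->]; case: b => /= [->//|/negP/negbTE ->].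
Qed.

Lemma word_probE w :
  P [set t | bit_prefix (om t) (size w) = w] = (word_prob w)%:E.
Proof. by rewrite fineK// fin_num_measure//; exact: measurable_word. Qed.

Lemma word_prob_ge0 w : (0 <= word_prob w)%R.
Proof. exact/fine_ge0/measure_ge0. Qed.

Lemma word_prob_le1 w : (word_prob w <= 1)%R.
Proof.
by rewrite -lee_fin -word_probE probability_le1//; exact: measurable_word.
Qed.

Lemma word_prob_nil : word_prob [::] = 1%R.
Proof.
apply: EFin_inj; rewrite -word_probE.
by rewrite (_ : mkset _ = setT) ?probability_setT//; apply/seteqP; split.
Qed.

Lemma word_prob_split w :
  (word_prob w = word_prob (true :: w) + word_prob (false :: w))%R.
Proof.
apply: EFin_inj; rewrite EFinD -!word_probE -measureU; last 3 first.
- exact: measurable_word.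
- exact: measurable_word.
- apply/seteqP; split => // t /= [].
  by move=> [-> _] [].
congr (P _); apply/seteqP; split => t /=.
  by move=> ->; case: (om t (size w)); [left|right].
by move=> [[_ ->]|[_ ->]].
Qed.

(** A function of [N] bits takes finitely many values, so its expectation is a finite combination of
    word probabilities; convergence of these is then all that a passage to the limit requires. *)
Lemma bits_expectation N (psi : (nat -> bool) -> R) :
  (forall x, (0 <= psi x)%R) -> determined_bits N psi ->
  \int[P]_t (psi (om t))%:E =
  (\sum_(w : N.-tuple bool) psi (bits_of w) * word_prob w)%:E.
Proof.
move=> psi0 psiN.
pose W (w : N.-tuple bool) := [set t | bit_prefix (om t) (size w) = w].
transitivity (\int[P]_t
    (\sum_(w : N.-tuple bool) (psi (bits_of w))%:E * (\1_(W w) t)%:E)).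
  apply: eq_integral => t _.
  have st : size (bit_prefix (om t) N) == N by rewrite size_bit_prefix.
  rewrite (bigD1 (Tuple st))//= big1 => [|w wt].
    rewrite adde0 indicE mem_set ?mule1 /W/= ?size_bit_prefix//.
    by rewrite bits_of_prefix -psiN.
  rewrite indicE memNset ?mule0// /W/= size_tuple => h.
  by move/negP: wt; apply; apply/eqP/val_inj.
rewrite ge0_integral_sum//=; last 2 first.
- move=> w; apply: measurable_funeM; apply/measurable_EFinP.
  exact/measurable_indic/measurable_word.
- by move=> w t _; rewrite mule_ge0// lee_fin.
rewrite -sumEFin; apply: eq_bigr => w _.
rewrite ge0_integralZl//; last 2 first.
- by apply/measurable_EFinP; exact/measurable_indic/measurable_word.
- by rewrite lee_fin.
rewrite integral_indic//; last exact: measurable_word.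
by rewrite setIT EFinM; congr *%E; exact: word_probE.
Qed.

Lemma bits_expectation2 N (phi : (nat -> bool) -> (nat -> bool) -> R) :
  (forall x y, (0 <= phi x y)%R) -> determined_bits N phi ->
  (forall x, determined_bits N (phi x)) ->
  \int[P]_s \int[P]_t (phi (om s) (om t))%:E =
  (\sum_(w : N.-tuple bool) \sum_(w' : N.-tuple bool)
     phi (bits_of w) (bits_of w') * word_prob w' * word_prob w)%:E.
Proof.
move=> phi0 phi1 phi2.
under eq_integral do rewrite (bits_expectation (phi0 _) (phi2 _)).
rewrite (bits_expectation (N := N) (psi := fun x =>
  (\sum_(w : N.-tuple bool) phi x (bits_of w) * word_prob w)%R)).
- by congr EFin; apply: eq_bigr => w _; rewrite mulr_suml.
- by move=> x; apply: sumr_ge0 => w _; rewrite mulr_ge0// word_prob_ge0.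
- by move=> x; rewrite phi1.
Qed.

End bits_expectation.

(** * A uniform variable with prescribed word probabilities *)

Section bisection.
Context (R : realType) (p : seq bool -> R).
Hypothesis p0 : forall w, 0 <= p w.
Hypothesis pnil : p [::] = 1.
Hypothesis psplit : forall w, p w = p (true :: w) + p (false :: w).

(** Words correspond to nested subintervals of the unit interval, that of [w] having length [p w]
    and the child with bit [true] lying on the left. This realises Kolmogorov's extension of
    consistent word probabilities by a uniform variable. *)
Fixpoint left_end (w : seq bool) : R :=
  if w is b :: w' then left_end w' + (if b then 0 else p (true :: w')) else 0.

Fixpoint bisect (t : R) n : seq bool :=
  if n is m.+1 then
    let w := bisect t m in (t < left_end w + p (true :: w)) :: w
  else [::].

Definition random_bits (t : R) n : bool :=
  t < left_end (bisect t n) + p (true :: bisect t n).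

Lemma bisectE t n : bisect t n = bit_prefix (random_bits t) n.
Proof. by elim: n => //= n <-. Qed.

Lemma bisect_itv t n w : 0 <= t < 1 ->
  bisect t n = w <-> size w = n /\ left_end w <= t < left_end w + p w.
Proof.
move=> t01; elim: n w => [|n ih] [|b w] /=.
- by split => // _; rewrite pnil add0r.
- by split => // -[].
- by split => // -[].
split.
  move=> [hb hw]; have [sw lt] := (ih _).1 hw; rewrite sw; split => //.
  rewrite hw in hb; move: lt => /andP[lt tl]; rewrite -hb.
  case: (ltP t (left_end w + p (true :: w))) => h.
    by rewrite addr0 lt.
  by rewrite h -addrA -psplit.
move=> [[sw]]; case: b => [|] /andP[].
  rewrite addr0 => lt tl.
  have -> : bisect t n = w.
    apply/ih; split=> //; rewrite lt/= (lt_le_trans tl)// lerD2l.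
    by rewrite [leRHS]psplit lerDl.
  by rewrite tl.
move=> lt tl; have -> : bisect t n = w.
  apply/ih; split=> //; rewrite -addrA -psplit in tl; rewrite tl andbT.
  by rewrite (le_trans _ lt)// lerDl.
by rewrite ltNge lt.
Qed.

Lemma left_end_ge0 w : 0 <= left_end w.
Proof. by elim: w => //= b w ih; rewrite addr_ge0//; case: b. Qed.

Lemma left_end_le w : left_end w + p w <= 1.
Proof.
elim: w => [|b w ih] /=; first by rewrite add0r pnil.
apply: le_trans ih; rewrite -addrA lerD2l [leRHS]psplit.
by case: b; rewrite ?add0r ?lerDl.
Qed.

Let lam : probability _ R := uniform_prob (@ltr01 R).

(** The right endpoint is a null set; without it the intervals of the words of a given length form a
    partition. *)
Lemma uniform01E A : measurable A ->
  lam A = lebesgue_measure (A `&` `[0, 1[).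
Proof.
move=> mA.
have -> : lam A = (\int[lam]_x (\1_A x)%:E)%E by rewrite integral_indic// setIT.
rewrite integral_uniform//; last by apply/measurable_EFinP; exact: measurable_indic.
rewrite subr0 invr1 mul1e -integral_itv_bndo_bndc; last first.
  by apply: measurable_funTS; apply/measurable_EFinP; exact: measurable_indic.
by rewrite integral_indic.
Qed.

Lemma measurable_random_bits i : measurable [set t : measurableTypeR R | random_bits t i].
Proof.
have mb n w : measurable [set t : measurableTypeR R | bisect t n = w].
  elim: n w => [|n ih] w /=.
    by case: (pselect ([::] = w)) => h; [rewrite (_ : mkset _ = setT)|
      rewrite (_ : mkset _ = set0)] => //; apply/seteqP; split.
  case: w => [|b w]; first by rewrite (_ : mkset _ = set0) //; apply/seteqP; split.
  rewrite (_ : mkset _ = [set t | bisect t n = w] `&`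
     [set t | (t < left_end w + p (true :: w)) = b]).
    apply: measurableI => //.
    case: b.
      have -> : [set t | (t < left_end w + p (true :: w)) = true] =
          `]-oo, (left_end w + p (true :: w))[%classic.
        by apply/seteqP; split => t /=; rewrite in_itv.
      exact: measurable_itv.
    have -> : [set t | (t < left_end w + p (true :: w)) = false] =
        `[(left_end w + p (true :: w)), +oo[%classic.
      apply/seteqP; split => t /=; rewrite in_itv /= andbT leNgt.
        by move=> ->.
      by move=> /negbTE.
    exact: measurable_itv.
  apply/seteqP; split => t /=.
    by move=> [<- <-].
  by move=> [-> ->].
have -> : [set t : measurableTypeR R | random_bits t i] =
    \bigcup_(w in [set: seq bool]) [set t | bisect t i.+1 = true :: w].
  apply/seteqP; split => t /=.
    by move=> h; exists (bisect t i) => //=; congr cons.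
  by move=> [w _ /= [h _]].
by apply: countable_bigcupT_measurable => // w; exact: mb.
Qed.

Lemma bisect_prob w : lam [set t | bit_prefix (random_bits t) (size w) = w] = (p w)%:E.
Proof.
rewrite uniform01E; last exact: (measurable_word measurable_random_bits).
rewrite (_ : _ `&` _ = `[left_end w, left_end w + p w[%classic).
  rewrite lebesgue_measure_itv/= lte_fin ltrDl -EFinD addrC addKr.
  by case: ltP => // pw; congr EFin; apply/eqP; rewrite eq_le p0.
apply/seteqP; split => t /=; rewrite !in_itv/=.
  by move=> [h t01]; move: h; rewrite -bisectE => /(bisect_itv _ _ t01)[].
move=> h; have t01 : 0 <= t < 1.
  case/andP: h => h1 h2; rewrite (le_trans (left_end_ge0 w) h1)/=.
  exact: lt_le_trans (left_end_le w).
by split => //; rewrite -bisectE; apply/bisect_itv.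
Qed.

End bisection.

(** * Limits of word probabilities along an ultrafilter *)

Section compact_bits.
Local Open Scope ereal_scope.
Context d (T : measurableType d) (R : realType).

Lemma ultra_fmap (X Y : Type) (f : X -> Y) (UU : set_system X) :
  UltraFilter UU -> UltraFilter (fmap f UU).
Proof.
move=> UUF; split; first exact: fmap_proper_filter.
move=> G GF UG; apply/seteqP; split => [A GA|A /UG//].
have [//|UA] := in_ultra_setVsetC (f @^-1` A) UUF.
have /UG GnA : fmap f UU (~` A) by [].
by have /filter_not_empty : G set0 by rewrite -(setICr A); exact: filterI.
Qed.

Lemma ultra_limit (UU : set_system nat) (u : nat -> R) : UltraFilter UU ->
  (forall k, 0 <= u k <= 1)%R -> exists l : R, u @ UU --> l.
Proof.
move=> UUF u01; have := @segment_compact R 0%R 1%R.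
rewrite compact_ultra => /(_ (u @ UU)%classic) [].
- exact: ultra_fmap.
- apply: (@filterS _ UU _ setT) filterT => k _ /=.
  by rewrite in_itv/= u01.
- by move=> l [_ ul]; exists l.
Qed.

Let lam : probability _ R := uniform_prob (@ltr01 R).

(** Along an ultrafilter all word probabilities converge at once, without diagonal extraction. The
    limits are still consistent, so bisection realises them. Expectations of functions of finitely
    many bits are polynomials in the word probabilities, so their upper bounds survive. *)
Lemma compact_bits (UU : set_system nat) (nu : nat -> probability T R)
    (a : T -> nat -> bool) :
  UltraFilter UU -> (forall i, measurable [set z | a z i]) ->
  exists om : R -> nat -> bool,
    (forall i, measurable [set t : measurableTypeR R | om t i]) /\
    forall N (phi : (nat -> bool) -> (nat -> bool) -> R) (c : R),
      (forall x y, (0 <= phi x y)%R) -> determined_bits N phi ->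
      (forall x, determined_bits N (phi x)) ->
      (\forall k \near UU,
         \int[nu k]_z \int[nu k]_z' (phi (a z) (a z'))%:E <= c%:E) ->
      \int[lam]_s \int[lam]_t (phi (om s) (om t))%:E <= c%:E.
Proof.
move=> UUF ma.
have UUP : ProperFilter UU by exact: ultra_proper.
pose q k w := word_prob (nu k) a w.
have q01 k w : (0 <= q k w <= 1)%R by rewrite word_prob_ge0 word_prob_le1.
have /choice[p pE] : forall w, exists l : R, (q k w) @[k --> UU] --> l.
  by move=> w; apply: ultra_limit => k.
have p0 w : (0 <= p w)%R.
  by apply: (cvgr_to_ge (pE w)); near=> k; case/andP: (q01 k w).
have pnil : p [::] = 1%R.
  apply: (cvg_unique (@Rhausdorff R) (pE [::])).
  rewrite (_ : (fun _ => _) = cst 1%R); first exact: cvg_cst.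
  by apply/funext => k; exact: word_prob_nil.
have psplit w : p w = (p (true :: w) + p (false :: w))%R.
  apply: (cvg_unique (@Rhausdorff R) (pE w)).
  rewrite (_ : (fun _ => _) = (fun k => q k (true :: w) + q k (false :: w))%R).
    exact: cvgD.
  by apply/funext => k; exact: word_prob_split.
exists (random_bits p); have mom := measurable_random_bits p.
split => // N phi c phi0 phi1 phi2 le_c.
rewrite (bits_expectation2 lam mom phi0 phi1 phi2) lee_fin.
have wE w : word_prob lam (random_bits p) w = p w.
  by apply: EFin_inj; rewrite -(word_probE lam mom) bisect_prob.
have cv : (\sum_(w : N.-tuple bool) \sum_(w' : N.-tuple bool)
     phi (bits_of w) (bits_of w') * q k w' * q k w)%R @[k --> UU] -->
   (\sum_(w : N.-tuple bool) \sum_(w' : N.-tuple bool)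
     phi (bits_of w) (bits_of w') * word_prob lam (random_bits p) w' *
      word_prob lam (random_bits p) w)%R.
  apply: cvg_big => [|w _]; first exact: add_continuous.
  apply: cvg_big => [|w' _]; first exact: add_continuous.
  rewrite !wE.
  by apply: cvgM => //; apply: cvgM => //; exact: cvg_cst.
apply: (cvgr_to_le cv).
near=> k; rewrite -lee_fin -(bits_expectation2 (nu k) ma phi0 phi1 phi2).
by near: k.
Unshelve. all: by end_near. Qed.

End compact_bits.

(** * From limiting bits to points of the plane *)

Section plane_limit.
Local Open Scope ereal_scope.
Context d (T : measurableType d) (R : realType).
Variables (UU : set_system nat) (nu : nat -> probability T R).
Variable pi : T -> R * R.
Hypothesis UUF : UltraFilter UU.

Let coord (b : bool) (z : R * R) := if b then z.1 else z.2.

Hypothesis mpi : forall b, measurable_fun setT (fun z => coord b (pi z)).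
Hypothesis tight : forall e : R, (0 < e)%R -> exists m : R, \forall k \near UU,
  forall b, nu k [set z | (m <= `|coord b (pi z)|)%R] <= e%:E.

Let lam : probability (measurableTypeR R) R := uniform_prob (@ltr01 R).

(** Indices are codes of a coordinate and a rational; an index that codes nothing carries the bit
    [false]. *)
Definition point_bits (z : T) (i : nat) : bool :=
  if (unpickle i : option (bool * rat)) is Some x
  then (coord x.1 (pi z) < ratr x.2)%R else false.

Lemma measurable_point_bits i : measurable [set z | point_bits z i].
Proof.
rewrite /point_bits; case: unpickle => [[b q]|] /=; last first.
  by rewrite (_ : mkset _ = set0)//; apply/seteqP; split.
rewrite (_ : mkset _ = (fun z => coord b (pi z)) @^-1` `]-oo, (ratr q)[).
  by rewrite -[X in measurable X]setTI; apply: mpi => //; exact: measurable_itv.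
by apply/seteqP; split => z /=; rewrite in_itv.
Qed.

Variable om : R -> nat -> bool.
Hypothesis mom : forall i, measurable [set t : measurableTypeR R | om t i].
Hypothesis om_le : forall N (phi : (nat -> bool) -> (nat -> bool) -> R) (c : R),
  (forall x y, (0 <= phi x y)%R) -> determined_bits N phi ->
  (forall x, determined_bits N (phi x)) ->
  (\forall k \near UU, \int[nu k]_z \int[nu k]_z'
     (phi (point_bits z) (point_bits z'))%:E <= c%:E) ->
  \int[lam]_s \int[lam]_t (phi (om s) (om t))%:E <= c%:E.

Let bit (w : nat -> bool) (b : bool) (q : rat) := w (pickle (b, q)).

Let bitE z b q : bit (point_bits z) b q = (coord b (pi z) < ratr q)%R.
Proof. by rewrite /bit /point_bits pickleK. Qed.

(** An event is a function of the first variable alone, whose double integral is its probability. *)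
Lemma om_event N (e : (nat -> bool) -> bool) (c : R) : determined_bits N e ->
  measurable [set t : measurableTypeR R | e (om t)] ->
  measurable [set z | e (point_bits z)] ->
  (\forall k \near UU, nu k [set z | e (point_bits z)] <= c%:E) ->
  lam [set t | e (om t)] <= c%:E.
Proof.
move=> eN me me' ec.
have H d' (T' : measurableType d') (P : probability T' R) (a : T' -> nat -> bool) :
   measurable [set t | e (a t)] ->
   \int[P]_s \int[P]_t ((fun x _ => (e x)%:R : R) (a s) (a t))%:E = P [set t | e (a t)].
  move=> m; under eq_integral do rewrite integral_cst//= probability_setT mule1.
  rewrite (eq_integral (fun x => (\1_[set t | e (a t)] x)%:E)).
    by rewrite integral_indic// setIT.
  move=> x _; rewrite indicE; case: (boolP (e (a x))) => h.
    by rewrite mem_set.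
  by rewrite memNset//=; apply/negP.
rewrite -H//; apply: (@om_le N (fun x _ => (e x)%:R)) => //.
- by move=> x; apply/funext => y; rewrite eN.
- by near=> k; rewrite H//; near: k.
Unshelve. all: by end_near. Qed.

Let bit_trunc b q N w : (pickle (b, q) < N)%N ->
  bit (trunc_bits N w) b q = bit w b q.
Proof. by move=> qN; rewrite /bit /trunc_bits qN. Qed.

(** For each coordinate the rationals marked [true] then form the upper part of a Dedekind cut. *)
Let good t := [/\ forall b q q', (q <= q')%R -> bit (om t) b q -> bit (om t) b q',
  forall b, exists q, bit (om t) b q & forall b, exists q, ~~ bit (om t) b q].

Let mbit b q : measurable [set t : measurableTypeR R | bit (om t) b q].
Proof. exact: mom. Qed.

Let mbitT b q : measurable [set z | bit (point_bits z) b q].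
Proof. exact: measurable_point_bits. Qed.

(** A failure of monotonicity between two given rationals involves two bits and is impossible for
    the bits of actual points, so it has limit probability zero. The other two conditions say that
    the limit coordinates are finite, and follow from tightness. *)
Lemma ae_good : {ae lam, forall t, good t}.
Proof.
have n1 x : lam.-negligible [set t | ~ (x.1.2 <= x.2 -> bit (om t) x.1.1 x.1.2 ->
    bit (om t) x.1.1 x.2)%R].
  have [qq|qq] := boolP (x.1.2 <= x.2)%R; last first.
    rewrite (_ : mkset _ = set0); first exact: negligible_set0.
    by apply/seteqP; split => // t /=; apply.
  set A := mkset _.
  pose e w := bit w x.1.1 x.1.2 && ~~ bit w x.1.1 x.2.
  have AE : A = [set t | e (om t)].
    apply/seteqP; split => t /=.
      move=> h; rewrite /e; case: (boolP (bit _ _ x.1.2)) => [h1|h1] /=.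
        by apply/negP => h2; apply: h.
      by exfalso; apply: h => _; rewrite (negbTE h1).
    by move=> /andP[h1 /negP h2] h; apply/h2/h.
  have me d' (T' : measurableType d') (a : T' -> nat -> bool) :
     (forall b q, measurable [set z | bit (a z) b q]) -> measurable [set z | e (a z)].
    move=> mb; rewrite (_ : mkset _ = [set z | bit (a z) x.1.1 x.1.2] `&`
      ~` [set z | bit (a z) x.1.1 x.2]).
      by apply: measurableI => //; exact: measurableC.
    apply/seteqP; split => z /=; rewrite /e; first by move=> /andP[-> /negP].
    by move=> [-> /negP].
  exists A; split => //.
    by rewrite AE; exact: me.
  apply/eqP; rewrite -measure_le0 AE.
  apply: (@om_event (maxn (pickle (x.1.1, x.1.2)) (pickle (x.1.1, x.2))).+1).
  - by move=> w; rewrite /e !bit_trunc// ltnS ?leq_maxl ?leq_maxr.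
  - exact: me.
  - exact: me.
  - near=> k; rewrite (_ : mkset _ = set0) ?measure0//; apply/seteqP; split => // z /=.
    rewrite /e !bitE => /andP[h /negP]; apply.
    by rewrite (lt_le_trans h)// ler_rat.
(* If [A] lies in events [e q] of finitely many bits that force a coordinate of actual points beyond
   any given bound, tightness makes [A] negligible. It is applied to all bits being [false] and to
   all bits being [true]. *)
have pos (b : bool) (A : set (measurableTypeR R)) (e : rat -> (nat -> bool) -> bool) :
    (forall q, exists N, determined_bits N (e q)) ->
    (forall q, measurable [set t : measurableTypeR R | e q (om t)]) ->
    (forall q, measurable [set t | e q (point_bits t)]) ->
    (forall q, A `<=` [set t | e q (om t)]) ->
    (forall m : R, exists q, forall z, e q (point_bits z) -> (m <= `|coord b (pi z)|)%R) ->
    lam.-negligible A.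
  move=> eN me me' Ae em.
  pose B := ~` \bigcup_(q in [set: rat]) ~` [set t : measurableTypeR R | e q (om t)].
  have mB : measurable B.
    apply/measurableC/countable_bigcupT_measurable => // q; exact: measurableC.
  have Be q : B `<=` [set t | e q (om t)].
    by move=> t Bt; apply: contrapT => h; apply: Bt; exists q.
  exists B; split => //; last by move=> t At [q _]; apply; exact: Ae.
  apply/eqP; rewrite -measure_le0; apply/lee_addgt0Pr => eps eps0; rewrite add0e.
  have [m tm] := tight eps0; have [q qm] := em m; have [N qN] := eN q.
  apply: (@le_trans _ _ (lam [set t | e q (om t)])).
    by apply: le_measure; rewrite ?inE//; exact: Be.
  apply: (om_event qN) => //.
  near=> k; apply: (@le_trans _ _ (nu k [set z | (m <= `|coord b (pi z)|)%R])).
    apply: le_measure; rewrite ?inE//.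
    have -> : [set z | (m <= `|coord b (pi z)|)%R] =
        (fun z => `|coord b (pi z)|%R) @^-1` `[m, +oo[.
      by apply/seteqP; split => z /=; rewrite in_itv/= andbT.
    rewrite -[X in measurable X]setTI.
    exact: (measurableT_comp (f := fun x : R => `|x|%R) _ (mpi b)).
  suff : forall b, nu k [set z | (m <= `|coord b (pi z)|)%R] <= eps%:E by apply.
  by near: k; exact: tm.
have n2 b : lam.-negligible [set t | ~ exists q, bit (om t) b q].
  apply: (pos b _ (fun q w => ~~ bit w b q)).
  - by move=> q; exists (pickle (b, q)).+1 => w; rewrite bit_trunc.
  - move=> q; rewrite (_ : mkset _ = ~` [set t | bit (om t) b q]); first exact: measurableC.
    by apply/seteqP; split => t /= /negP.
  - move=> q; rewrite (_ : mkset _ = ~` [set t | bit (point_bits t) b q]); first exact: measurableC.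
    by apply/seteqP; split => t /= /negP.
  - by move=> q t /= h; apply/negP => h'; apply: h; exists q.
  - move=> m; have [q mq] := rat_in_itvoo (ltr_pwDr (@ltr01 R) (lexx m)).
    move: mq; rewrite in_itv/= => /andP[mq _].
    exists q => z; rewrite bitE -leNgt => h.
    by rewrite (le_trans (ltW mq))// (le_trans h)// ler_norm.
have n3 b : lam.-negligible [set t | ~ exists q, ~~ bit (om t) b q].
  apply: (pos b _ (fun q w => bit w b q)) => //.
  - by move=> q; exists (pickle (b, q)).+1 => w; rewrite bit_trunc.
  - by move=> q t /= h; apply/negPn/negP => h'; apply: h; exists q.
  - move=> m; have [q mq] := rat_in_itvoo (ltr_pwDr (@ltr01 R) (lexx (- m - 1)%R)).
    move: mq; rewrite in_itv/= => /andP[_ mq].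
    exists q => z; rewrite bitE => h.
    rewrite -normrN (le_trans _ (ler_norm _))// lerNr (le_trans (ltW h))//.
    by rewrite (le_trans (ltW mq))// subrK.
have [A1 A2 A3] : [/\ lam.-negligible (\bigcup_n [set t | if (unpickle n : option (bool * rat * rat)) is Some x then
    ~ (x.1.2 <= x.2 -> bit (om t) x.1.1 x.1.2 -> bit (om t) x.1.1 x.2)%R else False]),
   lam.-negligible ([set t | ~ exists q, bit (om t) true q] `|`
     [set t | ~ exists q, bit (om t) false q]) &
   lam.-negligible ([set t | ~ exists q, ~~ bit (om t) true q] `|`
     [set t | ~ exists q, ~~ bit (om t) false q])].
  split; [|exact: negligibleU|exact: negligibleU].
  have n0 : lam.-negligible [set t : R | False].
    by rewrite (_ : mkset _ = set0); [exact: negligible_set0|apply/seteqP; split].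
  by apply: negligible_bigcup => n; case: unpickle.
apply: negligibleS (negligibleU (negligibleU A1 A2) A3) => t /= nt.
apply: contrapT => /not_orP[/not_orP[h1 /not_orP[h2 h3]] /not_orP[h4 h5]].
apply: nt; split.
- move=> b q q' qq bq; apply: contrapT => nb; apply: h1.
  exists (pickle (((b, q), q') : bool * rat * rat)) => //.
  by rewrite /mkset pickleK /= => /(_ qq bq).
- by case; apply: contrapT.
- by case; apply: contrapT.
Unshelve. all: by end_near. Qed.

(** The value [+oo] removes unmarked rationals from the infimum, so [lim_coord] is the infimum of
    the marked ones, in a form that is visibly measurable. *)
Let active b (n : nat) (t : R) : \bar R :=
  if (unpickle n : option rat) is Some q
  then if bit (om t) b q then (ratr q : R)%:E else +oo else +oo.

Let lim_coord b (t : R) : \bar R := einfs (active b ^~ t) 0%N.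

Definition limit_point (t : R) : R * R :=
  (fine (lim_coord true t), fine (lim_coord false t)).

Lemma measurable_limit_point b :
  measurable_fun [set: measurableTypeR R] (fun t => coord b (limit_point t)).
Proof.
have mE b' : measurable_fun [set: measurableTypeR R] (lim_coord b').
  apply: measurable_fun_einfs => n; rewrite /active.
  case: unpickle => [q|]; last exact: measurable_cst.
  apply: measurable_fun_ifT; [|exact: measurable_cst..].
  apply: (measurable_fun_bool true); rewrite setTI; exact: mbit.
case: b => /=; exact: measurableT_comp (fine_measurable measurableT) (mE _).
Qed.

Let lim_coord_le b q t : bit (om t) b q -> lim_coord b t <= (ratr q)%:E.
Proof.
move=> bq; apply: ereal_inf_lbound; exists (pickle q) => //.
by rewrite /active pickleK bq.
Qed.

Let lim_coord_fin b t : good t -> lim_coord b t \is a fin_num.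
Proof.
move=> [g1 g2 g3]; have [q bq] := g2 b; have [q' bq'] := g3 b.
have le1 := lim_coord_le bq.
have le2 : (ratr q')%:E <= lim_coord b t.
  apply: le_ereal_inf_tmp => _ [n _ <-]; rewrite /active.
  case: unpickle => [r|]; last exact: leey.
  case: ifPn => br; last exact: leey.
  rewrite lee_fin ler_rat leNgt; apply/negP => rq.
  by move/negP : bq'; apply; apply: (g1 b r) br; exact: ltW.
rewrite fin_numE; apply/andP; split; apply/eqP => E.
  by rewrite E in le2.
by rewrite E in le1.
Qed.

Let lim_coord_lt b t (y : R) : lim_coord b t < y%:E ->
  exists2 q, bit (om t) b q & (ratr q < y)%R.
Proof.
move=> /ereal_inf_lt[_ [n _ <-]]; rewrite /active.
case: unpickle => // q; case: ifPn => // bq; rewrite lte_fin => qy.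
by exists q.
Qed.

Local Notation box := ((rat * rat) * (rat * rat))%type.

Let in_box (w : nat -> bool) (B : box) : bool :=
  [&& ~~ bit w true B.1.1, bit w true B.1.2, ~~ bit w false B.2.1 & bit w false B.2.2].

Let box_set (B : box) : set (R * R) :=
  [set z | (ratr B.1.1 <= z.1 < ratr B.1.2)%R /\ (ratr B.2.1 <= z.2 < ratr B.2.2)%R].

Let in_boxE z B : in_box (point_bits z) B -> box_set B (pi z).
Proof.
rewrite /in_box !bitE /= -!leNgt => /and4P[h1 h2 h3 h4].
by split; rewrite ?h1 ?h3.
Qed.

Variable h : R * R -> R * R -> R.
Hypothesis h0 : forall x y, (0 <= h x y)%R.
Hypothesis mh : measurable_fun [set: ((measurableTypeR R * measurableTypeR R) *
  (measurableTypeR R * measurableTypeR R))%type] (fun p => h p.1 p.2).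
Hypothesis lsc_h : forall x y (c : R), (c < h x y)%R ->
  \forall x' \near x & y' \near y, (c <= h x' y')%R.

(** A nonnegative lower semicontinuous [h] is the supremum of countably many rational constants
    placed on products of rational boxes that they minorise. Each such step function reads finitely
    many bits. *)
Let minorant (x : rat * box * box) : Prop :=
  (0 <= x.1.1)%R /\ forall z z', box_set x.1.2 z -> box_set x.2 z' -> (ratr x.1.1 <= h z z')%R.

Let term (n : nat) (w w' : nat -> bool) : R :=
  if (unpickle n : option (rat * box * box)) is Some x then
    if [&& `[< minorant x >], in_box w x.1.2 & in_box w' x.2] then ratr x.1.1 else 0%R
  else 0%R.

Let hN N (w w' : nat -> bool) : R :=
  iteri N (fun n x => Num.max x (term n w w')) 0%R.

Let term_le n z z' : (term n (point_bits z) (point_bits z') <= h (pi z) (pi z'))%R.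
Proof.
rewrite /term; case: unpickle => // x; case: ifP => // /and3P[/asboolP[_ m]].
by move=> /in_boxE ? /in_boxE ?; exact: m.
Qed.

Let hNS N w w' : hN N.+1 w w' = Num.max (hN N w w') (term N w w').
Proof. by []. Qed.

Let hN0 w w' : hN 0 w w' = 0%R.
Proof. by []. Qed.

Let hN_le N z z' : (hN N (point_bits z) (point_bits z') <= h (pi z) (pi z'))%R.
Proof. by elim: N => [|N ih]; rewrite ?hN0// hNS ge_max ih term_le. Qed.

Let hN_ge0 N w w' : (0 <= hN N w w')%R.
Proof. by elim: N => [|N ih]; rewrite ?hN0// hNS le_max ih. Qed.

Let hN_nd w w' : {homo (fun N => hN N w w') : n m / (n <= m)%N >-> (n <= m)%R}.
Proof. by apply/nondecreasing_seqP => n; rewrite hNS le_max lexx. Qed.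

Let box_depth (B : box) := (pickle (true, B.1.1) + pickle (true, B.1.2) +
  pickle (false, B.2.1) + pickle (false, B.2.2)).+1.

Let in_box_trunc N B w : (box_depth B <= N)%N -> in_box (trunc_bits N w) B = in_box w B.
Proof.
have sum4 m n p q : (m + n + p + q < N)%N -> [/\ m < N, n < N, p < N & q < N]%N.
  move=> lt_N; split; apply: leq_ltn_trans lt_N; rewrite ?leq_addl// -!addnA ?leq_addr//.
    by rewrite addnCA leq_addr.
  by rewrite addnA addnCA leq_addr.
move=> /sum4[b1 b2 b3 b4]; rewrite /in_box.
by rewrite (bit_trunc w b1) (bit_trunc w b2) (bit_trunc w b3) (bit_trunc w b4).
Qed.

Let hN_determined N : exists D, forall D' w w', (D <= D')%N ->
  hN N (trunc_bits D' w) (trunc_bits D' w') = hN N w w'.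
Proof.
elim: N => [|N [D ih]]; first by exists 0%N => *; rewrite !hN0.
have [D1 tD1] : exists D, forall D' w w', (D <= D')%N ->
   term N (trunc_bits D' w) (trunc_bits D' w') = term N w w'.
  rewrite /term; case: unpickle => [x|]; last by exists 0%N.
  exists (box_depth x.1.2 + box_depth x.2)%N => D' w w' DD'.
  by rewrite !in_box_trunc// (leq_trans _ DD')// ?leq_addr ?leq_addl.
exists (maxn D D1) => D' w w'; rewrite geq_max => /andP[h1 h2].
by rewrite !hNS ih// tD1.
Qed.

Let trunc_trunc D w : trunc_bits D (trunc_bits D w) = trunc_bits D w.
Proof. by apply/funext => i; rewrite /trunc_bits andbA andbb. Qed.

Let coord_itv b t (e : R) : good t -> (0 < e)%R -> exists lo hi,
  [/\ ~~ bit (om t) b lo, bit (om t) b hi, (coord b (limit_point t) - e < ratr lo)%R &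
      (ratr hi < coord b (limit_point t) + e)%R].
Proof.
move=> gt e0; have cE : (coord b (limit_point t))%:E = lim_coord b t.
  by rewrite -(fineK (lim_coord_fin b gt)); case: b.
have [lo] : exists q : rat, ratr q \in `](coord b (limit_point t) - e)%R, (coord b (limit_point t))[.
  by apply: rat_in_itvoo; rewrite gtrBl.
rewrite in_itv/= => /andP[lo1 lo2].
have [hi bhi hi1] : exists2 q, bit (om t) b q & (ratr q < coord b (limit_point t) + e)%R.
  by apply: lim_coord_lt; rewrite -cE lte_fin ltrDl.
exists lo, hi; split => //; apply/negP => /lim_coord_le.
by rewrite -cE lee_fin leNgt lo2.
Qed.

Let good_box t (A : set (R * R)) : good t -> nbhs (limit_point t) A ->
  exists B, in_box (om t) B /\ box_set B `<=` A.
Proof.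
move=> gt /nbhs_ballP[e /= e0 eA].
have [l1 [h1 [a1 a2 a3 a4]]] := coord_itv true gt e0.
have [l2 [h2 [b1 b2 b3 b4]]] := coord_itv false gt e0.
exists ((l1, h1), (l2, h2)); split; first by rewrite /in_box /= a1 a2 b1 b2.
move=> z /= [/andP[c1 c2] /andP[d1 d2]]; apply: eA.
by split; rewrite /ball/= ltr_distlC; apply/andP; split;
  [apply: lt_le_trans a3 _|apply: lt_trans a4|apply: lt_le_trans b3 _|apply: lt_trans b4].
Qed.

(** Lower semicontinuity gives a rational minorant near the pair of limit points, and arbitrarily
    small boxes around each limit point are announced by its bits. *)
Let hN_sup s t (c : R) : good s -> good t -> (c < h (limit_point s) (limit_point t))%R ->
  exists N, (c <= hN N (om s) (om t))%R.
Proof.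
move=> gs gt ch; have [c0|c0] := ltP c 0%R; first by exists 0%N; rewrite hN0 ltW.
have [r] := rat_in_itvoo ch; rewrite in_itv/= => /andP[cr rh].
have [[A A'] /= [nA nA'] AA'] := lsc_h rh.
have [B [tB BA]] := good_box gs nA.
have [B' [tB' BA']] := good_box gt nA'.
exists (pickle ((r, B), B')).+1; rewrite hNS le_max; apply/orP; right.
rewrite /term pickleK /= tB tB'.
suff -> : `[< minorant ((r, B), B') >] by exact: ltW.
apply/asboolP; split => /=; first by rewrite -(ler_rat R) rmorph0 (le_trans c0)// ltW.
by move=> z z' /BA Az /BA' A'z'; exact: (AA' (z, z')).
Qed.

Let mhN d' (T' : measurableType d') (a : T' -> nat -> bool) N :
  (forall b q, measurable [set z | bit (a z) b q]) ->
  measurable_fun [set: T' * T'] (fun p => (hN N (a p.1) (a p.2))%:E).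
Proof.
move=> ma; apply/measurable_EFinP; elim: N => [|N ih].
  by under eq_fun do rewrite hN0; exact: measurable_cst.
under eq_fun do rewrite hNS; apply: measurable_maxr => //.
rewrite /term; case: unpickle => [x|]; last exact: measurable_cst.
apply: measurable_fun_ifT; [|exact: measurable_cst..].
have mb b q (f : T' * T' -> T') :
    measurable_fun setT f -> measurable_fun setT (fun p => bit (a (f p)) b q).
  move=> mf; apply: (measurable_fun_bool true).
  rewrite setTI (_ : _ @^-1` _ = f @^-1` [set t | bit (a t) b q]).
    by rewrite -[X in measurable X]setTI; apply: mf => //; exact: ma.
  by apply/seteqP; split.
have mbox (f : T' * T' -> T') B :
    measurable_fun setT f -> measurable_fun setT (fun p => in_box (a (f p)) B).
  move=> mf; rewrite /in_box.
  apply: measurable_and; first by apply: measurable_neg; exact: mb.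
  apply: measurable_and; first exact: mb.
  apply: measurable_and; first by apply: measurable_neg; exact: mb.
  exact: mb.
apply: measurable_and; first exact: measurable_cst.
apply: measurable_and; first by apply: (mbox fst).
by apply: (mbox snd).
Qed.

Let mhX d' (T' : measurableType d') (X : T' -> R * R) :
  (forall b, measurable_fun [set: T'] (fun t => coord b (X t))) ->
  measurable_fun [set: T' * T'] (fun p => (h (X p.1) (X p.2))%:E).
Proof.
move=> mX; apply/measurable_EFinP.
have mX' : measurable_fun setT (X : T' -> measurableTypeR R * measurableTypeR R).
  by apply/measurable_fun_pairP; split; [exact: (mX true)|exact: (mX false)].
apply: (measurableT_comp mh (g := fun p : T' * T' => (X p.1, X p.2))).
by apply: measurable_fun_pair; exact: measurableT_comp mX' _.
Qed.

(** A portmanteau inequality. Each [hN N] lies below [h] on actual points and reads finitely many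
    bits, so its limit integral is at most [c]; almost surely the supremum over [N] is at least [h]
    at the limit points, and monotone convergence concludes. *)
Lemma limit_point_integral (c : R) :
  (\forall k \near UU, \int[nu k \x nu k]_p (h (pi p.1) (pi p.2))%:E <= c%:E) ->
  \int[lam \x lam]_p (h (limit_point p.1) (limit_point p.2))%:E <= c%:E.
Proof.
move=> hc.
have hNc N : \int[lam \x lam]_p (hN N (om p.1) (om p.2))%:E <= c%:E.
  rewrite fubini_tonelli1//; last 2 first.
  - by apply: mhN => b q; exact: mbit.
  - by move=> p; rewrite lee_fin hN_ge0.
  have [D hD] := hN_determined N.
  apply: (@om_le D (hN N)).
  - by move=> x y; exact: hN_ge0.
  - by move=> w; apply/funext => w'; rewrite -[LHS](hD D)// -[RHS](hD D)// trunc_trunc.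
  - by move=> w w'; rewrite -[LHS](hD D)// -[RHS](hD D)// trunc_trunc.
  near=> k; apply: (@le_trans _ _ (\int[nu k \x nu k]_p (h (pi p.1) (pi p.2))%:E)).
    have mh1 := mhN N mbitT.
    rewrite -(fubini_tonelli1 (fun p => (hN N (point_bits p.1) (point_bits p.2))%:E))//;
      last by move=> p; rewrite lee_fin hN_ge0.
    apply: ge0_le_integral => //.
    - by move=> p _; rewrite lee_fin hN_ge0.
    - exact: mhX.
    - by move=> p _; rewrite lee_fin hN_le.
  by near: k.
pose g N (p : measurableTypeR R * measurableTypeR R) := (hN N (om p.1) (om p.2))%:E.
have g_nd p : {homo (fun N => g N p) : n m / (n <= m)%N >-> n <= m}.
  by move=> n m nm; rewrite lee_fin hN_nd.
have mg N : measurable_fun setT (g N) by apply: mhN => b q; exact: mbit.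
have g0 N p : 0 <= g N p by rewrite lee_fin hN_ge0.
have cg := @cvg_monotone_convergence _ _ _ (lam \x lam) _ measurableT g mg
  (fun N p _ => g0 N p) (fun p _ => g_nd p).
apply: (@le_trans _ _ (\int[lam \x lam]_p limn (g^~ p))); last first.
  rewrite -(cvg_lim _ cg)//; apply: lime_le; first by apply/cvg_ex; eexists; exact: cg.
  by apply: nearW => N; exact: hNc.
apply: ae_ge0_le_integral => //.
- by move=> p _; rewrite lee_fin.
- by apply: mhX => b; exact: measurable_limit_point.
- by move=> p _; apply: lime_ge; [exact: ereal_nondecreasing_is_cvgn|exact: nearW].
- by apply: (emeasurable_fun_cvg g) => // p _; exact: ereal_nondecreasing_is_cvgn.
have [N0 [mN0 N00 sN0]] := ae_good.
exists (N0 `*` setT `|` setT `*` N0); split.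
- by apply: measurableU; exact: measurableX.
- apply/eqP; rewrite -measure_le0; apply: le_trans (measureU2 _ _ _) _.
  + exact: measurableX.
  + exact: measurableX.
  + have l0 : lam N0 = 0 by exact: N00.
    have e1 : (lam \x lam)%E (N0 `*` setT) = 0.
      by transitivity (lam N0 * lam setT); [exact: product_measure1E|rewrite l0 mul0e].
    have e2 : (lam \x lam)%E (setT `*` N0) = 0.
      by transitivity (lam setT * lam N0); [exact: product_measure1E|rewrite l0 mule0].
    rewrite -[leRHS]adde0; apply: leeD; [rewrite -[leRHS]e1|rewrite -[leRHS]e2]; exact: lexx.
move=> [s t] /= nst; apply: contrapT => /not_orP[ns nt]; apply: nst => _.
have gs : good s by apply: contrapT => gs; apply: ns; split => //; exact: sN0.
have gt : good t by apply: contrapT => gt; apply: nt; split => //; exact: sN0.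
apply/lee_subgt0Pr => e e0.
have [N hNst] : exists N, (h (limit_point s) (limit_point t) - e <= hN N (om s) (om t))%R.
  by apply: hN_sup => //; rewrite gtrBl.
rewrite -EFinB; apply: (@le_trans _ _ (g N (s, t))); first by rewrite lee_fin.
have := ereal_nondecreasing_cvgn (g_nd (s, t)); move/cvg_lim => ->//.
by apply: ereal_sup_ubound; exists N.
Unshelve. all: by end_near. Qed.

End plane_limit.

(** Double integrals are what the applications need: the cut-off energy is one, and the mass of an
    open set is the case of an indicator of the first variable alone. *)
Theorem plane_compactness d (T : measurableType d) (R : realType)
    (UU : set_system nat) (nu : nat -> probability T R) (pi : T -> R * R) :
  UltraFilter UU ->
  measurable_fun setT (fun z => (pi z).1) ->
  measurable_fun setT (fun z => (pi z).2) ->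
  (forall e : R, 0 < e -> exists m : R, \forall k \near UU,
     (nu k [set z | (m <= `|(pi z).1|)%R] <= e%:E)%E /\
     (nu k [set z | (m <= `|(pi z).2|)%R] <= e%:E)%E) ->
  exists X : measurableTypeR R -> R * R,
    [/\ measurable_fun setT (fun t => (X t).1),
        measurable_fun setT (fun t => (X t).2) &
        forall (h : R * R -> R * R -> R) (c : R),
          (forall x y, 0 <= h x y) ->
          measurable_fun [set: ((measurableTypeR R * measurableTypeR R) *
            (measurableTypeR R * measurableTypeR R))%type] (fun p => h p.1 p.2) ->
          (forall x y (a : R), a < h x y ->
            \forall x' \near x & y' \near y, a <= h x' y') ->
          (\forall k \near UU,
            (\int[nu k \x nu k]_p (h (pi p.1) (pi p.2))%:E <= c%:E)%E) ->
          (\int[uniform_prob (@ltr01 R) \x uniform_prob (@ltr01 R)]_p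
             (h (X p.1) (X p.2))%:E <= c%:E)%E].
Proof.
move=> UUF mp1 mp2 tight.
have mpi b : measurable_fun setT (fun z => if b then (pi z).1 else (pi z).2).
  by case: b.
have [om [mom om_le]] := compact_bits nu UUF (measurable_point_bits mpi).
have tight' : forall e : R, (0 < e)%R -> exists m : R, \forall k \near UU,
  forall b, (nu k [set z | (m <= `|if b then (pi z).1 else (pi z).2|)%R] <= e%:E)%E.
  move=> e /tight[m hm]; exists m; apply: filterS hm => k [h1 h2].
  by case.
exists (limit_point om); split.
- exact: (measurable_limit_point mom true).
- exact: (measurable_limit_point mom false).
- by move=> h c h0 mh lsc_h hc; exact: (limit_point_integral UUF mpi tight' mom om_le h0 mh lsc_h hc).
Qed.

(** * Logarithmic energy on the line and the plane *)

Section cmod.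
Context (R : realType).
Implicit Types z w : R * R.

Lemma cmod_ge0 z : 0 <= cmod z.
Proof. exact: sqrtr_ge0. Qed.

Lemma cmod_sq z : cmod z ^+ 2 = z.1 ^+ 2 + z.2 ^+ 2.
Proof. by rewrite sqr_sqrtr// addr_ge0// sqr_ge0. Qed.

Lemma cmodN z : cmod (- z) = cmod z.
Proof. by rewrite /cmod /= !sqrrN. Qed.

Lemma cmod_fst z : `|z.1| <= cmod z.
Proof. by rewrite -sqrtr_sqr ler_wsqrtr// lerDl sqr_ge0. Qed.

Lemma cmod_snd z : `|z.2| <= cmod z.
Proof. by rewrite -sqrtr_sqr ler_wsqrtr// lerDr sqr_ge0. Qed.

Lemma cmodD z w : cmod (z + w) <= cmod z + cmod w.
Proof.
rewrite -(ler_pXn2r (n := 2))// ?nnegrE ?addr_ge0 ?cmod_ge0//.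
rewrite sqrrD !cmod_sq /=.
suff : z.1 * w.1 + z.2 * w.2 <= cmod z * cmod w by rewrite mulr2n; nra.
apply: (le_trans (ler_norm _)).
rewrite -(ler_pXn2r (n := 2))// ?nnegrE ?mulr_ge0 ?cmod_ge0//.
rewrite exprMn !cmod_sq -normrX ger0_norm ?sqr_ge0//.
(* By Lagrange's identity this square is the gap in the Cauchy-Schwarz inequality. *)
by have := sqr_ge0 (z.1 * w.2 - z.2 * w.1); nra.
Qed.

Lemma cmod_le z : cmod z <= `|z.1| + `|z.2|.
Proof.
rewrite -(ler_pXn2r (n := 2))// ?nnegrE ?addr_ge0 ?cmod_ge0//.
rewrite cmod_sq sqrrD !real_normK ?num_real//.
rewrite addrAC lerDl mulrn_wge0// mulr_ge0//.
Qed.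

Lemma cmodC z w : cmod (z - w) = cmod (w - z).
Proof. by rewrite -cmodN opprB. Qed.

Lemma cmod_continuous : continuous (@cmod R).
Proof.
move=> z; apply: (continuous_comp (f := fun z : R * R => z.1 ^+ 2 + z.2 ^+ 2) (g := Num.sqrt));
  last exact: sqrt_continuous.
by apply: cvgD; apply: cvgM; (exact: cvg_fst || exact: cvg_snd).
Qed.

Lemma measurable_cmod d (T : measurableType d) (X : T -> R * R) :
  measurable_fun setT (fun t => (X t).1) -> measurable_fun setT (fun t => (X t).2) ->
  measurable_fun setT (fun t => cmod (X t)).
Proof.
move=> m1 m2; rewrite /cmod.
apply: (measurableT_comp (f := (@Num.sqrt R))).
  by apply: continuous_measurable_fun; exact: sqrt_continuous.
by apply: measurable_funD; apply: measurable_funX.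
Qed.

End cmod.

(* [ret] makes [F] a retract of the plane: the identity for C, the real part for R. *)
Record planar (R : realType) (F : ambient R) := Planar {
  emb : F -> R * R ;
  ret : R * R -> F ;
  add : F -> F -> F ;
  noise : R -> probability F R ;
  density : R -> R ;
  emb_measurable1 : measurable_fun setT (fun x => (emb x).1) ;
  emb_measurable2 : measurable_fun setT (fun x => (emb x).2) ;
  ret_measurable : measurable_fun
    [set: measurableTypeR R * measurableTypeR R] (ret : _ -> F) ;
  add_measurable : measurable_fun setT (fun p : F * F => add p.1 p.2) ;
  embK : cancel emb ret ;
  emb_ret_continuous : continuous (fun z => emb (ret z)) ;
  emb_add : forall x y, emb (add x y) = emb x + emb y ;
  modulusE : forall x : F, modulus x = cmod (emb x) ;
  distE : forall x y : F, dist x y = cmod (emb x - emb y) ;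
  noise_small : forall e, 0 < e -> noise e [set u | 2 * e < modulus u] = 0%E ;
  density_ge0 : forall e, 0 < e -> 0 <= density e ;
  noise_density : forall e x A, 0 < e -> measurable A ->
    (noise e [set u | A (add x u)] <= (density e)%:E * vol F A)%E ;
  noise_near : forall e x y t, 0 < e -> 0 < t ->
    (noise e [set u | (dist (add x u) y <= e * t)%R] <= t%:E)%E ;
  vol_decay : (\int[vol F]_x ((1 + modulus x) ^- 3)%:E < +oo)%E }.

(** * The nonnegative logarithmic kernel *)

Section kernel.
Context (R : realType) (F : ambient R) (P : planar F).
Implicit Types (x y : F).

Lemma modulus_ge0 x : 0 <= modulus x.
Proof. by rewrite (modulusE P) cmod_ge0. Qed.

Lemma dist_ge0 x y : 0 <= dist x y.
Proof. by rewrite (distE P) cmod_ge0. Qed.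

Lemma dist_eq0_or_gt0 x y : dist x y = 0 \/ 0 < dist x y.
Proof.
have := dist_ge0 x y; rewrite le_eqVlt => /predU1P[->|]; [by left|by right].
Qed.

Lemma distC x y : dist x y = dist y x.
Proof. by rewrite !(distE P) cmodC. Qed.

Lemma measurable_modulus : measurable_fun setT (@modulus R F).
Proof.
rewrite (_ : @modulus R F = fun x => cmod (emb P x)); last exact/funext/modulusE.
by apply: measurable_cmod; [exact: emb_measurable1|exact: emb_measurable2].
Qed.

Lemma measurable_dist : measurable_fun setT (fun p : F * F => dist p.1 p.2).
Proof.
rewrite (_ : (fun _ => _) = fun p : F * F => cmod (emb P p.1 - emb P p.2)); last first.
  by apply/funext => p; exact: distE.
by apply: measurable_cmod; apply: measurable_funB;
  (apply: (measurableT_comp (emb_measurable1 P)) => // ||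
   apply: (measurableT_comp (emb_measurable2 P)) => //).
Qed.

Definition log1 (x : F) : R := ln (modulus x + 1).

Lemma modulus1_gt0 x : 0 < modulus x + 1.
Proof. by rewrite ltr_wpDl// modulus_ge0. Qed.

Lemma log1_ge0 x : 0 <= log1 x.
Proof. by apply: ln_ge0; rewrite lerDr modulus_ge0. Qed.

Lemma expR_log1 x : expR (log1 x) = modulus x + 1.
Proof. by rewrite lnK// posrE modulus1_gt0. Qed.

Lemma measurable_log1 : measurable_fun setT log1.
Proof.
apply: (measurableT_comp (@measurable_ln R)).
by apply: measurable_funD => //; exact: measurable_modulus.
Qed.

(** The distance is at most [|x| + |y|], hence at most [(1 + |x|) * (1 + |y|)]. This is what makes
    the kernels below nonnegative. *)
Lemma dist_le x y : dist x y <= expR (log1 x + log1 y).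
Proof.
rewrite expRD !expR_log1 (distE P).
apply: le_trans (cmodD _ _) _; rewrite cmodN -!(modulusE P).
have := modulus_ge0 x; have := modulus_ge0 y; nra.
Qed.

Variables (beta : R).
Hypothesis beta0 : 0 < beta.

Definition cutoff_dist (M : nat) x y : R := Num.max (dist x y) (expR (- M%:R)).

Definition cutoff_kernel (M : nat) x y : R :=
  beta / 2 * (log1 x + log1 y - ln (cutoff_dist M x y)).

Definition log_kernel x y : \bar R :=
  ((beta / 2)%:E * ((log1 x + log1 y)%:E - lne (dist x y)%:E))%E.

Lemma cutoff_dist_gt0 M x y : 0 < cutoff_dist M x y.
Proof. by rewrite lt_max expR_gt0 orbT. Qed.

Lemma cutoff_kernel_ge0 M x y : 0 <= cutoff_kernel M x y.
Proof.
apply: mulr_ge0; first by rewrite divr_ge0// ltW.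
rewrite subr_ge0 -ler_expR lnK ?posrE ?cutoff_dist_gt0//.
rewrite ge_max dist_le ler_expR (le_trans (y := 0)) ?oppr_le0//.
by rewrite addr_ge0 ?log1_ge0.
Qed.

Lemma cutoff_kernel_nd x y :
  {homo (fun M => cutoff_kernel M x y) : n m / (n <= m)%N >-> n <= m}.
Proof.
move=> n m nm; rewrite ler_pM2l ?divr_gt0// lerD2l lerN2 ler_ln ?posrE ?cutoff_dist_gt0//.
rewrite ge_max le_max lexx/= le_max ler_expR lerN2 ler_nat nm orbT//.
Qed.

Lemma log_kernel_dist0 x y : dist x y = 0 -> log_kernel x y = +oo%E.
Proof.
move=> d0; rewrite /log_kernel d0 le0_lneNy//= addey//.
by rewrite gt0_muley// lte_fin divr_gt0.
Qed.

Lemma log_kernel_dist_gt0 x y : 0 < dist x y ->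
  log_kernel x y = (beta / 2 * (log1 x + log1 y - ln (dist x y)))%:E.
Proof. by move=> d0; rewrite /log_kernel lne_EFin// -EFinB -EFinM. Qed.

Lemma log_kernelP x y (Q : \bar R -> Prop) : Q +oo%E ->
  (0 < dist x y -> Q (beta / 2 * (log1 x + log1 y - ln (dist x y)))%:E) ->
  Q (log_kernel x y).
Proof.
move=> Qoo Qd; have [d0|d0] := dist_eq0_or_gt0 x y.
  by rewrite log_kernel_dist0.
by rewrite log_kernel_dist_gt0//; exact: Qd.
Qed.

Lemma cutoff_kernel_le M x y : ((cutoff_kernel M x y)%:E <= log_kernel x y)%E.
Proof.
apply: (log_kernelP (Q := fun k => (_ <= k)%E)) => [|d0]; first exact: leey.
rewrite lee_fin ler_pM2l ?divr_gt0// lerD2l lerN2 ler_ln ?posrE ?cutoff_dist_gt0//.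
by rewrite le_max lexx.
Qed.

Lemma log_kernel_ge0 x y : (0 <= log_kernel x y)%E.
Proof.
by apply: le_trans (cutoff_kernel_le 0 x y); rewrite lee_fin cutoff_kernel_ge0.
Qed.

(** Off the diagonal the sequence is stationary once [expR (- M%:R)] is below the distance; on the
    diagonal it grows linearly in [M]. *)
Lemma cutoff_kernel_cvg x y :
  (cutoff_kernel M x y)%:E @[M --> \oo] --> log_kernel x y.
Proof.
have nd : {homo (fun M => (cutoff_kernel M x y)%:E) : n m / (n <= m)%N >-> (n <= m)%E}.
  by move=> n m nm; rewrite lee_fin cutoff_kernel_nd.
suff <- : ereal_sup (range (fun M => (cutoff_kernel M x y)%:E)) = log_kernel x y.
  exact: ereal_nondecreasing_cvgn.
apply/eqP; rewrite eq_le; apply/andP; split.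
  by apply: ub_ereal_sup => _ [M _ <-]; exact: cutoff_kernel_le.
have [d0|d0] := dist_eq0_or_gt0 x y.
  rewrite log_kernel_dist0// leye_eq; apply/eqP/eq_infty => r.
  pose M := Num.bound `|r / (beta / 2)|.
  apply: (@le_trans _ _ (cutoff_kernel M x y)%:E); last by apply: ereal_sup_ubound; exists M.
  rewrite lee_fin -ler_pdivrMl ?divr_gt0// mulrC /cutoff_dist d0 max_r ?expR_ge0// expRK opprK.
  have h1 : r / (beta / 2) <= M%:R.
    exact: le_trans (ler_norm _) (ltW (archi_boundP (normr_ge0 _))).
  by rewrite (le_trans h1)// lerDr addr_ge0 ?log1_ge0.
have [M hM] : exists M : nat, expR (- M%:R) <= dist x y.
  exists (Num.bound `|- ln (dist x y)|); rewrite -[leRHS]lnK ?posrE// ler_expR lerNl.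
  exact: le_trans (ler_norm _) (ltW (archi_boundP (normr_ge0 _))).
apply: ereal_sup_ubound; exists M => //.
by rewrite log_kernel_dist_gt0// /cutoff_kernel /cutoff_dist max_l.
Qed.

Let mlog1l : measurable_fun setT (fun p : F * F => log1 p.1).
Proof. exact: measurableT_comp measurable_log1 measurable_fst. Qed.

Let mlog1r : measurable_fun setT (fun p : F * F => log1 p.2).
Proof. exact: measurableT_comp measurable_log1 measurable_snd. Qed.

Lemma measurable_cutoff_kernel M :
  measurable_fun setT (fun p : F * F => cutoff_kernel M p.1 p.2).
Proof.
apply: measurable_funM => //; apply: measurable_funB; first exact: measurable_funD.
apply: (measurableT_comp (@measurable_ln R)).
by apply: measurable_maxr => //; exact: measurable_dist.
Qed.

Lemma measurable_log_kernel :
  measurable_fun setT (fun p : F * F => log_kernel p.1 p.2).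
Proof.
apply: (emeasurable_fun_cvg (fun M p => (cutoff_kernel M p.1 p.2)%:E)).
  by move=> M; apply/measurable_EFinP; exact: measurable_cutoff_kernel.
by move=> p _; exact: cutoff_kernel_cvg.
Qed.

Lemma lne_distE x y :
  lne (dist x y)%:E = ((log1 x + log1 y)%:E - (2 / beta)%:E * log_kernel x y)%E.
Proof.
have [d0|d0] := dist_eq0_or_gt0 x y.
  rewrite log_kernel_dist0// d0 le0_lneNy// gt0_muley ?lte_fin ?divr_gt0//.
rewrite log_kernel_dist_gt0// lne_EFin// -EFinM -EFinB; congr EFin.
have b0 : beta != 0 by rewrite gt_eqF.
by field.
Qed.

Lemma measurable_lne_dist : measurable_fun setT (fun p : F * F => lne (dist p.1 p.2)%:E).
Proof.
under eq_fun do rewrite lne_distE.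
apply: emeasurable_funB; first exact/measurable_EFinP/measurable_funD.
by apply: measurable_funeM; exact: measurable_log_kernel.
Qed.

End kernel.

Section plane_measurability.
Context (R : realType).

(** The sigma-algebra on pairs is the product one, whereas openness is topological; rational boxes
    connect the two. *)
Lemma open_measurable_plane (G : set (R * R)) : open G ->
  measurable (G : set (measurableTypeR R * measurableTypeR R)).
Proof.
move=> oG.
pose box (B : (rat * rat) * (rat * rat)) : set (measurableTypeR R * measurableTypeR R) :=
  `]ratr B.1.1, ratr B.1.2[ `*` `]ratr B.2.1, ratr B.2.2[.
have -> : G = \bigcup_(B in [set B | box B `<=` G]) box B.
  apply/seteqP; split => [z Gz|z [B /= BG /BG]//].
  have /nbhs_ballP[e /= e0 eG] : nbhs z G by exact: open_nbhs_nbhs.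
  have ex (x : R) : exists q q' : rat, (x - e < ratr q < x) && (x < ratr q' < x + e).
    have [q] : exists q : rat, ratr q \in `](x - e), x[ by apply: rat_in_itvoo; rewrite gtrBl.
    have [q'] : exists q : rat, ratr q \in `]x, (x + e)[ by apply: rat_in_itvoo; rewrite ltrDl.
    by rewrite !in_itv /= => h1 h2; exists q, q'; rewrite h1 h2.
  have [q1 [r1 /andP[/andP[a1 a2] /andP[a3 a4]]]] := ex z.1.
  have [q2 [r2 /andP[/andP[b1 b2] /andP[b3 b4]]]] := ex z.2.
  exists ((q1, r1), (q2, r2)); last by split; rewrite /= in_itv/= ?a2 ?b2.
  move=> w [] /=; rewrite !in_itv/= => /andP[c1 c2] /andP[d1 d2]; apply: eG.
  split; rewrite /ball/= ltr_distlC; apply/andP; split.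
  - exact: lt_trans c1.
  - exact: lt_trans a4.
  - exact: lt_trans d1.
  - exact: lt_trans b4.
rewrite bigcup_mkcond; apply: countable_bigcupT_measurable => // B.
by case: ifP => // _; exact: measurableX.
Qed.

Lemma continuous_measurable_plane (f : R * R -> R) : continuous f ->
  measurable_fun [set: measurableTypeR R * measurableTypeR R] (f : _ -> R).
Proof.
move=> cf mD; apply: (measurability _ (RGenOInfty.measurableE R)) => //.
move=> _ [_ [a ->] <-]; rewrite setTI; apply: open_measurable_plane.
by apply: open_comp => [z _|]; [exact: cf|exact: interval_open].
Qed.

End plane_measurability.

(** * Energy through a nonnegative potential and a nonnegative kernel *)

Section energy.
Context (R : realType) (F : ambient R) (P : planar F) (beta beta' C0 : R).
Variable V : F -> R.
Hypothesis beta0 : 0 < beta.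
Hypothesis beta_lt : beta < beta'.
Hypothesis C0_ge0 : 0 <= C0.
Hypothesis V_ge0 : forall x, 0 <= V x.
Hypothesis V_cont : continuous (fun z => V (ret P z)).
Hypothesis V_growth : forall x, beta' * log1 x - C0 <= V x.
Implicit Types mu : probability F R.

Lemma measurable_V : measurable_fun setT V.
Proof.
rewrite (_ : V = (fun z => V (ret P z)) \o emb P); last first.
  by apply/funext => x /=; rewrite embK.
apply: (measurableT_comp (continuous_measurable_plane V_cont)).
by apply/measurable_fun_pairP; split; [exact: emb_measurable1|exact: emb_measurable2].
Qed.

(** Subtracting [beta * log1] pays for the terms [log1 x + log1 y] of the kernel, whose contribution
    to the double integral is [beta] times the integral of [log1]; [C0] restores nonnegativity. *)
Definition reduced_potential (x : F) : R := V x - beta * log1 x + C0.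
Local Notation W := reduced_potential.
Local Notation k := (log_kernel beta).

Lemma reduced_potential_ge x : (beta' - beta) * log1 x <= W x.
Proof. by rewrite /W; have := V_growth x; lra. Qed.

Lemma reduced_potential_ge0 x : 0 <= W x.
Proof.
apply: le_trans (reduced_potential_ge x).
by rewrite mulr_ge0 ?(log1_ge0 P)// subr_ge0 ltW.
Qed.

Lemma measurable_reduced_potential : measurable_fun setT W.
Proof.
apply: measurable_funD => //; apply: measurable_funB; first exact: measurable_V.
by apply: measurable_funM => //; exact: (measurable_log1 P).
Qed.

Local Open Scope ereal_scope.

Let ge0_neqNy (x : \bar R) : 0 <= x -> x != -oo.
Proof. by case: x. Qed.

Definition total_energy mu : \bar R := \int[mu]_x (W x)%:E + \int[mu \x mu]_p k p.1 p.2.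

Definition cutoff_energy M mu : \bar R :=
  \int[mu]_x (W x)%:E + \int[mu \x mu]_p (cutoff_kernel beta M p.1 p.2)%:E.

Let mW := measurable_reduced_potential.
Let mWE : measurable_fun setT (EFin \o W). Proof. exact/measurable_EFinP. Qed.
Let mlE : measurable_fun setT (EFin \o (@log1 R F)).
Proof. by apply/measurable_EFinP; exact: (measurable_log1 P). Qed.
Let mkE : measurable_fun setT (fun p : F * F => k p.1 p.2).
Proof. exact: measurable_log_kernel. Qed.

Let l0 (x : F) : 0 <= (log1 x)%:E.
Proof. by rewrite lee_fin; exact: (log1_ge0 P). Qed.

Lemma integral_fst mu (f : F -> \bar R) : measurable_fun setT f -> (forall x, 0 <= f x) ->
  \int[mu \x mu]_p f p.1 = \int[mu]_x f x.
Proof.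
move=> mf f0; rewrite fubini_tonelli1//=; last exact: measurableT_comp.
by apply: eq_integral => x _; rewrite /fubini_F (eq_integral (cst (f x)))// integral_cst//= probability_setT mule1.
Qed.

Lemma integral_snd mu (f : F -> \bar R) : measurable_fun setT f -> (forall x, 0 <= f x) ->
  \int[mu \x mu]_p f p.2 = \int[mu]_x f x.
Proof.
move=> mf f0; rewrite fubini_tonelli2//=; last exact: measurableT_comp.
by apply: eq_integral => x _; rewrite /fubini_G (eq_integral (cst (f x)))// integral_cst//= probability_setT mule1.
Qed.

Let L mu := \int[mu]_x (log1 x)%:E.
Let K mu := \int[mu \x mu]_p k p.1 p.2.

Let V_W mu : \int[mu]_x (V x)%:E + C0%:E = \int[mu]_x (W x)%:E + beta%:E * L mu.
Proof.
have -> : C0%:E = \int[mu]_x (cst C0%:E) x.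
  by rewrite integral_cst//= probability_setT mule1.
have mVE : measurable_fun setT (EFin \o V) by apply/measurable_EFinP; exact: measurable_V.
have V0 (x : F) : 0 <= (V x)%:E by rewrite lee_fin.
have W0 (x : F) : 0 <= (W x)%:E by rewrite lee_fin reduced_potential_ge0.
have c0 x : 0 <= cst C0%:E x :> \bar R by rewrite lee_fin.
have b0 : 0 <= beta%:E by rewrite lee_fin ltW.
have l0' := l0.
have bl0 (x : F) : 0 <= beta%:E * (log1 x)%:E by apply: mule_ge0; [exact: b0|exact: l0].
rewrite -ge0_integralD//.
rewrite -ge0_integralZl//.
rewrite -ge0_integralD//; last exact: measurable_funeM.
by apply: eq_integral => x _ /=; rewrite -EFinM -!EFinD; congr EFin; rewrite /W; ring.
Qed.

Let lne_integral mu : L mu < +oo ->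
  \int[mu \x mu]_p lne (dist p.1 p.2)%:E = L mu + L mu - (2 / beta)%:E * K mu.
Proof.
move=> Loo; have l0' := l0.
pose p (z : F * F) : R := (log1 z.1 + log1 z.2)%R.
pose q (z : F * F) := (2 / beta)%:E * k z.1 z.2.
have q0 z : 0 <= q z by rewrite mule_ge0 ?(log_kernel_ge0 P)// lee_fin divr_ge0// ltW.
have p0 z : (0 <= p z)%R by apply: addr_ge0; exact: (log1_ge0 P).
pose f z := (p z)%:E - q z.
have -> : (fun z : F * F => lne (dist z.1 z.2)%:E) = f.
  by apply/funext => z; rewrite (lne_distE P beta0).
have mp : measurable_fun setT (fun z => (p z)%:E).
  by apply/measurable_EFinP/measurable_funD;
     [apply: (measurableT_comp (measurable_log1 P))|apply: (measurableT_comp (measurable_log1 P))].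
have mq : measurable_fun setT q by exact: measurable_funeM.
have mf : measurable_fun setT f by exact: emeasurable_funB.
have ip : \int[mu \x mu]_z (p z)%:E = L mu + L mu.
  under eq_integral do rewrite EFinD.
  rewrite ge0_integralD//=.
  - by congr +%E; [apply: integral_fst|apply: integral_snd].
  - exact: (measurableT_comp mlE).
  - exact: (measurableT_comp mlE).
have iq : \int[mu \x mu]_z q z = (2 / beta)%:E * K mu.
  rewrite ge0_integralZl//; first by move=> z _; exact: (log_kernel_ge0 P).
  by rewrite lee_fin divr_ge0// ltW.
(* For [f = p - q] the identity [f^\+ + q = p + f^\-] involves nonnegative functions only, so it can
   be integrated even where [q] is infinite. Since [f^\+ <= p] is integrable, it can then be solved
   for the integral of [f]. *)
have split_pq : \int[mu \x mu]_z f^\+ z + \int[mu \x mu]_z q z =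
    \int[mu \x mu]_z (p z)%:E + \int[mu \x mu]_z f^\- z.
  rewrite -ge0_integralD//; last exact: measurable_funepos.
  rewrite -ge0_integralD//; last 2 first.
  - by move=> z _; rewrite lee_fin.
  - exact: measurable_funeneg.
  apply: eq_integral => z _; rewrite funeposE funenegE /f.
  move: (q z) (q0 z) => [r| |] //=; rewrite ?lee_fin => r0.
    rewrite -!EFinB. rewrite -!(EFin_max _ 0%R) -!EFinD; congr EFin.
    by rewrite /Num.max; do 2 case: ifPn; lra.
  by rewrite addeNy max_r ?leNye// max_l ?leey// add0e.
have fp : \int[mu \x mu]_z f^\+ z < +oo.
  apply: (@le_lt_trans _ _ (\int[mu \x mu]_z (p z)%:E)).
    apply: ge0_le_integral => //; first exact: measurable_funepos.
    move=> z _; rewrite funeposE ge_max lee_fin p0 andbT /f.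
    by rewrite lee_subel_addr// leeDl.
  by rewrite ip lte_add_pinfty.
rewrite integralE; move: split_pq; rewrite ip iq; move: fp.
have : 0 <= \int[mu \x mu]_z f^\+ z by exact: integral_ge0.
have : 0 <= \int[mu \x mu]_z f^\- z by exact: integral_ge0.
have : 0 <= (2 / beta)%:E * K mu by rewrite -iq; exact: integral_ge0.
have : 0 <= L mu by apply: integral_ge0 => x _; exact: l0.
move: Loo.
move: (L mu) ((2 / beta)%:E * K mu) (\int[mu \x mu]_z f^\+ z) (\int[mu \x mu]_z f^\- z).
move=> [l| |] [b| |] [c| |] [e| |] //= _ _ _ _ _ _.
by rewrite -!EFinD => -[h]; congr EFin; lra.
Qed.

Lemma energyE mu : energy beta V mu = total_energy mu - C0%:E.
Proof.
have VW := V_W mu.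
have W0 : 0 <= \int[mu]_x (W x)%:E.
  by apply: integral_ge0 => x _; rewrite lee_fin reduced_potential_ge0.
have V0 : 0 <= \int[mu]_x (V x)%:E by apply: integral_ge0 => x _; rewrite lee_fin.
have K0 : 0 <= K mu by apply: integral_ge0 => p _; exact: (log_kernel_ge0 P).
have L0 : 0 <= L mu by apply: integral_ge0 => x _; exact: l0.
have b2 : (0 < 2 / beta)%R by rewrite divr_gt0.
have b1 : (0 < beta / 2)%R by rewrite divr_gt0.
have bn0 : beta != 0%R by rewrite gt_eqF.
rewrite /energy /entropy -/(L mu) /total_energy -/(K mu); case: ifPn => [Loo|].
  rewrite lne_integral//.
  have Lfin : L mu \is a fin_num by rewrite ge0_fin_numE.
  move: VW; rewrite -(fineK Lfin); move: (fine (L mu)) => l.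
  case: (K mu) K0 => [c| |] // _; last first.
    rewrite gt0_muley ?lte_fin// addeNy gt0_muleNy ?lte_fin//= addey ?ge0_neqNy//.
    by rewrite addey ?ge0_neqNy.
  case: (\int[mu]_x (W x)%:E) W0 => [w| |] // _; case: (\int[mu]_x (V x)%:E) V0 => [v| |] // _.
  - rewrite -?EFinM -?EFinD => -[h]; congr EFin.
    have -> : v = (w + beta * l - C0)%R by rewrite -h; ring.
    by field.
(* If [log1] is not integrable the entropy is [-oo] by convention; [W] dominates a positive multiple
   of [log1], so the right-hand side is infinite as well. *)
rewrite -leNgt leye_eq => /eqP Loo.
rewrite gt0_muleNy ?lte_fin//= addey ?ge0_neqNy//.
suff -> : \int[mu]_x (W x)%:E = +oo by rewrite addye// ge0_neqNy.
apply/eqP; rewrite -leye_eq.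
have <- : (beta' - beta)%:E * L mu = +oo by rewrite Loo gt0_muley// lte_fin subr_gt0.
rewrite /L -ge0_integralZl//.
- apply: ge0_le_integral => //.
  + by move=> x _; apply: mule_ge0; [rewrite lee_fin subr_ge0 ltW|exact: l0].
  + exact: measurable_funeM.
  + by move=> x _; rewrite -EFinM lee_fin reduced_potential_ge.
- by rewrite lee_fin subr_ge0 ltW.
Qed.

Definition total_inf : \bar R := ereal_inf (range total_energy).

Lemma total_energy_ge0 mu : 0 <= total_energy mu.
Proof.
apply: adde_ge0; first by apply: integral_ge0 => x _; rewrite lee_fin reduced_potential_ge0.
by apply: integral_ge0 => p _; exact: (log_kernel_ge0 P).
Qed.

Lemma total_inf_ge0 : 0 <= total_inf.
Proof. by apply: le_ereal_inf_tmp => _ [mu _ <-]; exact: total_energy_ge0. Qed.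

Lemma min_energyE : min_energy beta V = total_inf - C0%:E.
Proof.
rewrite /min_energy /total_inf; apply/eqP; rewrite eq_le; apply/andP; split.
  rewrite leeBrDr//; apply: le_ereal_inf_tmp => _ [mu _ <-].
  rewrite -leeBrDr// -energyE; apply: ereal_inf_lbound; exists mu => //.
apply: le_ereal_inf_tmp => _ [mu _ <-]; rewrite energyE leeB//.
by apply: ereal_inf_lbound; exists mu.
Qed.

(** The convention [+oo] for infinite potential energy agrees with the formula: the entropy is never
    [+oo], so [energy] is then infinite too. *)
Lemma I_betaE mu : total_inf \is a fin_num ->
  I_beta beta V mu = total_energy mu - total_inf.
Proof.
move=> ifin; rewrite /I_beta min_energyE energyE; case: ifPn => [_|].
  rewrite -(fineK ifin); case: (total_energy mu) => [t| |] //=.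
  by rewrite -!EFinB; congr EFin; ring.
rewrite -leNgt leye_eq => /eqP Voo.
suff : total_energy mu = +oo by move=> ->; rewrite -(fineK ifin).
have := energyE mu; rewrite /energy Voo /entropy.
case: ifPn => [Loo|_]; last first.
  rewrite gt0_muleNy ?lte_fin ?divr_gt0//=; case: (total_energy mu) => //.
rewrite lne_integral//; have K0 : 0 <= K mu.
  by apply: integral_ge0 => p _; exact: (log_kernel_ge0 P).
have L0 : 0 <= L mu by apply: integral_ge0 => x _; exact: l0.
have Lfin : L mu \is a fin_num by rewrite ge0_fin_numE.
rewrite -(fineK Lfin); case: (K mu) K0 => [c| |] // _.
  by rewrite -?EFinM /=; case: (total_energy mu).
rewrite gt0_muley ?lte_fin ?divr_gt0//= gt0_muleNy ?lte_fin ?divr_gt0//=.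
by case: (total_energy mu).
Qed.

End energy.

Section law.
Local Open Scope ereal_scope.
Context d d' (T : measurableType d) (T' : measurableType d') (R : realType).
Variables (P : probability T R) (f : T -> T').
Hypothesis mf : measurable_fun setT f.

Lemma law_exists : exists mu : probability T' R,
  (forall A, measurable A -> mu A = P (f @^-1` A)) /\
  (forall h : T' -> \bar R, measurable_fun setT h -> (forall x, 0 <= h x) ->
     \int[mu]_x h x = \int[P]_t h (f t)).
Proof.
pose X : {mfun T >-> T'} := HB.pack f (isMeasurableFun.Build _ _ _ _ f mf).
exists (distribution P X); split => //.
by move=> h mh h0; rewrite ge0_integral_distribution.
Qed.

Lemma law_integral2 (mu : probability T' R) (h : T' * T' -> \bar R) :
  (forall h : T' -> \bar R, measurable_fun setT h -> (forall x, 0 <= h x) ->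
     \int[mu]_x h x = \int[P]_t h (f t)) ->
  measurable_fun setT h -> (forall x, 0 <= h x) ->
  \int[mu \x mu]_p h p = \int[P \x P]_p h (f p.1, f p.2).
Proof.
move=> muE mh h0; rewrite fubini_tonelli1//.
have mff : measurable_fun setT (fun p : T * T => (f p.1, f p.2)).
  by apply: measurable_fun_pair; exact: measurableT_comp.
rewrite (fubini_tonelli1 (fun p => h (f p.1, f p.2)))//; last exact: measurableT_comp mh mff.
rewrite muE; last 2 first.
- exact: measurable_fun_fubini_tonelli_F.
- by move=> x; apply: integral_ge0.
apply: eq_integral => t _; rewrite /fubini_F muE//.
exact: measurableT_comp.
Qed.

End law.

(** * Compactness of energy levels *)

Section energy_compactness.
Local Open Scope ereal_scope.
Context (R : realType) (F : ambient R) (P : planar F) (beta beta' C0 : R).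
Variable V : F -> R.
Hypothesis beta0 : (0 < beta)%R.
Hypothesis beta_lt : (beta < beta')%R.
Hypothesis V_cont : continuous (fun z => V (ret P z)).
Hypothesis V_growth : forall x, (beta' * log1 x - C0 <= V x)%R.
Implicit Types mu : probability F R.
Local Notation W := (reduced_potential beta C0 V).
Local Notation E := (total_energy beta C0 V).
Local Notation EM := (cutoff_energy beta C0 V).

Let W0 (x : F) : (0 <= W x)%R.
Proof. exact: (reduced_potential_ge0 P beta_lt V_growth). Qed.

Let mW : measurable_fun setT (EFin \o W).
Proof. by apply/measurable_EFinP; exact: (measurable_reduced_potential beta C0 V_cont). Qed.

Let mk M : measurable_fun setT (fun p : F * F => (cutoff_kernel beta M p.1 p.2)%:E).
Proof. by apply/measurable_EFinP; exact: (measurable_cutoff_kernel P beta). Qed.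

Let k0 M (x y : F) : (0 <= cutoff_kernel beta M x y)%R.
Proof. exact: (cutoff_kernel_ge0 P beta0). Qed.

(** Potential and interaction are put into one integrand on pairs, the form in which bounds pass to
    the limit. *)
Definition pair_energy M (x y : F) : R := (W x + cutoff_kernel beta M x y)%R.

Lemma cutoff_energyE M mu :
  EM M mu = \int[mu \x mu]_p (pair_energy M p.1 p.2)%:E.
Proof.
under [RHS]eq_integral do rewrite EFinD.
rewrite ge0_integralD//=.
- by congr +%E; rewrite -(integral_fst mu mW).
- by move=> p _; rewrite lee_fin.
- exact: (measurableT_comp mW).
- by move=> p _; rewrite lee_fin.
Qed.

Lemma cutoff_energy_nd mu : {homo (EM ^~ mu) : n m / (n <= m)%N >-> n <= m}.
Proof.
move=> n m nm; apply: leeD2l; apply: ge0_le_integral => //.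
- by move=> p _; rewrite lee_fin.
- by move=> p _; rewrite lee_fin cutoff_kernel_nd.
Qed.

Lemma cutoff_energy_le M mu : EM M mu <= E mu.
Proof.
apply: leeD2l; apply: ge0_le_integral => //.
- by move=> p _; rewrite lee_fin.
- exact: (measurable_log_kernel P beta0).
- by move=> p _; exact: (cutoff_kernel_le P beta0).
Qed.

(** Monotone convergence in the cut-off level; it reduces bounds on [E] to bounds on kernels that
    are finite and continuous. *)
Lemma total_energy_le mu (a : \bar R) : (forall M, EM M mu <= a) -> E mu <= a.
Proof.
move=> EMa.
have cv := @cvg_monotone_convergence _ _ _ (mu \x mu) _ measurableT
  (fun M p => (cutoff_kernel beta M p.1 p.2)%:E) mk.
have {}cv : EM M mu @[M --> \oo] --> E mu.
  apply: cvgeD => //.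
  - by rewrite ge0_adde_def// inE; apply: integral_ge0 => x _;
      [rewrite lee_fin|exact: (log_kernel_ge0 P beta0)].
  - exact: cvg_cst.
  rewrite (_ : \int[mu \x mu]_p log_kernel beta p.1 p.2 = \int[mu \x mu]_p
     limn (fun M => (cutoff_kernel beta M p.1 p.2)%:E)).
    apply: cv => [M p _|p _ n m nm]; first by rewrite lee_fin.
    by rewrite lee_fin cutoff_kernel_nd.
  apply: eq_integral => p _; apply/esym/cvg_lim => //.
  exact: (cutoff_kernel_cvg P beta0).
rewrite -(cvg_lim _ cv)//; apply: lime_le; first by apply/cvg_ex; eexists; exact: cv.
by apply: nearW.
Qed.

Lemma cutoff_energy_tail M mu (a : R) : EM M mu <= a%:E ->
  forall e : R, (0 < e)%R -> mu [set x |
    (expR ((a + 1) / (e * (beta' - beta))) <= modulus x)%R] <= e%:E.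
Proof.
move=> Ea e e0; have bb : (0 < beta' - beta)%R by rewrite subr_gt0.
have Wa : \int[mu]_x (W x)%:E <= a%:E.
  apply: le_trans Ea; rewrite leeDl//; apply: integral_ge0 => p _.
  by rewrite lee_fin.
have a0 : (0 <= a)%R.
  by rewrite -lee_fin (le_trans _ Wa)//; apply: integral_ge0 => x _; rewrite lee_fin.
(* The level for Markov's inequality applied to [W]; [a + 1] keeps it positive when [a = 0]. *)
pose t := ((a + 1) / e)%R.
have t0 : (0 < t)%R by rewrite divr_gt0// ltr_wpDl.
have mm m : measurable [set x : F | (m <= modulus x)%R].
  rewrite (_ : mkset _ = @modulus R F @^-1` `[m, +oo[).
    by rewrite -[X in measurable X]setTI; apply: (measurable_modulus P).
  by apply/seteqP; split => x /=; rewrite in_itv/= andbT.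
have mt : measurable [set x : F | t%:E <= (W x)%:E].
  by have := emeasurable_fun_c_infty measurableT mW t%:E; rewrite setTI.
apply: (@le_trans _ _ (mu [set x : F | t%:E <= (W x)%:E])).
  apply: le_measure; rewrite ?inE// => x /= mx; rewrite lee_fin.
  apply: (@le_trans _ _ ((beta' - beta) * log1 x)%R); last exact: reduced_potential_ge.
  rewrite -ler_pdivrMl// mulrC /t -mulrA -invfM -ler_expR (expR_log1 P).
  by apply: le_trans mx _; rewrite lerDl.
have := ge0_markov mu t0 mW (fun x => W0 x) => /(le_trans) /(_ Wa).
move=> h; rewrite -(lee_pmul2l (x := t%:E))//.
apply: (le_trans h); rewrite -EFinM lee_fin /t divfK ?gt_eqF//.
by rewrite lerDl.
Qed.

Lemma log1_continuous : continuous (fun z => log1 (ret P z)).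
Proof.
move=> z; rewrite /log1; under eq_fun do rewrite (modulusE P).
apply: (continuous_comp (f := fun z => (cmod (emb P (ret P z)) + 1)%R) (g := @ln R)).
  apply: cvgD; last exact: cvg_cst.
  by apply: (continuous_comp (f := fun z => emb P (ret P z)) (g := @cmod R));
    [exact: emb_ret_continuous|exact: cmod_continuous].
by apply: continuous_ln; rewrite ltr_wpDl// cmod_ge0.
Qed.

Lemma reduced_potential_continuous : continuous (fun z => W (ret P z)).
Proof.
move=> z; rewrite /reduced_potential; apply: cvgD; last exact: cvg_cst.
apply: cvgB; first exact: V_cont.
by apply: cvgM; [exact: cvg_cst|exact: log1_continuous].
Qed.

Lemma pair_energy_continuous M :
  continuous (fun p : (R * R) * (R * R) => pair_energy M (ret P p.1) (ret P p.2)).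
Proof.
have along (Y : topologicalType) (f : R * R -> Y) : continuous f ->
    continuous (fun p : (R * R) * (R * R) => f p.1) /\
    continuous (fun p : (R * R) * (R * R) => f p.2).
  move=> cf; split=> p.
    by apply: (continuous_comp (f := fst) (g := f)); [exact: cvg_fst|exact: cf].
  by apply: (continuous_comp (f := snd) (g := f)); [exact: cvg_snd|exact: cf].
have [c1 c2] := along _ _ (@emb_ret_continuous _ _ P).
have [l1 l2] := along _ _ log1_continuous.
have [w1 _] := along _ _ reduced_potential_continuous.
have cd : continuous (fun p : (R * R) * (R * R) => cutoff_dist M (ret P p.1) (ret P p.2)).
  rewrite (_ : (fun _ => _) = (fun p : (R * R) * (R * R) =>
      cmod (emb P (ret P p.1) - emb P (ret P p.2))%R) \max cst (expR (- M%:R))%R); last first.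
    by apply/funext => p; rewrite /cutoff_dist (distE P).
  move=> p; apply: continuous_max; last exact: cvg_cst.
  apply: (continuous_comp (f := fun p : (R * R) * (R * R) =>
    (emb P (ret P p.1) - emb P (ret P p.2))%R) (g := @cmod R)); last exact: cmod_continuous.
  by apply: cvgB; [exact: c1|exact: c2].
move=> p; rewrite /pair_energy; apply: cvgD; first exact: w1.
rewrite /cutoff_kernel; apply: cvgM; first exact: cvg_cst.
apply: cvgB; first by apply: cvgD; [exact: l1|exact: l2].
apply: (continuous_comp (f := fun p : (R * R) * (R * R) =>
  cutoff_dist M (ret P p.1) (ret P p.2)) (g := @ln R)).
  exact: cd.
by apply: continuous_ln; rewrite lt_max expR_gt0 orbT.
Qed.

(** The cut-off level grows with the index, so measures with atoms are allowed. For fixed [M] and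
    [n >= M] the energy at level [M] is at most that at level [n], so the limit has energy at most
    [a] at every level. *)
Lemma energy_compactness (nu : nat -> probability F R) (a : R) :
  (forall n, EM n (nu n) <= a%:E) ->
  exists (mu : probability F R) (UU : set_system nat),
    [/\ UltraFilter UU, \oo `<=` UU, E mu <= a%:E &
      forall (G : set F) (c : R), open (ret P @^-1` G) -> measurable G ->
        (\forall n \near UU, nu n G <= c%:E) -> mu G <= c%:E].
Proof.
move=> nua; have [UU [UUF ooU]] := ultraFilterLemma (@eventually_filter).
have mmod m : measurable [set x : F | (m <= modulus x)%R].
  rewrite (_ : mkset _ = @modulus R F @^-1` `[m, +oo[).
    by rewrite -[X in measurable X]setTI; apply: (measurable_modulus P).
  by apply/seteqP; split => x /=; rewrite in_itv/= andbT.
have mc (f : F -> R) m : measurable_fun setT f -> measurable [set x : F | (m <= `|f x|)%R].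
  move=> mf; rewrite (_ : mkset _ = (fun x => `|f x|)%R @^-1` `[m, +oo[).
    by rewrite -[X in measurable X]setTI; apply: (measurableT_comp (f := fun x : R => `|x|%R) _ mf).
  by apply/seteqP; split => x /=; rewrite in_itv/= andbT.
have [|X [mX1 mX2 hX]] := @plane_compactness _ _ _ UU nu (emb P) UUF
  (emb_measurable1 P) (emb_measurable2 P).
  move=> e e0; exists (expR ((a + 1) / (e * (beta' - beta)))); apply: nearW => n.
  by split; apply: le_trans (cutoff_energy_tail (nua n) e0); apply: le_measure;
    rewrite ?inE//; (exact/mc/emb_measurable1 || exact/mc/emb_measurable2 ||
    (move=> x /= h; apply: (le_trans h); rewrite (modulusE P);
     (exact: cmod_fst || exact: cmod_snd))).
pose lam : probability (measurableTypeR R) R := uniform_prob (@ltr01 R).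
have mX : measurable_fun setT (fun t => ret P (X t)).
  apply: (measurableT_comp (ret_measurable P)).
  by apply/measurable_fun_pairP; split.
have [mu [muP muI]] := law_exists lam mX.
have muI2 := law_integral2 mX muI.
have mpl (h : F -> F -> R) : measurable_fun setT (fun p : F * F => h p.1 p.2) ->
  measurable_fun [set: ((measurableTypeR R * measurableTypeR R) *
            (measurableTypeR R * measurableTypeR R))%type]
    (fun p => h (ret P p.1) (ret P p.2)).
  move=> mh; apply: (measurableT_comp mh (g := fun p : (measurableTypeR R * measurableTypeR R) *
            (measurableTypeR R * measurableTypeR R) => (ret P p.1, ret P p.2))).
  by apply: measurable_fun_pair; apply: (measurableT_comp (ret_measurable P)).
have key (h : F -> F -> R) (c : R) : (forall x y, (0 <= h x y)%R) ->
    measurable_fun setT (fun p : F * F => h p.1 p.2) ->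
    (forall (x y : R * R) (b : R), (b < h (ret P x) (ret P y))%R ->
            \forall x' \near x & y' \near y, (b <= h (ret P x') (ret P y'))%R) ->
    (\forall n \near UU, \int[nu n \x nu n]_p (h p.1 p.2)%:E <= c%:E) ->
    \int[mu \x mu]_p (h p.1 p.2)%:E <= c%:E.
  move=> h0 mh lsch hc; rewrite muI2; last 2 first.
  - exact/measurable_EFinP.
  - by move=> p; rewrite lee_fin.
  apply: (hX (fun x y => h (ret P x) (ret P y))) => //; first exact: mpl.
  by apply: filterS hc => n; under [in X in _ -> X <= _]eq_integral do rewrite !embK.
exists mu, UU; split => //.
- apply: total_energy_le => M; rewrite cutoff_energyE; apply: key.
  + by move=> x y; rewrite addr_ge0.
  + apply: measurable_funD; last exact: (measurable_cutoff_kernel P beta).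
    exact: (measurableT_comp (measurable_reduced_potential beta C0 V_cont)).
  + move=> x y b bh; have := @pair_energy_continuous M (x, y).
    by move=> /cvgr_gt /(_ _ bh); apply: filterS => -[x' y'] /= /ltW.
  + apply: ooU; exists M => // n /= Mn; rewrite -cutoff_energyE.
    by apply: le_trans (nua n); exact: cutoff_energy_nd.
move=> G c oG mG Gc.
have muG (nu' : probability F R) : \int[nu' \x nu']_p (\1_G p.1)%:E = nu' G.
  rewrite (integral_fst nu' (f := fun x => (\1_G x)%:E)).
  - by rewrite integral_indic// setIT.
  - by apply/measurable_EFinP; exact: measurable_indic.
  - by move=> x; rewrite lee_fin.
rewrite -muG; apply: (key (fun x _ => \1_G x)) => //.
- by apply: (measurableT_comp (f := \1_G : F -> R)) => //; exact: measurable_indic.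
- move=> x y b; rewrite indicE; have [|_ b1] := boolP (_ \in G).
    rewrite inE => Gx b1; exists ((ret P @^-1` G), setT) => /=.
      by split; [exact: open_nbhs_nbhs|exact: filterT].
    by move=> [x' y'] /= [Gx' _]; rewrite indicE mem_set// ltW.
  exists (setT, setT); first by split; exact: filterT.
  by move=> [x' y'] _ /=; rewrite (le_trans (ltW b1)).
- by apply: filterS Gc => n; rewrite muG.
Qed.

End energy_compactness.

(** * Upper bound on the weight *)

Section empirical_integral.
Local Open Scope ereal_scope.
Context d (T : measurableType d) (R : realType) (n : nat) (x : n.+1.-tuple T).
Local Notation L := (empirical x : probability T R).

Lemma integral_empirical (f : T -> \bar R) : measurable_fun setT f ->
  (forall t, 0 <= f t) ->
  \int[L]_t f t = (n.+1%:R^-1)%:E * \sum_(i < n.+1) f (tnth x i).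
Proof.
move=> mf f0; have c0 : (0 <= n.+1%:R^-1 :> R)%R by rewrite invr_ge0.
pose m : {measure set T -> \bar R} :=
  mscale (NngNum c0) (msum (fun k => \d_(tnth x (inord k))) n.+1).
rewrite (eq_measure_integral m); last first.
  move=> A _ _; rewrite /= /empirical /m /mscale /msum/=.
  by congr *%E; apply: eq_bigr => k _; rewrite inord_val.
rewrite ge0_integral_mscale// ge0_integral_measure_sum//; congr *%E.
by apply: eq_bigr => k _; rewrite integral_dirac// diracT mul1e inord_val.
Qed.

Lemma integral_empirical2 (f : T * T -> \bar R) : measurable_fun setT f ->
  (forall t, 0 <= f t) ->
  \int[L \x L]_p f p =
  (n.+1%:R^-1)%:E * \sum_(i < n.+1)
    ((n.+1%:R^-1)%:E * \sum_(j < n.+1) f (tnth x i, tnth x j)).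
Proof.
move=> mf f0; rewrite fubini_tonelli1// integral_empirical; last 2 first.
- exact: measurable_fun_fubini_tonelli_F.
- by move=> t; exact: integral_ge0.
congr *%E; apply: eq_bigr => i _; rewrite /fubini_F integral_empirical//.
exact: measurableT_comp.
Qed.

End empirical_integral.

Section tuple_product.
Local Open Scope ereal_scope.
Context d (T : measurableType d) (R : realType).

Lemma integral_tuple_prod (m : {sigma_finite_measure set T -> \bar R}) (rho : T -> R) (J : R) n :
  measurable_fun setT rho -> (forall x, (0 <= rho x)%R) ->
  \int[m]_x (rho x)%:E = J%:E ->
  \int[tuple_measure m n]_x (\prod_(i < n) rho (tnth x i))%:E = (J ^+ n)%:E.
Proof.
move=> mrho rho0 rhoJ.
have mp k : measurable_fun setT (fun x : k.-tuple T => (\prod_(i < k) rho (tnth x i))%:E).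
  apply/measurable_EFinP; apply: measurable_prod => i _.
  exact: (measurableT_comp mrho (measurable_tnth i)).
have p0 k (x : k.-tuple T) : 0 <= (\prod_(i < k) rho (tnth x i))%:E.
  by rewrite lee_fin prodr_ge0.
elim: n => [|n ih]; first by rewrite integral_tuple0// big_ord0 expr0.
rewrite integral_tuple_cons; [|exact: (mp n.+1)|exact: (p0 n.+1)].
have stepE a : \int[tuple_measure m n]_t
    (\prod_(i < n.+1) rho (tnth [tuple of a :: t] i))%:E = (rho a)%:E * (J ^+ n)%:E.
  have rhoa : 0 <= (rho a)%:E by rewrite lee_fin.
  rewrite -ih -ge0_integralZl//; last exact: mp.
  apply: eq_integral => t _; rewrite big_ord_recl EFinM tnth0; congr (_ * _%:E).
  by apply: eq_bigr => i _; rewrite tnthS.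
rewrite (eq_integral (fun a => (rho a)%:E * (J ^+ n)%:E)); last by move=> a _; exact: stepE.
rewrite ge0_integralZr ?rhoJ -?EFinM -?exprS//.
- exact/measurable_EFinP.
- by move=> a _; rewrite lee_fin.
- rewrite lee_fin; apply: exprn_ge0; rewrite -lee_fin -rhoJ.
  by apply: integral_ge0 => a _; rewrite lee_fin.
Qed.

End tuple_product.

Lemma sum_ord_sym (R : numDomainType) n (s : 'I_n -> 'I_n -> R) :
  (forall i j, s i j = s j i) ->
  \sum_(i < n) \sum_(j < n) s i j =
  (\sum_(i < n) \sum_(j < n | (i < j)%N) s i j) *+ 2 + \sum_(i < n) s i i.
Proof.
move=> ss.
transitivity (\sum_(i < n) (\sum_(j < n | (i < j)%N) s i j +
   (\sum_(j < n | (j < i)%N) s i j + s i i))).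
  apply: eq_bigr => i _; rewrite (bigID (fun j : 'I_n => (i < j)%N))/=; congr +%R.
  rewrite (bigD1 i) ?ltnn//= addrC; congr +%R; apply: eq_bigl => j.
  by rewrite -leqNgt ltn_neqAle andbC.
rewrite !big_split/= addrA mulr2n; congr (_ + _ + _).
rewrite (exchange_big_dep xpredT)//=; apply: eq_bigr => i _; apply: eq_bigr => j _.
exact: ss.
Qed.

(** * The weight of a configuration and the cut-off energy *)

Section weight.
Context (R : realType) (F : ambient R) (P : planar F) (beta beta' C0 : R).
Variable V : F -> R.
Hypothesis beta0 : 0 < beta.
Hypothesis beta_lt : beta < beta'.
Hypothesis V_cont : continuous (fun z => V (ret P z)).
Hypothesis V_growth : forall x, beta' * log1 x - C0 <= V x.
Local Notation W := (reduced_potential beta C0 V).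
Local Notation EM := (cutoff_energy beta C0 V).
Local Notation gM := (cutoff_kernel beta).
Local Notation weight := (@ensemble_weight R F beta V _).

Lemma measurable_weight n : measurable_fun [set: n.-tuple F] (@ensemble_weight R F beta V n).
Proof.
apply: measurable_funM.
  apply: measurable_prod => i _; under eq_fun do rewrite big_mkcond.
  apply: measurable_prod => j _; case: (ltnP i j) => _; last exact: measurable_cst.
  apply: (measurableT_comp (measurable_powR beta)).
  apply: (measurableT_comp (measurable_dist P) (g := fun x : n.-tuple F => (tnth x i, tnth x j))).
  by apply: measurable_fun_pair; exact: measurable_tnth.
apply: measurableT_comp => //; apply: measurable_funN; apply: measurable_funM => //.
apply: measurable_sum => i; exact: (measurableT_comp (measurable_V V_cont) (measurable_tnth i)).
Qed.

Lemma weight_ge0 n (x : n.-tuple F) : 0 <= weight x.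
Proof.
by rewrite mulr_ge0 ?expR_ge0// prodr_ge0// => i _; rewrite prodr_ge0// => j _; exact: powR_ge0.
Qed.

Lemma cutoff_dist_diag M (x : F) : cutoff_dist M x x = expR (- M%:R).
Proof.
rewrite /cutoff_dist max_r// (distE P) subrr /cmod/= expr0n/= addr0 sqrtr0.
exact: expR_ge0.
Qed.

(** This is [n ^ 2] times the cut-off energy of the empirical measure, diagonal included. *)
Definition pair_sum M n (x : n.-tuple F) : R :=
  n%:R * \sum_(i < n) W (tnth x i) + \sum_(i < n) \sum_(j < n) gM M (tnth x i) (tnth x j).

Lemma potential_sum n (x : n.-tuple F) : n%:R * \sum_(i < n) V (tnth x i) =
  n%:R * \sum_(i < n) W (tnth x i) + n%:R * (beta * \sum_(i < n) log1 (tnth x i)) - n%:R ^+ 2 * C0.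
Proof.
have -> : \sum_(i < n) W (tnth x i) = \sum_(i < n) V (tnth x i) -
    beta * \sum_(i < n) log1 (tnth x i) + n%:R * C0.
  rewrite /reduced_potential !big_split/= sumr_const card_ord -[C0 *+ n]mulr_natl sumrN.
  by rewrite mulr_sumr.
ring.
Qed.

(** Cutting off only increases distances. The sum over [i < j] is half of a full double sum without
    its diagonal, and each of the [n] diagonal values of [t] is [- beta * M]; hence the error
    [n * (beta * M / 2)]. *)
Lemma weight_le M n (x : n.-tuple F) :
  weight x <= expR (n%:R ^+ 2 * C0 + n%:R * (beta * M%:R / 2) - pair_sum M x).
Proof.
pose t (i j : 'I_n) := beta * ln (cutoff_dist M (tnth x i) (tnth x j)).
have tE i j : t i j = beta * (log1 (tnth x i) + log1 (tnth x j)) - 2 * gM M (tnth x i) (tnth x j).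
  by rewrite /t /cutoff_kernel; field.
have t_sym : forall i j, t i j = t j i by move=> i j; rewrite /t /cutoff_dist (distC P).
have h1 : \prod_(i < n) \prod_(j < n | (i < j)%N) dist (tnth x i) (tnth x j) `^ beta <=
    expR (\sum_(i < n) \sum_(j < n | (i < j)%N) t i j).
  rewrite expR_sum; apply: ler_prod => i _; rewrite prodr_ge0 ?expR_sum/=; last first.
    by move=> j _; exact: powR_ge0.
  apply: ler_prod => j _; rewrite powR_ge0/=.
  rewrite /t -ln_powR lnK ?posrE ?powR_gt0 ?cutoff_dist_gt0//.
  apply: ge0_ler_powR; rewrite ?nnegrE ?(dist_ge0 P)//; first exact: ltW.
    exact/ltW/cutoff_dist_gt0.
  by rewrite /cutoff_dist le_max lexx.
have h2 : \sum_(i < n) \sum_(j < n | (i < j)%N) t i j =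
    n%:R * (beta * \sum_(i < n) log1 (tnth x i)) + n%:R * (beta * M%:R / 2) -
    \sum_(i < n) \sum_(j < n) gM M (tnth x i) (tnth x j).
  have := sum_ord_sym t_sym.
  have -> : \sum_(i < n) t i i = - (n%:R * (beta * M%:R)).
    rewrite (eq_bigr (fun=> - (beta * M%:R))).
      by rewrite sumr_const card_ord mulNrn mulr_natl.
    by move=> i _; rewrite /t cutoff_dist_diag expRK mulrN.
  have -> : \sum_(i < n) \sum_(j < n) t i j = 2 * (n%:R * (beta * \sum_(i < n) log1 (tnth x i)) -
    \sum_(i < n) \sum_(j < n) gM M (tnth x i) (tnth x j)).
    under eq_bigr do under eq_bigr do rewrite tE.
    under eq_bigr do rewrite sumrB -mulr_sumr -mulr_sumr big_split/= sumr_const card_ord.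
    rewrite sumrB -!mulr_sumr big_split/= sumr_const card_ord sumrMnl.
    rewrite -!(mulr_natl (\sum_(i < n) log1 (tnth x i)) n).
    ring.
  have -> : n%:R * (beta * M%:R / 2) = n%:R * (beta * M%:R) / 2 by ring.
  set X := \sum_(i < n) \sum_(j < n | (i < j)%N) _.
  set A := n%:R * (beta * \sum_(i < n) _).
  set G := \sum_(i < n) \sum_(j < n) _.
  set D := n%:R * (beta * M%:R).
  move: X A G D => X A G D; rewrite -[X *+ 2]mulr_natl => h; lra.
apply: (le_trans (ler_wpM2r (expR_ge0 _) h1)).
rewrite -expRD ler_expR h2 potential_sum /pair_sum; lra.
Qed.

Local Open Scope ereal_scope.

Lemma cutoff_energy_empirical M n (x : n.+1.-tuple F) :
  EM M (empirical x : probability F R) = (pair_sum M x / n.+1%:R ^+ 2)%:E.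
Proof.
have mW : measurable_fun setT (EFin \o W).
  by apply/measurable_EFinP; exact: (measurable_reduced_potential beta C0 V_cont).
have W0 y : 0 <= (W y)%:E by rewrite lee_fin (reduced_potential_ge0 P beta_lt V_growth).
have k0 (p : F * F) : 0 <= (gM M p.1 p.2)%:E by rewrite lee_fin (cutoff_kernel_ge0 P beta0).
have mk : measurable_fun setT (fun p : F * F => (gM M p.1 p.2)%:E).
  by apply/measurable_EFinP; exact: (measurable_cutoff_kernel P beta).
rewrite /cutoff_energy integral_empirical// integral_empirical2//=.
rewrite sumEFin -EFinM.
under eq_bigr do rewrite sumEFin -EFinM.
rewrite sumEFin -EFinM -EFinD -mulr_sumr /pair_sum; congr EFin.
have : (n.+1%:R != 0 :> R)%R by rewrite pnatr_eq0.
by move: (n.+1%:R : R)%R => N N0; field.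
Qed.

(** A constant bound could not be integrated over the whole space. The fraction [K / n.+1] of the
    energy is spent on integrability: by the choice of [K] it yields the factor [(1 + |x|) ^- 3] for
    each point. The remaining fraction is bounded below through [a]. *)
Lemma weight_integral_le : exists J : R, (0 < J)%R /\
  forall (M K n : nat) (a : R) (A : set (n.+1.-tuple F)),
    (3 <= K%:R * (beta' - beta))%R -> (K <= n.+1)%N -> measurable A ->
    (forall x, A x -> a%:E <= EM M (empirical x : probability F R)) ->
    \int[tuple_measure (vol F) n.+1]_(x in A) (weight x)%:E <=
    (expR (n.+1%:R ^+ 2 * C0 + n.+1%:R * (beta * M%:R / 2) - n.+1%:R * (n.+1%:R - K%:R) * a)
      * J ^+ n.+1)%:E.
Proof.
pose rho (x : F) : R := ((1 + modulus x) ^- 3)%R.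
have rho0 x : (0 <= rho x)%R by rewrite invr_ge0 exprn_ge0// addr_ge0// (modulus_ge0 P).
have mrho : measurable_fun setT rho.
  rewrite (_ : rho = fun x => expR (- (3 * log1 x))%R).
    apply: measurableT_comp => //; apply: measurable_funN; apply: measurable_funM => //.
    exact: (measurable_log1 P).
  apply/funext => x; rewrite expRN mulrC expRM_natr (expR_log1 P) /rho addrC//.
have J0 : 0 <= \int[vol F]_x (rho x)%:E by apply: integral_ge0 => x _; rewrite lee_fin.
have Jfin : \int[vol F]_x (rho x)%:E \is a fin_num.
  by rewrite ge0_fin_numE//; exact: (vol_decay P).
pose J := fine (\int[vol F]_x (rho x)%:E).
have J0' : (0 <= J)%R by exact: fine_ge0.
(* Adding [1] ensures positivity, as the logarithm of this constant is taken later. *)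
exists (J + 1)%R; split; first by rewrite ltr_wpDl.
move=> M K n a A K3 Kn mA aA.
set c := expR _; set N : R := n.+1%:R.
have N0 : (0 < N)%R by rewrite ltr0n.
have mp : measurable_fun setT (fun x : n.+1.-tuple F => (\prod_(i < n.+1) rho (tnth x i))%R).
  by apply: measurable_prod => i _; exact: (measurableT_comp mrho (measurable_tnth i)).
have pw (x : n.+1.-tuple F) : A x -> (weight x <= c * \prod_(i < n.+1) rho (tnth x i))%R.
  move=> /aA; rewrite cutoff_energy_empirical lee_fin ler_pdivlMr ?exprn_gt0// -/N => aS.
  apply: (le_trans (weight_le M x)).
  have -> : (\prod_(i < n.+1) rho (tnth x i) = expR (- (3 * \sum_(i < n.+1) log1 (tnth x i))))%R.
    rewrite mulr_sumr -sumrN expR_sum; apply: eq_bigr => i _.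
    by rewrite expRN mulrC expRM_natr (expR_log1 P) /rho addrC.
  rewrite -expRD ler_expR -/N.
  have S1 : (3 * \sum_(i < n.+1) log1 (tnth x i) <= K%:R * \sum_(i < n.+1) W (tnth x i))%R.
    rewrite !mulr_sumr; apply: ler_sum => i _.
    have := reduced_potential_ge beta V_growth (tnth x i).
    have := log1_ge0 P (tnth x i).
    have : (0 <= K%:R :> R)%R by [].
    move: K3; move: (log1 _) (W _) (K%:R : R) => l w k; nra.
  have S2 : (K%:R * \sum_(i < n.+1) W (tnth x i) <= K%:R / N * pair_sum M x)%R.
    rewrite -mulrA ler_wpM2l// ler_pdivlMl// /pair_sum lerDl.
    by apply: sumr_ge0 => i _; apply: sumr_ge0 => j _; exact: (cutoff_kernel_ge0 P beta0).
  have S3 : (N * (N - K%:R) * a <= (1 - K%:R / N) * pair_sum M x)%R.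
    have -> : (N * (N - K%:R) * a = (1 - K%:R / N) * (a * N ^+ 2))%R by field; rewrite gt_eqF.
    by rewrite ler_wpM2l// subr_ge0 ler_pdivrMr// mul1r ler_nat.
  move: S1 S2 S3; rewrite mulrBl mul1r.
  move: (pair_sum M x) (K%:R / N * pair_sum M x)%R => ? ?.
  move: (N * (N - K%:R) * a)%R (K%:R * \sum_(i < n.+1) W _)%R => ? ?.
  move: (3 * \sum_(i < n.+1) log1 _)%R => ?; lra.
apply: (@le_trans _ _ (\int[tuple_measure (vol F) n.+1]_(x in A)
    (c * \prod_(i < n.+1) rho (tnth x i))%:E)).
  apply: ge0_le_integral => //.
  - by move=> x _; rewrite lee_fin weight_ge0.
  - by apply/measurable_funTS/measurable_EFinP; exact: measurable_weight.
  - by apply/measurable_funTS/measurable_EFinP; exact: measurable_funM.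
have c0 x : 0 <= (c * \prod_(i < n.+1) rho (tnth x i))%:E.
  by rewrite lee_fin mulr_ge0 ?expR_ge0// prodr_ge0.
apply: (@le_trans _ _ (\int[tuple_measure (vol F) n.+1]_x
    (c * \prod_(i < n.+1) rho (tnth x i))%:E)).
  apply: ge0_subset_integral => //.
  by apply/measurable_EFinP; exact: measurable_funM.
under eq_integral do rewrite EFinM.
rewrite ge0_integralZl//; last 3 first.
- exact/measurable_EFinP.
- by move=> x _; rewrite lee_fin prodr_ge0.
- by rewrite lee_fin expR_ge0.
rewrite (integral_tuple_prod (J := J))//; last by rewrite fineK.
by rewrite -EFinM lee_fin ler_wpM2l ?expR_ge0// lerXn2r ?nnegrE ?addr_ge0// lerDl.
Qed.

(** The corrections of order [n] are absorbed into [e * n^2]. The threshold on [n] is uniform over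
    the events [A]. *)
Lemma weight_integral_bound (M : nat) (a e : R) : (0 < e)%R ->
  \forall n \near \oo, forall A : set (n.+1.-tuple F), measurable A ->
    (forall x, A x -> a%:E <= EM M (empirical x : probability F R)) ->
    \int[tuple_measure (vol F) n.+1]_(x in A) (weight x)%:E <=
    (expR (n.+1%:R ^+ 2 * (C0 - a + e)))%:E.
Proof.
move=> e0; have [J [J0 HJ]] := weight_integral_le.
have bb : (0 < beta' - beta)%R by rewrite subr_gt0.
pose K := (Num.bound (3 / (beta' - beta))%R).
have K3 : (3 <= K%:R * (beta' - beta))%R.
  by rewrite -ler_pdivrMr// ltW// archi_boundP// divr_ge0// ltW.
(* The coefficient of the terms linear in the number of points: diagonal, spent fraction of the
   energy, and integral of the decay factor. *)
pose D := (beta * M%:R / 2 + K%:R * a + ln J)%R.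
near=> n => A mA aA.
have Kn : (K <= n.+1)%N by near: n; exists K => // n /= /leqW.
apply: (le_trans (HJ M K n a A K3 Kn mA aA)).
rewrite lee_fin -[in leLHS](lnK (x := J)) ?posrE// -expRM_natl -expRD ler_expR.
set N : R := n.+1%:R.
have N0 : (0 < N)%R by rewrite ltr0n.
have DN : (D <= N * e)%R.
  rewrite -ler_pdivrMr// (le_trans (ler_norm _))// /N.
  apply: ltW; apply: lt_le_trans (archi_boundP (normr_ge0 _)) _.
  rewrite ler_nat; near: n; exists (Num.bound `|D / e|%R) => // n /= /leqW//.
have : (N * D <= N * (N * e))%R by rewrite ler_pM2l.
rewrite /D; lra.
Unshelve. all: by end_near. Qed.

End weight.

(** * Lower bound on the weight for bounded densities *)

Section tuple_moments.
Local Open Scope ereal_scope.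
Context d (T : measurableType d) (R : realType) (nu : probability T R).

Lemma integral_cst_prob (r : \bar R) : \int[nu]_x cst r x = r.
Proof. by rewrite -[RHS]mule1 -(probability_setT nu); exact: integral_cst. Qed.

Lemma integral_cst_tuple n (r : \bar R) : \int[tuple_measure nu n]_x cst r x = r.
Proof.
by rewrite -[RHS]mule1 -(tuple_measure_prob nu n); exact: (integral_cst _ measurableT r).
Qed.

Lemma integral_tuple_sum (f : T -> \bar R) n : measurable_fun setT f -> (forall x, 0 <= f x) ->
  \int[tuple_measure nu n]_x (\sum_(i < n) f (tnth x i)) = n%:R%:E * \int[nu]_x f x.
Proof.
move=> mf f0.
have ms k : measurable_fun setT (fun x : k.-tuple T => \sum_(i < k) f (tnth x i)).
  by apply: emeasurable_sum => i; exact: (measurableT_comp mf (measurable_tnth i)).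
have s0 k (x : k.-tuple T) : 0 <= \sum_(i < k) f (tnth x i) by exact: sume_ge0.
elim: n => [|n ih]; first by rewrite integral_tuple0// big_ord0 mul0e.
rewrite integral_tuple_cons; [|exact: (ms n.+1)|exact: (s0 n.+1)].
have I0 : 0 <= \int[nu]_x f x by exact: integral_ge0.
have stepE a : \int[tuple_measure nu n]_t (\sum_(i < n.+1) f (tnth [tuple of a :: t] i)) =
    f a + n%:R%:E * \int[nu]_x f x.
  have msn := ms n; have s0n := s0 n.
  rewrite -ih; transitivity (\int[tuple_measure nu n]_t (cst (f a) t + \sum_(i < n) f (tnth t i))).
    apply: eq_integral => t _; rewrite big_ord_recl tnth0; congr +%E.
    by apply: eq_bigr => i _; rewrite tnthS.
  rewrite ge0_integralD//; last by move=> t _; exact: f0.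
  by rewrite integral_cst_tuple.
rewrite (eq_integral (fun a => f a + cst (n%:R%:E * \int[nu]_x f x) a)); last first.
  by move=> a _; exact: stepE.
rewrite ge0_integralD//; last by move=> a _ /=; rewrite mule_ge0// lee_fin.
rewrite integral_cst_prob.
by rewrite -[X in X + _]mul1e -ge0_muleDl ?lee_fin// -EFinD -natr1 addrC.
Qed.

(** The number of pairs is kept as a sum because the induction adds the [n] pairs formed with the
    new head. *)
Lemma integral_tuple_pairs (g : T * T -> \bar R) n : measurable_fun setT g -> (forall x, 0 <= g x) ->
  \int[tuple_measure nu n]_x (\sum_(i < n) \sum_(j < n | (i < j)%N) g (tnth x i, tnth x j)) =
  (\sum_(i < n) (i : nat))%:R%:E * \int[nu \x nu]_p g p.
Proof.
move=> mg g0.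
have s0 k (x : k.-tuple T) :
    0 <= \sum_(i < k) \sum_(j < k | (i < j)%N) g (tnth x i, tnth x j).
  by apply: sume_ge0 => i _; exact: sume_ge0.
have mg2 k (i j : 'I_k) : measurable_fun setT (fun x : k.-tuple T => g (tnth x i, tnth x j)).
  apply: (measurableT_comp mg (g := fun x : k.-tuple T => (tnth x i, tnth x j))).
  by apply: measurable_fun_pair; exact: measurable_tnth.
have ms k : measurable_fun setT (fun x : k.-tuple T =>
    \sum_(i < k) \sum_(j < k | (i < j)%N) g (tnth x i, tnth x j)).
  apply: emeasurable_sum => i; under eq_fun do rewrite big_mkcond.
  by apply: emeasurable_sum => j; case: (ltnP i j) => _; [exact: mg2|exact: measurable_cst].
elim: n => [|n ih]; first by rewrite integral_tuple0// !big_ord0 mul0e.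
rewrite integral_tuple_cons; [|exact: (ms n.+1)|exact: (s0 n.+1)].
have I0 : 0 <= \int[nu \x nu]_x g x by exact: integral_ge0.
have mga a : measurable_fun setT (fun y => g (a, y)) by exact: measurableT_comp.
have stepE a : \int[tuple_measure nu n]_t (\sum_(i < n.+1) \sum_(j < n.+1 | (i < j)%N)
      g (tnth [tuple of a :: t] i, tnth [tuple of a :: t] j)) =
    n%:R%:E * (\int[nu]_y g (a, y)) + (\sum_(i < n) (i : nat))%:R%:E * \int[nu \x nu]_p g p.
  have msn := ms n; have s0n := s0 n.
  have A0 (t : n.-tuple T) : 0 <= \sum_(i < n) g (a, tnth t i) by exact: sume_ge0.
  have mA : measurable_fun setT (fun t : n.-tuple T => \sum_(i < n) g (a, tnth t i)).
    by apply: emeasurable_sum => i; exact: (measurableT_comp (mga a) (measurable_tnth i)).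
  rewrite -ih -(integral_tuple_sum n (mga a))// -ge0_integralD//.
  apply: eq_integral => t _; rewrite big_ord_recl; congr +%E.
    rewrite big_mkcond big_ord_recl/= add0e; apply: eq_bigr => j _.
    by rewrite tnth0 tnthS.
  apply: eq_bigr => i _; rewrite big_mkcond big_ord_recl/= add0e -big_mkcond.
  by apply: eq_big => // j _; rewrite !tnthS.
rewrite (eq_integral (fun a => n%:R%:E * (\int[nu]_y g (a, y)) +
    cst ((\sum_(i < n) (i : nat))%:R%:E * \int[nu \x nu]_p g p) a)); last first.
  by move=> a _; exact: stepE.
have mG : measurable_fun setT (fun a => \int[nu]_y g (a, y)).
  exact: (measurable_fun_fubini_tonelli_F g).
have G0 a : 0 <= \int[nu]_y g (a, y) by exact: integral_ge0.
have n0 k : 0 <= (k%:R : R)%:E by rewrite lee_fin.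
have hA a : 0 <= n%:R%:E * \int[nu]_y g (a, y) by exact: mule_ge0.
have mA : measurable_fun setT (fun a => n%:R%:E * \int[nu]_y g (a, y)) by exact: measurable_funeM.
have hB (a : T) : 0 <= cst ((\sum_(i < n) (i : nat))%:R%:E * \int[nu \x nu]_p g p) a.
  exact: mule_ge0.
rewrite ge0_integralD//.
rewrite integral_cst_prob ge0_integralZl//.
rewrite [X in _ * X + _](_ : _ = \int[nu \x nu]_p g p); last by rewrite fubini_tonelli1.
by rewrite -ge0_muleDl ?lee_fin// -EFinD -natrD big_ord_recr/= addnC.
Qed.

End tuple_moments.

Lemma double_sum_ord n : ((\sum_(i < n) (i : nat)) * 2 + n = n * n)%N.
Proof.
elim: n => [|n ih]; rewrite ?big_ord0// big_ord_recr/=.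
rewrite mulSn [(n * n.+1)%N]mulnS -ih mulnDl [(n * 2)%N]muln2 -addnn addnC; congr (_ + _)%N.
by rewrite addnCA.
Qed.

(** * Fluctuations of the number of points in a set *)

Section count.
Local Open Scope ereal_scope.
Context d (T : measurableType d) (R : realType) (nu : probability T R) (U : set T).
Hypothesis mU : measurable U.

Definition count_in n (x : n.-tuple T) : R := (\sum_(i < n) \1_U (tnth x i))%R.

Lemma measurable_count n : measurable_fun setT (@count_in n).
Proof.
apply: measurable_sum => i.
by apply: (measurableT_comp (f := \1_U : T -> R)); [exact: measurable_indic|exact: measurable_tnth].
Qed.

(** An indicator equals its square, so the squared count is the count plus twice the sum over pairs,
    whose expectation factorises. The variance is [N * p * (1 - p)]. *)
Lemma chebyshev_count n (e : R) : (0 < e)%R ->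
  tuple_measure nu n.+1 [set x | (e <= `|count_in x / n.+1%:R - fine (nu U)|)%R] <=
  (1 / (n.+1%:R * e ^+ 2))%:E.
Proof.
move=> e0; set p := fine (nu U); set N : R := n.+1%:R.
have N0 : (0 < N)%R by rewrite ltr0n.
have nuU : nu U = p%:E by rewrite fineK// fin_num_measure.
have p0 : (0 <= p)%R by exact: fine_ge0.
have p1 : (p <= 1)%R by rewrite -lee_fin -nuU probability_le1.
have m1 : measurable_fun setT (EFin \o (\1_U : T -> R)).
  by apply/measurable_EFinP; exact: measurable_indic.
have I1 : \int[nu]_x (\1_U x)%:E = p%:E by rewrite integral_indic// setIT; exact: nuU.
have ES : \int[tuple_measure nu n.+1]_x (count_in x)%:E = (N * p)%:E.
  under eq_integral do rewrite /count_in -sumEFin.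
  rewrite (integral_tuple_sum _ _ m1)//; last by move=> x; rewrite lee_fin.
  by rewrite I1.
pose g (z : T * T) : \bar R := (\1_U z.1 * \1_U z.2)%:E.
have mg : measurable_fun setT g.
  apply/measurable_EFinP; apply: measurable_funM;
    by apply: (measurableT_comp (f := \1_U : T -> R)) => //; exact: measurable_indic.
have g0 z : 0 <= g z by rewrite lee_fin mulr_ge0.
have Eg : \int[nu \x nu]_z g z = (p * p)%:E.
  rewrite (fubini_tonelli1 g)// /fubini_F.
  rewrite (eq_integral (fun x => (\1_U x)%:E * p%:E)); last first.
    move=> x _; under eq_integral do rewrite /g/= EFinM.
    by rewrite ge0_integralZl// I1.
  by rewrite ge0_integralZr// I1.
pose D (x : n.+1.-tuple T) : R := (count_in x - N * p)%R.
have mD2 : measurable_fun setT (fun x => ((D x) ^+ 2)%:E).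
  by apply/measurable_EFinP/measurable_funX/measurable_funB => //; exact: measurable_count.
have mS := @measurable_count n.+1.
have S0 (x : n.+1.-tuple T) : (0 <= count_in x)%R by apply: sumr_ge0.
have ES2 : \int[tuple_measure nu n.+1]_x ((count_in x) ^+ 2)%:E = (N * p + (N ^+ 2 - N) * p ^+ 2)%:E.
  have sq (x : n.+1.-tuple T) : ((count_in x) ^+ 2)%:E = (count_in x)%:E +
      2%:E * \sum_(i < n.+1) \sum_(j < n.+1 | (i < j)%N) g (tnth x i, tnth x j).
    under eq_bigr do rewrite sumEFin.
    rewrite sumEFin -EFinM -EFinD; congr EFin.
    have := @sum_ord_sym R n.+1 (fun i j => \1_U (tnth x i) * \1_U (tnth x j))%R (fun i j => mulrC _ _).
    have -> : (\sum_(i < n.+1) \1_U (tnth x i) * \1_U (tnth x i) = count_in x)%R.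
      apply: eq_bigr => i _; rewrite indicE; case: (_ \in U) => /=; first by rewrite mulr1.
      by rewrite mulr0.
    have -> : (\sum_(i < n.+1) \sum_(j < n.+1) \1_U (tnth x i) * \1_U (tnth x j) = count_in x ^+ 2)%R.
      by rewrite expr2 /count_in mulr_suml; apply: eq_bigr => i _; rewrite mulr_sumr.
    by move=> ->; rewrite mulr_natl addrC.
  under eq_integral do rewrite sq.
  have mpr : measurable_fun setT (fun x : n.+1.-tuple T =>
      \sum_(i < n.+1) \sum_(j < n.+1 | (i < j)%N) g (tnth x i, tnth x j)).
    apply: emeasurable_sum => i; under eq_fun do rewrite big_mkcond.
    apply: emeasurable_sum => j; case: (ltnP i j) => _; last exact: measurable_cst.
    apply: (measurableT_comp mg (g := fun x : n.+1.-tuple T => (tnth x i, tnth x j))).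
    by apply: measurable_fun_pair; exact: measurable_tnth.
  have pr0 (x : n.+1.-tuple T) :
      0 <= \sum_(i < n.+1) \sum_(j < n.+1 | (i < j)%N) g (tnth x i, tnth x j).
    by apply: sume_ge0 => i _; exact: sume_ge0.
  rewrite ge0_integralD//; last 4 first.
  - by move=> x _; rewrite lee_fin.
  - exact/measurable_EFinP.
  - by move=> x _; apply: mule_ge0.
  - exact: measurable_funeM.
  rewrite ES ge0_integralZl// integral_tuple_pairs// Eg -!EFinM -EFinD; congr EFin.
  congr (_ + _)%R.
  have : ((\sum_(i < n.+1) (i : nat))%:R * 2 + N = N * N :> R)%R.
    by rewrite -natrM -natrD double_sum_ord natrM.
  by move: (_%:R : R)%R => s h; rewrite !expr2 -h; ring.
have ED : \int[tuple_measure nu n.+1]_x ((D x) ^+ 2)%:E = (N * p * (1 - p))%:E.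
  have Np0 : (0 <= 2 * (N * p))%R by rewrite mulr_ge0// mulr_ge0// ltW.
  (* The cross term of the square is moved to the other side, so that only nonnegative functions are
     integrated. *)
  have eq1 : \int[tuple_measure nu n.+1]_x (((D x) ^+ 2)%:E + (2 * (N * p))%:E * (count_in x)%:E) =
      \int[tuple_measure nu n.+1]_x ((count_in x ^+ 2)%:E + cst ((N * p) ^+ 2)%:E x).
    by apply: eq_integral => x _ /=; rewrite -EFinM -!EFinD; congr EFin; rewrite /D; ring.
  move: eq1; rewrite ge0_integralD//; last 3 first.
  - by move=> x _; rewrite lee_fin sqr_ge0.
  - by move=> x _; rewrite -EFinM lee_fin mulr_ge0.
  - by apply: measurable_funeM; exact/measurable_EFinP.
  rewrite ge0_integralD//; last 3 first.
  - by move=> x _; rewrite lee_fin sqr_ge0.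
  - by apply/measurable_EFinP; exact: measurable_funX.
  - by move=> x _ /=; rewrite lee_fin sqr_ge0.
  rewrite ge0_integralZl//; last 2 first.
  - exact/measurable_EFinP.
  - by move=> x _; rewrite lee_fin.
  rewrite ES ES2 integral_cst_tuple.
  case: (\int[_]_x _) => [r| |] //.
  rewrite -EFinM -!EFinD => -[h]; congr EFin.
  by apply: (addIr (2 * (N * p) * (N * p))%R); rewrite h; ring.
have e2 : (0 < (N * e) ^+ 2)%R by rewrite exprn_gt0// mulr_gt0.
have D0 x : 0 <= ((D x) ^+ 2)%:E by rewrite lee_fin sqr_ge0.
have := ge0_markov (tuple_measure nu n.+1) e2 mD2 D0; rewrite ED.
have -> : [set x | ((N * e) ^+ 2)%:E <= ((D x) ^+ 2)%:E] =
    [set x | (e <= `|count_in x / N - p|)%R].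
  have E (x : n.+1.-tuple T) : ((N * e) ^+ 2 <= D x ^+ 2)%R = (e <= `|count_in x / N - p|)%R.
    rewrite -(real_normK (num_real (D x))) ler_pXn2r ?nnegrE ?normr_ge0//; last first.
      by rewrite mulr_ge0// ltW.
    have -> : D x = (N * (count_in x / N - p))%R.
      by rewrite /D mulrBr mulrCA divff ?mulr1// gt_eqF.
    by rewrite normrM (gtr0_norm N0) ler_pM2l.
  by apply/seteqP; split => x /=; rewrite lee_fin E.
move=> h; rewrite -(lee_pmul2l (x := ((N * e) ^+ 2)%:E))//.
apply: (le_trans h); rewrite -EFinM lee_fin.
have -> : ((N * e) ^+ 2 * (1 / (N * e ^+ 2)) = N)%R by field; rewrite !gt_eqF.
by rewrite -mulrA; apply: ler_piMr; [exact: ltW|nra].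
Qed.

End count.

Lemma near_ler_nat (R : realType) (D : R) : \forall n \near \oo, D <= n.+1%:R.
Proof.
exists (Num.bound `|D|) => // n /= Dn; apply: (le_trans (ler_norm D)).
apply: ltW; apply: lt_le_trans (archi_boundP (normr_ge0 D)) _.
by rewrite ler_nat (leq_trans Dn).
Qed.

(** * Lower bound by independent sampling *)

Section lower_bound_dominated.
Context (R : realType) (F : ambient R) (P : planar F) (beta beta' C0 : R).
Variable V : F -> R.
Hypothesis beta0 : 0 < beta.
Hypothesis beta_lt : beta < beta'.
Hypothesis V_cont : continuous (fun z => V (ret P z)).
Hypothesis V_growth : forall x, beta' * log1 x - C0 <= V x.
Local Notation W := (reduced_potential beta C0 V).
Local Notation E := (total_energy beta C0 V).
Local Notation k := (log_kernel beta).
Local Notation weight := (@ensemble_weight R F beta V _).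
Local Open Scope ereal_scope.

(** For distinct points this is [n ^ 2 * C0] minus the logarithm of the weight. The last term arises
    because a point lies in [n - 1] pairs, while [n * V] contains [n * beta] times its [log1]. *)
Definition pair_functional n (x : n.-tuple F) : \bar R :=
  2%:E * \sum_(i < n) \sum_(j < n | (i < j)%N) k (tnth x i) (tnth x j) +
  (n%:R%:E * \sum_(i < n) (W (tnth x i))%:E + beta%:E * \sum_(i < n) (log1 (tnth x i))%:E).

Let k0 (p : F * F) : 0 <= k p.1 p.2. Proof. exact: (log_kernel_ge0 P). Qed.
Let W0 (y : F) : 0 <= (W y)%:E.
Proof. by rewrite lee_fin (reduced_potential_ge0 P beta_lt V_growth). Qed.
Let l0 (y : F) : 0 <= (log1 y)%:E. Proof. by rewrite lee_fin; exact: (log1_ge0 P). Qed.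
Let mk : measurable_fun setT (fun p : F * F => k p.1 p.2).
Proof. exact: (measurable_log_kernel P). Qed.
Let mW : measurable_fun setT (EFin \o W).
Proof. by apply/measurable_EFinP; exact: (measurable_reduced_potential beta C0 V_cont). Qed.
Let ml : measurable_fun setT (EFin \o (@log1 R F)).
Proof. by apply/measurable_EFinP; exact: (measurable_log1 P). Qed.

Let pairs0 n (x : n.-tuple F) :
  0 <= \sum_(i < n) \sum_(j < n | (i < j)%N) k (tnth x i) (tnth x j).
Proof. by apply: sume_ge0 => i _; apply: sume_ge0 => j _; exact: (k0 (_, _)). Qed.

Lemma weight_ge n (x : n.-tuple F) (b : R) : pair_functional x <= b%:E ->
  (expR (n%:R ^+ 2 * C0 - b) <= weight x)%R.
Proof.
have nN (y : \bar R) : 0 <= y -> y != -oo by case: y.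
move=> Phib.
have Phi_fin : \sum_(i < n) \sum_(j < n | (i < j)%N) k (tnth x i) (tnth x j) < +oo.
  rewrite ltey; apply/eqP => S; move: Phib; rewrite /pair_functional S gt0_muley ?lte_fin//.
  by rewrite !sumEFin -!EFinM -EFinD addye//.
(* A finite functional forces the points to be distinct, so all logarithms of distances are real. *)
have d0 (i j : 'I_n) : (i < j)%N -> (0 < dist (tnth x i) (tnth x j))%R.
  move=> ij; have [d|//] := dist_eq0_or_gt0 P (tnth x i) (tnth x j).
  move: Phi_fin; rewrite ltNge leye_eq => /negP[]; apply/eqP.
  rewrite (bigD1 i)//= (bigD1 j)//= (log_kernel_dist0 beta0 d).
  rewrite addye; last by apply: nN; apply: sume_ge0 => j' _; exact: (k0 (_, _)).
  rewrite addye//; apply: nN; apply: sume_ge0 => i' _.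
  by apply: sume_ge0 => j' _; exact: (k0 (_, _)).
pose kr (i j : 'I_n) := (beta / 2 * (log1 (tnth x i) + log1 (tnth x j) - ln (dist (tnth x i) (tnth x j))))%R.
have kE : \sum_(i < n) \sum_(j < n | (i < j)%N) k (tnth x i) (tnth x j) =
    (\sum_(i < n) \sum_(j < n | (i < j)%N) kr i j)%:E.
  rewrite -sumEFin; apply: eq_bigr => i _; rewrite -sumEFin; apply: eq_bigr => j ij.
  by rewrite log_kernel_dist_gt0// d0.
have wE : (\prod_(i < n) \prod_(j < n | (i < j)%N) dist (tnth x i) (tnth x j) `^ beta =
    expR (\sum_(i < n) \sum_(j < n | (i < j)%N) beta * ln (dist (tnth x i) (tnth x j))))%R.
  rewrite expR_sum; apply: eq_bigr => i _; rewrite expR_sum; apply: eq_bigr => j ij.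
  by rewrite -ln_powR lnK// posrE powR_gt0// d0.
have ll : (\sum_(i < n) \sum_(j < n | (i < j)%N) (log1 (tnth x i) + log1 (tnth x j)) =
   (n%:R - 1) * \sum_(i < n) log1 (tnth x i))%R.
  have := @sum_ord_sym R n (fun i j => log1 (tnth x i) + log1 (tnth x j))%R (fun i j => addrC _ _).
  under eq_bigr do rewrite big_split/= sumr_const card_ord.
  rewrite !big_split/= sumr_const card_ord sumrMnl.
  rewrite -!(mulr_natl (\sum_(i < n) log1 (tnth x i)) n).
  set X := (\sum_(i < n) \sum_(j < n | (i < j)%N) _)%R; set L := (\sum_(i < n) log1 _)%R.
  by rewrite -(mulr_natl X 2) => h; lra.
have ksum : (2 * \sum_(i < n) \sum_(j < n | (i < j)%N) kr i j =
   beta * ((n%:R - 1) * \sum_(i < n) log1 (tnth x i)) -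
   \sum_(i < n) \sum_(j < n | (i < j)%N) beta * ln (dist (tnth x i) (tnth x j)))%R.
  rewrite -ll !mulr_sumr -sumrB; apply: eq_bigr => i _.
  rewrite !mulr_sumr -sumrB; apply: eq_bigr => j _.
  by rewrite /kr; field.
move: Phib; rewrite /pair_functional kE !sumEFin -!EFinM -!EFinD lee_fin ksum => Phib.
rewrite /ensemble_weight wE -expRD ler_expR (potential_sum beta C0).
move: Phib; move: (\sum_(i < n) \sum_(j < n | _) _)%R (\sum_(i < n) W _)%R (\sum_(i < n) log1 _)%R.
by move=> X Y Z; lra.
Qed.

Lemma measurable_pair_functional n : measurable_fun setT (@pair_functional n).
Proof.
apply: emeasurable_funD.
  apply: measurable_funeM; apply: emeasurable_sum => i; under eq_fun do rewrite big_mkcond.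
  apply: emeasurable_sum => j; case: (ltnP i j) => _; last exact: measurable_cst.
  apply: (measurableT_comp mk (g := fun x : n.-tuple F => (tnth x i, tnth x j))).
  by apply: measurable_fun_pair; exact: measurable_tnth.
apply: emeasurable_funD; apply: measurable_funeM; apply: emeasurable_sum => i.
  exact: (measurableT_comp mW (measurable_tnth i)).
exact: (measurableT_comp ml (measurable_tnth i)).
Qed.

Lemma pair_functional_ge0 n (x : n.-tuple F) : 0 <= pair_functional x.
Proof.
have b0 : 0 <= beta%:E by rewrite lee_fin ltW.
apply: adde_ge0; first by apply: mule_ge0.
by apply: adde_ge0; apply: mule_ge0 => //; exact: sume_ge0.
Qed.

(** Independent samples see the kernel off the diagonal only: there are [n * (n - 1)] ordered pairs,
    and [n ^ 2] bounds their number. *)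
Lemma expectation_pair_functional (nu : probability F R) n :
  \int[tuple_measure nu n]_x pair_functional x <=
  (n%:R ^+ 2)%:E * E nu + (n%:R * beta)%:E * \int[nu]_x (log1 x)%:E.
Proof.
have b0 : 0 <= beta%:E by rewrite lee_fin ltW.
have mS (f : F -> \bar R) : measurable_fun setT f ->
   measurable_fun setT (fun x : n.-tuple F => \sum_(i < n) f (tnth x i)).
  by move=> mf; apply: emeasurable_sum => i; exact: (measurableT_comp mf (measurable_tnth i)).
have mP : measurable_fun setT (fun x : n.-tuple F =>
    \sum_(i < n) \sum_(j < n | (i < j)%N) k (tnth x i) (tnth x j)).
  apply: emeasurable_sum => i; under eq_fun do rewrite big_mkcond.
  apply: emeasurable_sum => j; case: (ltnP i j) => _; last exact: measurable_cst.
  apply: (measurableT_comp mk (g := fun x : n.-tuple F => (tnth x i, tnth x j))).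
  by apply: measurable_fun_pair; exact: measurable_tnth.
have mSW := mS _ mW; have mSl := mS _ ml.
have SW0 (x : n.-tuple F) : 0 <= \sum_(i < n) (W (tnth x i))%:E by exact: sume_ge0.
have Sl0 (x : n.-tuple F) : 0 <= \sum_(i < n) (log1 (tnth x i))%:E by exact: sume_ge0.
have n0 : 0 <= (n%:R : R)%:E by rewrite lee_fin.
have a1 (x : n.-tuple F) : 0 <= n%:R%:E * \sum_(i < n) (W (tnth x i))%:E by exact: mule_ge0.
have a2 (x : n.-tuple F) : 0 <= beta%:E * \sum_(i < n) (log1 (tnth x i))%:E by exact: mule_ge0.
have m1 : measurable_fun setT (fun x : n.-tuple F => n%:R%:E * \sum_(i < n) (W (tnth x i))%:E).
  exact: measurable_funeM.
have m2 : measurable_fun setT (fun x : n.-tuple F => beta%:E * \sum_(i < n) (log1 (tnth x i))%:E).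
  exact: measurable_funeM.
rewrite /pair_functional ge0_integralD//; last 4 first.
- by move=> x _; apply: mule_ge0.
- exact: measurable_funeM.
- by move=> x _; apply: adde_ge0.
- exact: emeasurable_funD.
rewrite ge0_integralD// !ge0_integralZl//.
rewrite (integral_tuple_pairs _ _ mk)// (integral_tuple_sum _ _ mW)// (integral_tuple_sum _ _ ml)//.
rewrite /total_energy addeA; apply: leeD; last by rewrite muleA -EFinM mulrC.
have I1 : 0 <= \int[nu]_x (W x)%:E by exact: integral_ge0.
have I2 : 0 <= \int[nu \x nu]_p k p.1 p.2 by apply: integral_ge0 => p _; exact: k0.
move: (\int[nu]_x (W x)%:E) (\int[nu \x nu]_p k p.1 p.2) I1 I2 => A B A0 B0.
rewrite ge0_muleDr// addeC; apply: leeD; first by rewrite muleA -EFinM expr2.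
rewrite muleA -EFinM; apply: lee_wpmul2r => //; rewrite lee_fin.
by rewrite expr2 -natrM -(double_sum_ord n) natrD natrM mulrC lerDl.
Qed.

Lemma log1_integral_fin (nu : probability F R) : E nu < +oo ->
  \int[nu]_x (log1 x)%:E \is a fin_num.
Proof.
move=> Efin; have bb : (0 < beta' - beta)%R by rewrite subr_gt0.
have L0 : 0 <= \int[nu]_x (log1 x)%:E by exact: integral_ge0.
rewrite ge0_fin_numE//; case: (ltP (\int[nu]_x (log1 x)%:E) +oo) => //.
rewrite leye_eq => /eqP Loo; move: Efin; rewrite ltNge; move/negP; case.
apply: (@le_trans _ _ (\int[nu]_x (W x)%:E)); last first.
  by rewrite leeDl//; apply: integral_ge0 => p _; exact: k0.
have <- : (beta' - beta)%:E * \int[nu]_x (log1 x)%:E = +oo.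
  by rewrite Loo gt0_muley// lte_fin.
rewrite -ge0_integralZl//; last by rewrite lee_fin ltW.
apply: ge0_le_integral => //.
- by move=> x _; apply: mule_ge0; [rewrite lee_fin ltW|exact: l0].
- exact: measurable_funeM.
- by move=> x _; rewrite -EFinM lee_fin reduced_potential_ge.
Qed.

(** An event of fixed positive probability is enough, since constants vanish at speed [n^2].
    Markov's inequality keeps the functional near its mean with probability at least [r],
    Chebyshev's makes the fraction correct up to probability [r / 2], and the density bound
    transfers the remaining [r / 2] to the volume. *)
Lemma weight_integral_lower_dominated (nu : probability F R) (c e d eta : R) (U : set F) :
  (forall A, measurable A -> nu A <= c%:E * vol F A) -> (0 <= c)%R ->
  E nu = e%:E -> measurable U -> (0 < d)%R -> (0 < eta)%R ->
  \forall n \near \oo,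
    (expR (n.+1%:R ^+ 2 * (C0 - e - eta)))%:E <=
    \int[tuple_measure (vol F) n.+1]_(x in
      [set x | (`|count_in R U x / n.+1%:R - fine (nu U)| < d)%R]) (weight x)%:E.
Proof.
move=> nuc c0 nue mU d0 eta0.
have e0 : (0 <= e)%R.
  rewrite -lee_fin -nue; apply: adde_ge0; first exact: integral_ge0.
  by apply: integral_ge0 => p _; exact: k0.
have Lfin : \int[nu]_x (log1 x)%:E \is a fin_num by apply: log1_integral_fin; rewrite nue ltry.
pose l := fine (\int[nu]_x (log1 x)%:E).
have l0' : (0 <= l)%R by apply: fine_ge0; exact: integral_ge0.
have eeta : (0 < e + eta / 2)%R by rewrite ltr_wpDl// divr_gt0.
(* Markov's inequality gives the ratio [(e + eta / 4) / (e + eta / 2)], which is [1 - r]; the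
   [eta / 4] in its numerator absorbs the linear term in the expectation. *)
pose r := (eta / 4 / (e + eta / 2))%R.
have r0 : (0 < r)%R by rewrite !divr_gt0.
(* A positive density bound, so that its powers can be divided out and its logarithm taken. *)
pose c1 := (c + 1)%R.
have c10 : (0 < c1)%R by rewrite ltr_wpDl.
near=> n.
set N : R := n.+1%:R; have N0 : (0 < N)%R by rewrite ltr0n.
pose mun := tuple_measure nu n.+1.
pose A := [set x : n.+1.-tuple F | (`|count_in R U x / N - fine (nu U)| < d)%R].
pose b := (N ^+ 2 * (e + eta / 2))%R.
have b0 : (0 < b)%R by rewrite mulr_gt0// exprn_gt0.
pose B := [set x : n.+1.-tuple F | b%:E <= pair_functional x].
have mcount : measurable_fun setT (fun x : n.+1.-tuple F => `|count_in R U x / N - fine (nu U)|%R).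
  apply: measurableT_comp => //; apply: measurable_funB => //.
  by apply: measurable_funM => //; exact: measurable_count.
have mA : measurable A.
  rewrite (_ : A = (fun x : n.+1.-tuple F => `|count_in R U x / N - fine (nu U)|%R) @^-1` `]-oo, d[).
    by rewrite -[X in measurable X]setTI; exact: mcount.
  by apply/seteqP; split => x /=; rewrite in_itv.
have mB : measurable B.
  by have := emeasurable_fun_c_infty measurableT (@measurable_pair_functional n.+1) b%:E; rewrite setTI.
have PA : mun (~` A) <= (r / 2)%:E.
  have -> : ~` A = [set x | (d <= `|count_in R U x / N - fine (nu U)|)%R].
    by apply/seteqP; split => x /=; rewrite leNgt => /negP.
  apply: (le_trans (chebyshev_count nu mU n d0)); rewrite lee_fin -/N.
  rewrite ler_pdivrMr ?mulr_gt0// ?exprn_gt0// mulrCA mulrC -ler_pdivrMl; last first.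
    by rewrite mulr_gt0 ?divr_gt0 ?exprn_gt0.
  by rewrite /N; near: n; exact: near_ler_nat.
have PB : mun B <= (1 - r)%:E.
  have := ge0_markov mun b0 (@measurable_pair_functional n.+1) (@pair_functional_ge0 n.+1).
  move=> /le_trans /(_ (expectation_pair_functional nu n.+1)).
  rewrite nue -(fineK Lfin) -/l -!EFinM -EFinD => h.
  rewrite -(lee_pmul2l (x := b%:E))//; apply: (le_trans h).
  rewrite -EFinM lee_fin -/N.
  have -> : (b * (1 - r) = N ^+ 2 * (e + eta / 4))%R by rewrite /b /r; field; apply/lt0r_neq0; lra.
  have : (beta * l <= N * (eta / 4))%R.
    by rewrite -ler_pdivrMr ?divr_gt0// /N; near: n; exact: near_ler_nat.
  by move=> /(ler_wpM2l (ltW N0)); lra.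
have PAB : (r / 2)%:E <= mun (A `\` B).
  have h : 1 <= mun (A `\` B) + (mun (~` A) + mun B).
    rewrite -(tuple_measure_prob nu n.+1) -/mun.
    apply: (@le_trans _ _ (mun ((A `\` B) `|` ((~` A) `|` B)))).
      rewrite (_ : _ `|` _ = setT)//; apply/seteqP; split => // x _ /=.
      by case: (pselect (A x)) => Ax; case: (pselect (B x)) => Bx; [right; right|left|right; left..].
    apply: (le_trans (measureU2 _ _ _)).
    - exact: measurableD.
    - by apply: measurableU => //; exact: measurableC.
    by rewrite leeD2l// measureU2//; exact: measurableC.
  have : 1 <= mun (A `\` B) + ((r / 2)%:E + (1 - r)%:E).
    by apply: (le_trans h); rewrite leeD2l// leeD.
  rewrite -EFinD; case: (mun (A `\` B)) => [y| |]; rewrite ?leey//.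
  by rewrite -EFinD !lee_fin; lra.
have mw : measurable_fun setT (EFin \o (@ensemble_weight R F beta V n.+1)).
  by apply/measurable_EFinP; exact: measurable_weight.
pose h := (EFin \o (@ensemble_weight R F beta V n.+1)) \_ A.
have h0 x : 0 <= h x by rewrite /h patchE; case: ifP => // _; rewrite lee_fin weight_ge0.
have mh : measurable_fun setT h.
  by apply/(measurable_restrictT _ mA); exact: measurable_funTS.
have := tuple_measure_dominated (m := nu) (m' := vol F) (c := c1) (ltW c10) _ mh h0.
have nuc1 : forall A, measurable A -> nu A <= c1%:E * vol F A.
  move=> A' mA'; apply: (le_trans (nuc A' mA')); apply: lee_wpmul2r => //.
  by rewrite lee_fin lerDl.
move=> /(_ nuc1) dom.
rewrite -/A integral_mkcond -/h.
rewrite -(lee_pmul2l (x := (c1 ^+ n.+1)%:E))//; last by rewrite lte_fin exprn_gt0.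
apply: (le_trans _ dom).
apply: (@le_trans _ _ (\int[mun]_x ((expR (N ^+ 2 * C0 - b))%:E * (\1_(A `\` B) x)%:E))); last first.
  have g0 x : 0 <= (expR (N ^+ 2 * C0 - b))%:E * (\1_(A `\` B) x)%:E.
    by rewrite -EFinM lee_fin mulr_ge0// expR_ge0.
  have mg : measurable_fun setT (fun x => (expR (N ^+ 2 * C0 - b))%:E * (\1_(A `\` B) x)%:E).
    by apply: measurable_funeM; apply/measurable_EFinP/measurable_indic; exact: measurableD.
  apply: ge0_le_integral => // x _; rewrite indicE; have [|_] := boolP (x \in A `\` B); last by rewrite mule0.
  rewrite inE => -[Ax nBx]; rewrite mule1 /h patchE mem_set//= lee_fin; apply: weight_ge.
  by rewrite ltW// ltNge; apply/negP.
have mi : measurable_fun setT (fun x : n.+1.-tuple F => (\1_(A `\` B) x : R)%:E).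
  by apply/measurable_EFinP/measurable_indic; exact: measurableD.
have i0 (x : n.+1.-tuple F) : 0 <= (\1_(A `\` B) x : R)%:E by rewrite lee_fin.
have x0 : 0 <= (expR (N ^+ 2 * C0 - b))%:E by rewrite lee_fin expR_ge0.
rewrite ge0_integralZl//.
rewrite integral_indic//; last exact: measurableD.
rewrite setIT; apply: (@le_trans _ _ ((expR (N ^+ 2 * C0 - b))%:E * (r / 2)%:E)); last first.
  by apply: lee_wpmul2l => //; rewrite lee_fin expR_ge0.
rewrite -!EFinM lee_fin -[X in (X * _ <= _)%R](lnK (x := c1 ^+ n.+1)%R) ?posrE ?exprn_gt0//.
rewrite lnXn// -[X in (_ <= _ * X)%R](lnK (x := (r / 2)%R)) ?posrE ?divr_gt0//.
rewrite -!expRD ler_expR /b -[(ln c1 *+ n.+1)%R]mulr_natl -/N.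
have h1 : (ln c1 - ln (r / 2) <= N * (eta / 2))%R.
  by rewrite -ler_pdivrMr ?divr_gt0// /N; near: n; exact: near_ler_nat.
have h2 : (ln (r / 2) <= 0)%R.
  apply: ln_le0; rewrite /r ler_pdivrMr// mul1r ler_pdivrMr//; lra.
have N1 : (1 <= N)%R by rewrite ler1n.
have : (N * (ln c1 - ln (r / 2)) <= N * (N * (eta / 2)))%R by rewrite ler_pM2l.
by nra.
Unshelve. all: by end_near. Qed.

End lower_bound_dominated.

(** * Regularization *)

Section convolution.
Local Open Scope ereal_scope.
Context (R : realType) (F : ambient R) (P : planar F).

(** Says that [nu] is the law of the sum of independent variables with laws [mu] and [eta], through
    its action on nonnegative functions. *)
Definition convolves (mu eta nu : probability F R) :=
  forall h : F -> \bar R, measurable_fun setT h -> (forall x, 0 <= h x) ->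
    \int[nu]_z h z = \int[mu]_x \int[eta]_u h (add P x u).

Lemma convolution_exists (mu eta : probability F R) :
  exists nu : probability F R, convolves mu eta nu.
Proof.
have [nu [_ nuE]] := law_exists (mu \x eta : probability _ R) (add_measurable P).
exists nu => h mh h0; rewrite nuE// fubini_tonelli1//.
exact: measurableT_comp mh (add_measurable P).
Qed.

Lemma measurable_addl x : measurable_fun setT (add P x).
Proof.
apply: (measurableT_comp (add_measurable P) (g := fun u => (x, u))).
by apply: measurable_fun_pair.
Qed.

Lemma measurable_shift x A : measurable A -> measurable [set u | A (add P x u)].
Proof. by move=> mA; rewrite -[X in measurable X]setTI; exact: measurable_addl. Qed.

Lemma integral_indic_shift (eta : probability F R) x A : measurable A ->
  \int[eta]_u (\1_A (add P x u))%:E = eta [set u | A (add P x u)].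
Proof.
move=> mA; transitivity (\int[eta]_u (\1_[set u | A (add P x u)] u)%:E).
  by apply: eq_integral => u _; rewrite !indicE; congr (_%:R%:E); apply/idP/idP; rewrite !inE.
by rewrite integral_indic ?setIT//; exact: measurable_shift.
Qed.

Lemma measurable_convolution_inner (eta : probability F R) (h : F -> \bar R) :
  measurable_fun setT h -> (forall x, 0 <= h x) ->
  measurable_fun setT (fun x => \int[eta]_u h (add P x u)).
Proof.
move=> mh h0; apply: (measurable_fun_fubini_tonelli_F (fun p : F * F => h (add P p.1 p.2))) => //.
exact: measurableT_comp mh (add_measurable P).
Qed.

Lemma convolution_set (mu eta nu : probability F R) A : convolves mu eta nu ->
  measurable A -> nu A = \int[mu]_x eta [set u | A (add P x u)].
Proof.
move=> nuE mA; transitivity (\int[nu]_z (\1_A z)%:E).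
  by rewrite integral_indic// setIT.
rewrite nuE//; last by apply/measurable_EFinP; exact: measurable_indic.
by apply: eq_integral => x _; rewrite integral_indic_shift.
Qed.

Lemma convolution_dominated (mu nu : probability F R) e : (0 < e)%R ->
  convolves mu (noise P e) nu ->
  forall A, measurable A -> nu A <= (density P e)%:E * vol F A.
Proof.
move=> e0 nuE A mA; rewrite (convolution_set nuE)//.
have mI : measurable_fun setT (fun x => noise P e [set u | A (add P x u)]).
  rewrite (_ : (fun _ => _) = fun x => \int[noise P e]_u (\1_A (add P x u))%:E).
    apply: (@measurable_convolution_inner _ (fun x => (\1_A x)%:E)); last by move=> x; rewrite lee_fin.
    by apply/measurable_EFinP; exact: measurable_indic.
  by apply/funext => x; rewrite integral_indic_shift.
apply: (@le_trans _ _ (\int[mu]_x cst ((density P e)%:E * vol F A) x)).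
  apply: ge0_le_integral => //.
  by move=> x _; exact: noise_density.
by rewrite integral_cst_prob.
Qed.

Lemma convolution_pair (mu eta nu : probability F R) (h : F * F -> \bar R) :
  convolves mu eta nu -> measurable_fun setT h -> (forall p, 0 <= h p) ->
  \int[nu \x nu]_p h p =
  \int[mu]_x \int[mu]_y \int[eta]_u \int[eta]_v h (add P x u, add P y v).
Proof.
move=> nuE mh h0.
have mhz z : measurable_fun setT (fun w => h (z, w)) by exact: measurableT_comp.
rewrite fubini_tonelli1// nuE; last 2 first.
- exact: measurable_fun_fubini_tonelli_F.
- by move=> x; apply: integral_ge0.
apply: eq_integral => x _.
rewrite -(fubini_tonelli (fun p : F * F => \int[eta]_v h (add P x p.1, add P p.2 v))); last 2 first.
- apply: (measurable_fun_fubini_tonelli_F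
    (fun p : (F * F) * F => h (add P x p.1.1, add P p.1.2 p.2))) => //.
  apply: (measurableT_comp mh (g := fun p : (F * F) * F => (add P x p.1.1, add P p.1.2 p.2))).
  apply: measurable_fun_pair.
    apply: (measurableT_comp (@measurable_addl x)).
    exact: measurableT_comp.
  apply: (measurableT_comp (add_measurable P) (g := fun p : (F * F) * F => (p.1.2, p.2))).
  apply: measurable_fun_pair => //; exact: measurableT_comp.
- by move=> p; apply: integral_ge0.
by apply: eq_integral => u _; rewrite /fubini_F nuE.
Qed.

End convolution.

Lemma sum_expRN_le2 (R : realType) n : \sum_(k < n) expR (- k%:R) <= 2 :> R.
Proof.
have q2 : expR (- 1) <= 1 / 2 :> R.
  rewrite expRN -[leRHS]invrK lef_pV2 ?posrE ?invr_gt0 ?divr_gt0 ?expR_gt0//.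
  by apply: le_trans (expR_ge1Dx 1); lra.
(* The explicit remainder makes the induction work: a new term is at most the resulting decrease of
   the remainder, because [expR (- 1) <= 1 / 2]. *)
suff : \sum_(k < n) expR (- k%:R) <= 2 - 2 * expR (- n%:R) :> R.
  by move=> /le_trans; apply; rewrite gerBl mulr_ge0// expR_ge0.
elim: n => [|n ih]; first by rewrite big_ord0 oppr0 expR0; lra.
rewrite big_ord_recr/= -[n.+1%:R]natr1 opprD expRD.
move: ih q2 (expR_ge0 (- n%:R : R)); move: (\sum_(k < n) _) (expR (- n%:R)) (expR (- 1)) => S a q; nra.
Qed.

Lemma le_count_nat (R : realType) (t : R) M : t <= M%:R ->
  t <= \sum_(k < M.+1) ((k : nat)%:R <= t)%R%:R.
Proof.
elim: M => [|M ih] tM; first by apply: le_trans tM _; rewrite big_ord_recl big_ord0 addr0.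
have [/ih tM'|Mt] := leP t M%:R.
  by rewrite big_ord_recr/= (le_trans tM')// lerDl.
apply: (le_trans tM); rewrite big_ord_recr/= (eq_bigr (fun=> 1)) ?sumr_const ?card_ord ?lerDl//.
by move=> k _; rewrite (le_trans _ (ltW Mt))// ler_nat -ltnS.
Qed.

(** * Effect of the noise on the kernel *)

Section noise_kernel.
Local Open Scope ereal_scope.
Context (R : realType) (F : ambient R) (P : planar F) (beta : R).
Hypothesis beta0 : (0 < beta)%R.
Implicit Types x y u v : F.

Lemma modulus_add x u : (modulus (add P x u) <= modulus x + modulus u)%R.
Proof. by rewrite !(modulusE P) emb_add cmodD. Qed.

Lemma log1_add x u : (log1 (add P x u) <= log1 x + modulus u)%R.
Proof.
rewrite -ler_expR expRD !(expR_log1 P).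
have := modulus_add x u; have := modulus_ge0 P x; have := modulus_ge0 P u.
have := expR_ge1Dx (modulus u); nra.
Qed.

Lemma dist_add x u y v : (dist x y - modulus u - modulus v <= dist (add P x u) (add P y v))%R.
Proof.
rewrite !(modulusE P) !(distE P) !emb_add.
have := cmodD (emb P x + emb P u - (emb P y + emb P v))%R (- emb P u)%R.
have := cmodD (emb P x + emb P u - (emb P y + emb P v) - emb P u)%R (emb P v).
rewrite (_ : emb P x + emb P u - (emb P y + emb P v) - emb P u + emb P v =
  emb P x - emb P y)%R.
  by rewrite cmodN; lra.
by rewrite addrAC opprD !addrA subrK addrAC addrK.
Qed.

(** The radius [2 * e] is large enough for noise uniform on a square of half-side [e]. *)
Lemma noise_le_integral e (f g : F -> \bar R) : (0 < e)%R ->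
  measurable_fun setT f -> measurable_fun setT g ->
  (forall u, 0 <= f u) -> (forall u, 0 <= g u) ->
  (forall u, (modulus u <= 2 * e)%R -> f u <= g u) ->
  \int[noise P e]_u f u <= \int[noise P e]_u g u.
Proof.
move=> e0 mf mg f0 g0 fg; apply: ae_ge0_le_integral => //.
exists [set u | (2 * e < modulus u)%R]; split.
- rewrite (_ : mkset _ = @modulus R F @^-1` `](2 * e)%R, +oo[%classic).
    by rewrite -[X in measurable X]setTI; apply: (measurable_modulus P).
  by apply/seteqP; split => u /=; rewrite in_itv/= andbT.
- exact: noise_small.
move=> u /= nu; rewrite ltNge; apply/negP => ue; apply: nu => _; exact: fg.
Qed.

Lemma noise_cst_le e (f : F -> \bar R) (c : \bar R) : (0 < e)%R -> 0 <= c ->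
  measurable_fun setT f -> (forall u, 0 <= f u) ->
  (forall u, (modulus u <= 2 * e)%R -> f u <= c) -> \int[noise P e]_u f u <= c.
Proof.
move=> e0 c0 mf f0 fc; rewrite -[leRHS](integral_cst_prob (noise P e)).
exact: noise_le_integral.
Qed.

Local Notation gM := (cutoff_kernel beta).
Local Notation k := (log_kernel beta).

Lemma measurable_noise_kernel M x y :
  measurable_fun setT (fun p : F * F => (gM M (add P x p.1) (add P y p.2))%:E).
Proof.
apply/measurable_EFinP; apply: (measurableT_comp (measurable_cutoff_kernel P beta M)
  (g := fun p : F * F => (add P x p.1, add P y p.2))).
by apply: measurable_fun_pair; apply: (measurableT_comp (measurable_addl P _)).
Qed.

Lemma measurable_noise_kernel_mean M e : measurable_fun setT (fun p : F * F =>
  \int[noise P e]_u \int[noise P e]_v (gM M (add P p.1 u) (add P p.2 v))%:E).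
Proof.
have k0 (x y : F) : 0 <= (gM M x y)%:E by rewrite lee_fin (cutoff_kernel_ge0 P beta0).
have mkn : measurable_fun setT (fun q : ((F * F) * F) * F =>
    (gM M (add P q.1.1.1 q.1.2) (add P q.1.1.2 q.2))%:E).
  apply/measurable_EFinP; apply: (measurableT_comp (measurable_cutoff_kernel P beta M)
    (g := fun q : ((F * F) * F) * F => (add P q.1.1.1 q.1.2, add P q.1.1.2 q.2))).
  apply: measurable_fun_pair.
    apply: (measurableT_comp (add_measurable P)
      (g := fun q : ((F * F) * F) * F => (q.1.1.1, q.1.2))).
    apply: measurable_fun_pair; last by apply: (measurableT_comp (f := snd)).
    by do 2 apply: (measurableT_comp (f := fst)) => //.
  apply: (measurableT_comp (add_measurable P)
    (g := fun q : ((F * F) * F) * F => (q.1.1.2, q.2))).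
  apply: measurable_fun_pair => //; apply: (measurableT_comp (f := snd)) => //.
  by apply: (measurableT_comp (f := fst)).
have mk1 := measurable_fun_fubini_tonelli_F (m2 := noise P e) _ mkn (fun q => k0 _ _).
exact: (measurable_fun_fubini_tonelli_F (m2 := noise P e) _ mk1
  (fun q => integral_ge0 _ (fun v _ => k0 _ _))).
Qed.

Lemma noise_kernel_mean_ge0 M e (p : F * F) :
  0 <= \int[noise P e]_u \int[noise P e]_v (gM M (add P p.1 u) (add P p.2 v))%:E.
Proof.
apply: integral_ge0 => u _; apply: integral_ge0 => v _.
by rewrite lee_fin (cutoff_kernel_ge0 P beta0).
Qed.

(* Layer cake over the levels [e * exp (- i)], to be integrated with [noise_near]. *)
Lemma neg_ln_cutoff_dist_le M e x y : (0 < e <= 1)%R ->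
  (- ln (cutoff_dist M x y) <=
   - ln e + \sum_(i < M.+1) (dist x y <= e * expR (- (i : nat)%:R))%R%:R)%R.
Proof.
move=> /andP[e0 e1]; pose t := (ln e - ln (cutoff_dist M x y))%R.
have tM : (t <= M%:R)%R.
  have h1 : (ln e <= 0)%R by exact: ln_le0.
  have h2 : (- M%:R <= ln (cutoff_dist M x y))%R.
    rewrite -ler_expR lnK ?posrE ?cutoff_dist_gt0// /cutoff_dist le_max lexx orbT//.
  by rewrite /t; lra.
have := le_count_nat tM; rewrite {1}/t => h.
have {h} : (ln e - ln (cutoff_dist M x y) <=
    \sum_(i < M.+1) (dist x y <= e * expR (- (i : nat)%:R))%R%:R)%R.
  apply: (le_trans h); apply: ler_sum => i _; rewrite ler_nat.
  case: (lerP (i : nat)%:R t) => // it; rewrite lt0b.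
  apply: (@le_trans _ _ (cutoff_dist M x y)); first by rewrite /cutoff_dist le_max lexx.
  rewrite -[leLHS]lnK ?posrE ?cutoff_dist_gt0// -[X in (_ <= X * _)%R]lnK// -expRD ler_expR.
  by move: it; rewrite /t; lra.
by lra.
Qed.

(** Valid even for [x = y], and obtained by averaging over [v] alone: the distance is below
    [e * expR (- i)] with probability at most [expR (- i)], and these sum to at most [2]. The term
    [4 * e] bounds the change of the two [log1]. *)
Lemma noise_kernel_near M e x y : (0 < e <= 1)%R ->
  \int[noise P e]_u \int[noise P e]_v (gM M (add P x u) (add P y v))%:E <=
  (beta / 2 * (log1 x + log1 y + 4 * e - ln e + 2))%:E.
Proof.
move=> e01; have /andP[e0 e1] := e01.
have lne0 : (0 <= - ln e)%R by rewrite oppr_ge0; exact: ln_le0.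
pose A := (log1 x + log1 y + 4 * e - ln e)%R.
have A0 : (0 <= A)%R by rewrite /A; have := log1_ge0 P x; have := log1_ge0 P y; lra.
have b0 : (0 <= beta / 2)%R by rewrite divr_ge0// ltW.
have k0 M' (z w : F) : 0 <= (gM M' z w)%:E by rewrite lee_fin (cutoff_kernel_ge0 P beta0).
apply: noise_cst_le => //.
- by rewrite lee_fin mulr_ge0//; move: A0; rewrite /A; lra.
- exact: (measurable_fun_fubini_tonelli_F (fun p : F * F => (gM M (add P x p.1) (add P y p.2))%:E)
     (measurable_noise_kernel M x y)).
- by move=> u; exact: integral_ge0.
move=> u ue; set x' := add P x u.
pose S v i : R := \1_[set v | (dist (add P y v) x' <= e * expR (- i%:R))%R] v.
have mS i : measurable [set v | (dist (add P y v) x' <= e * expR (- i%:R))%R].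
  rewrite (_ : mkset _ = (fun v => dist (add P y v) x') @^-1` `]-oo, (e * expR (- i%:R))%R]%classic).
    rewrite -[X in measurable X]setTI.
    apply: (measurableT_comp (measurable_dist P) (g := fun v => (add P y v, x'))) => //.
    by apply: measurable_fun_pair => //; exact: measurable_addl.
  by apply/seteqP; split => v /=; rewrite in_itv.
have mSE i : measurable_fun setT (fun v => (S v i)%:E).
  by apply/measurable_EFinP; exact: measurable_indic.
apply: (@le_trans _ _ (\int[noise P e]_v ((beta / 2)%:E *
    (cst A%:E v + \sum_(i < M.+1) (S v i)%:E)))).
  apply: noise_le_integral => //.
  - apply: (measurableT_comp (measurable_noise_kernel M x y) (g := fun v => (u, v))).
    by apply: measurable_fun_pair.
  - by apply: measurable_funeM; apply: emeasurable_funD => //; exact: emeasurable_sum.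
  - by move=> v; rewrite mule_ge0// adde_ge0//= ?lee_fin// sumEFin lee_fin sumr_ge0.
  move=> v ve; rewrite sumEFin -EFinD -EFinM lee_fin /cutoff_kernel ler_pM2l ?divr_gt0//.
  have h1 := log1_add x u; have h2 := log1_add y v.
  have h3 := neg_ln_cutoff_dist_le M x' (add P y v) e01.
  have h4 : (\sum_(i < M.+1) (dist x' (add P y v) <= e * expR (- (i : nat)%:R))%R%:R =
     \sum_(i < M.+1) S v i)%R.
    apply: eq_bigr => i _; rewrite /S indicE (distC P); congr ((nat_of_bool _)%:R)%R.
    by apply/idP/idP; rewrite inE.
  by rewrite -h4 /A -/x' /= in h1 *; lra.
have sm v : 0 <= \sum_(i < M.+1) (S v i)%:E by rewrite sumEFin lee_fin sumr_ge0.
have mSum : measurable_fun setT (fun v => \sum_(i < M.+1) (S v i)%:E) by exact: emeasurable_sum.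
have mG : measurable_fun setT (fun v => cst A%:E v + \sum_(i < M.+1) (S v i)%:E).
  exact: emeasurable_funD.
have G0 v : 0 <= cst A%:E v + \sum_(i < M.+1) (S v i)%:E by rewrite adde_ge0.
rewrite ge0_integralZl//.
rewrite [leRHS]EFinM; apply: lee_wpmul2l; first by rewrite lee_fin.
rewrite ge0_integralD//.
rewrite integral_cst_prob -/A [leRHS]EFinD; apply: leeD2l.
rewrite ge0_integral_sum//; last by move=> i v _; rewrite lee_fin.
apply: (@le_trans _ _ (\sum_(i < M.+1) (expR (- (i : nat)%:R))%:E)).
  apply: lee_sum => i _; rewrite integral_indic// setIT.
  by apply: noise_near => //; rewrite expR_gt0.
by rewrite sumEFin lee_fin sum_expRN_le2.
Qed.

(** The noise shortens the distance by at most [4 * e], which is at most half of it, so the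
    distances before and after have ratio at most [1 + 8 * e / s]. *)
Lemma noise_kernel_far M e s x y : (0 < e)%R -> (8 * e <= s)%R -> (s <= dist x y)%R ->
  \int[noise P e]_u \int[noise P e]_v (gM M (add P x u) (add P y v))%:E <=
  k x y + (beta / 2 * (4 * e + 8 * e / s))%:E.
Proof.
move=> e0 es sd; have s0 : (0 < s)%R by lra.
have d0 : (0 < dist x y)%R by lra.
have b0 : (0 <= beta / 2)%R by rewrite divr_ge0// ltW.
have k0 M' (z w : F) : 0 <= (gM M' z w)%:E by rewrite lee_fin (cutoff_kernel_ge0 P beta0).
have c0 : 0 <= k x y + (beta / 2 * (4 * e + 8 * e / s))%:E.
  apply: adde_ge0; first exact: (log_kernel_ge0 P).
  by rewrite lee_fin mulr_ge0// addr_ge0// ?divr_ge0// ?mulr_ge0// ltW.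
have mk : measurable_fun setT (fun p : F * F => (gM M (add P x p.1) (add P y p.2))%:E).
  exact: measurable_noise_kernel.
apply: noise_cst_le => //.
- exact: (measurable_fun_fubini_tonelli_F (fun p : F * F => (gM M (add P x p.1) (add P y p.2))%:E) mk).
- by move=> u; exact: integral_ge0.
move=> u ue; apply: noise_cst_le => //.
  apply: (measurableT_comp mk (g := fun v => (u, v))).
  by apply: measurable_fun_pair.
move=> v ve; rewrite log_kernel_dist_gt0// -EFinD lee_fin -mulrDr ler_pM2l ?divr_gt0//.
have h1 := log1_add x u; have h2 := log1_add y v; have h3 := dist_add x u y v.
set D' := cutoff_dist M (add P x u) (add P y v).
have D'0 : (0 < D')%R by exact: cutoff_dist_gt0.
have h4 : (dist x y - 4 * e <= D')%R.
  by rewrite /D' /cutoff_dist le_max; apply/orP; left; lra.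
have h5 : (ln (dist x y) - ln D' <= 8 * e / s)%R.
  rewrite -ln_div ?posrE//.
  have -> : (dist x y / D' = 1 + (dist x y / D' - 1))%R by ring.
  apply: (le_trans (le_ln1Dx _)).
    by rewrite ltrBrDl subrr divr_gt0.
  rewrite lerBlDr ler_pdivrMr// -(ler_pM2r s0) mulrDl mul1r mulrDl.
  have -> : (8 * e / s * D' * s = 8 * e * D')%R by field; rewrite gt_eqF.
  by nra.
by lra.
Qed.

(** Beyond [s] the far bound applies as it is, and between [8 * e] and [s] it applies with [8 * e]
    for [s]. Closer still, the near bound is compared with [k] through [ln (8 * e) <= ln e + 7]; the
    excess [beta / 2 * (7 + 2)] is below [7 * beta]. *)
Lemma noise_kernel_le M e s x y : (0 < e <= 1)%R -> (8 * e <= s)%R ->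
  \int[noise P e]_u \int[noise P e]_v (gM M (add P x u) (add P y v))%:E <=
  k x y + (beta / 2 * (4 * e + 8 * e / s) + 7 * beta * (dist x y < s)%R%:R)%:E.
Proof.
move=> e01 es; have /andP[e0 e1] := e01; have s0 : (0 < s)%R by lra.
have b0 : (0 <= beta / 2)%R by rewrite divr_ge0// ltW.
have t0 : (0 <= 8 * e / s)%R by rewrite divr_ge0// ?mulr_ge0// ltW.
have [ds|sd] := ltP (dist x y) s; last by rewrite mulr0 addr0; exact: noise_kernel_far.
rewrite mulr1; have [d8|d8] := ltP (dist x y) (8 * e)%R; last first.
  apply: (le_trans (noise_kernel_far M e0 (lexx (8 * e)%R) d8)).
  rewrite leeD2l// lee_fin divff; last by rewrite gt_eqF// mulr_gt0.
  nra.
have [d0|d0] := dist_eq0_or_gt0 P x y.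
  by rewrite log_kernel_dist0// addye// leey.
apply: (le_trans (noise_kernel_near M x y e01)).
rewrite log_kernel_dist_gt0// -EFinD lee_fin.
have h : (ln (dist x y) <= ln e + 7)%R.
  apply: (@le_trans _ _ (ln (8 * e)%R)); first by rewrite ler_ln ?posrE ?mulr_gt0// ltW.
  rewrite lnM ?posrE// addrC lerD2l.
  have -> : (8 = 1 + 7 :> R)%R by ring.
  by apply: le_ln1Dx; lra.
by nra.
Qed.

End noise_kernel.

Section convolution_limit.
Local Open Scope ereal_scope.
Context (R : realType) (F : ambient R) (P : planar F).

Definition radially_continuous (phi : F -> R) (x : F) :=
  forall d : R, (0 < d)%R -> exists2 eta : R, (0 < eta)%R &
    forall u, (modulus u <= eta)%R -> (`|phi (add P x u) - phi x| <= d)%R.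

Lemma radially_continuousP (phi : F -> R) x :
  (phi (ret P z) @[z --> emb P x] --> phi x)%R -> radially_continuous phi x.
Proof.
move=> cphi d d0.
have := cphi => /cvgrPdist_le /(_ _ d0) /nbhs_ballP[eta /= eta0 H]; exists (eta / 2)%R; first by rewrite divr_gt0.
move=> u ue; rewrite distrC -[add P x u](embK P) emb_add; apply: H.
have e2 : (modulus u < eta)%R by apply: le_lt_trans ue _; rewrite ltr_pdivrMr//; lra.
rewrite (modulusE P) in e2.
split; rewrite /ball/= opprD addrA subrr sub0r normrN.
  exact: le_lt_trans (cmod_fst _) e2.
exact: le_lt_trans (cmod_snd _) e2.
Qed.

Lemma bounded_on_balls (phi : F -> R) (r : R) : continuous (fun z => phi (ret P z)) ->
  exists C : R, forall x, (modulus x <= r)%R -> (phi x <= C)%R.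
Proof.
move=> cphi.
have /compact_bounded[C [_ HC]] : compact ((fun z => phi (ret P z)) @` (`[(- r)%R, r] `*` `[(- r)%R, r])).
  apply: continuous_compact; first exact: continuous_subspaceT.
  by apply: compact_setX; exact: segment_compact.
exists (C + 1)%R => x xr; apply: (le_trans (ler_norm _)).
apply: (HC (C + 1)%R); first by rewrite ltrDl.
exists (emb P x); last by rewrite embK.
rewrite (modulusE P) in xr.
by split; rewrite /= in_itv/= -ler_norml (le_trans _ xr)// ?cmod_fst ?cmod_snd.
Qed.

Variables (mu : probability F R) (nu : nat -> probability F R).
Hypothesis nuE : forall n, convolves P mu (noise P n.+1%:R^-1) (nu n).

(** Dominated convergence: [mu] lives on a ball of radius [r] and the noise moves points by at most
    [2], so [phi] is bounded where it matters. Continuity is asked only almost everywhere, to allow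
    indicators of sets with null boundary. *)
Lemma convolution_cvg (phi : F -> R) (C r : R) :
  measurable_fun setT phi -> (forall x, 0 <= phi x)%R ->
  (forall x, modulus x <= r + 2 -> phi x <= C)%R ->
  mu [set x | (r < modulus x)%R] = 0 ->
  {ae mu, forall x, radially_continuous phi x} ->
  \int[nu n]_x (phi x)%:E @[n --> \oo] --> \int[mu]_x (phi x)%:E.
Proof.
move=> mphi phi0 phiC mur rc.
have e0 n : (0 < n.+1%:R^-1 :> R)%R by rewrite invr_gt0.
have phi0E x : 0 <= (phi x)%:E by rewrite lee_fin.
have mphiE : measurable_fun setT (EFin \o phi) by exact/measurable_EFinP.
pose f n x := \int[noise P n.+1%:R^-1]_u (phi (add P x u))%:E.
have mf n : measurable_fun setT (f n).
  exact: (measurable_convolution_inner P (noise P n.+1%:R^-1) mphiE).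
have f0 n x : 0 <= f n x by exact: integral_ge0.
have mphix x : measurable_fun setT (fun u => (phi (add P x u))%:E).
  exact: (measurableT_comp mphiE (measurable_addl P x)).
rewrite (_ : (fun n => _) = (fun n => \int[mu]_x f n x)); last first.
  by apply/funext => n; rewrite nuE.
have mball : measurable [set x : F | (r < modulus x)%R].
  rewrite (_ : mkset _ = @modulus R F @^-1` `]r, +oo[%classic).
    by rewrite -[X in measurable X]setTI; apply: (measurable_modulus P).
  by apply/seteqP; split => u /=; rewrite in_itv/= andbT.
have dom : {ae mu, forall x, forall n, `|f n x| <= (`|C|)%R%:E}.
  exists [set x | (r < modulus x)%R]; split => // x /= nx; rewrite ltNge; apply/negP => xr.
  apply: nx => n; rewrite gee0_abs//; apply: noise_cst_le => //.
  move=> u ue; rewrite lee_fin (le_trans _ (ler_norm C))// phiC//.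
  apply: (le_trans (modulus_add P x u)); apply: lerD => //.
  by apply: (le_trans ue); rewrite ger_pMr// invf_le1// ler1n.
have [|||_ _ //] := @dominated_convergence _ _ _ mu _ measurableT f (EFin \o phi) (cst (`|C|)%R%:E)
  mf mphiE.
- apply: filterS rc => x rcx _.
  apply/fine_cvgP; split.
    have [eta eta0 H] := rcx 1%R ltr01.
    near=> n; rewrite ge0_fin_numE//.
    apply: (@le_lt_trans _ _ (phi x + 1)%:E); last by rewrite ltry.
    apply: noise_cst_le => //; first by rewrite lee_fin addr_ge0.
    move=> u ue; rewrite lee_fin.
    have : (`|phi (add P x u) - phi x| <= 1)%R.
      apply: H; apply: (le_trans ue).
      rewrite -ler_pdivlMl// mulrC -[leRHS]invrK lef_pV2 ?posrE ?invr_gt0 ?divr_gt0//.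
      by near: n; exact: near_ler_nat.
    by rewrite ler_norml => /andP[]; lra.
  apply/cvgrPdist_le => d d0; have [eta eta0 H] := rcx d d0; near=> n.
  have Hn u : (modulus u <= 2 * n.+1%:R^-1)%R -> (`|phi (add P x u) - phi x| <= d)%R.
    move=> ue; apply: H; apply: (le_trans ue).
    rewrite -ler_pdivlMl// mulrC -[leRHS]invrK lef_pV2 ?posrE ?invr_gt0 ?divr_gt0//.
    by near: n; exact: near_ler_nat.
  have up : f n x <= (phi x + d)%:E.
    apply: noise_cst_le => //; first by rewrite lee_fin addr_ge0// ltW.
    by move=> u /Hn; rewrite lee_fin ler_norml => /andP[]; lra.
  have lo : (phi x)%:E <= f n x + d%:E.
    rewrite -[leLHS](integral_cst_prob (noise P n.+1%:R^-1)).
    rewrite -[in leRHS](integral_cst_prob (noise P n.+1%:R^-1) d%:E) /f.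
    have cd0 u : 0 <= cst d%:E u :> \bar R by rewrite lee_fin ltW.
    rewrite -ge0_integralD//.
    apply: noise_le_integral => //.
    - exact: emeasurable_funD.
    - by move=> u; rewrite lee_fin.
    - by move=> u; rewrite adde_ge0.
    - by move=> u /Hn; rewrite -EFinD lee_fin ler_norml => /andP[]; lra.
  move: up lo; rewrite /=; case: (f n x) (f0 n x) => [y| |]// _.
  by rewrite -EFinD !lee_fin => up lo; rewrite ler_norml; apply/andP; split => /=; lra.
- by apply: finite_measure_integrable_cst.
- by apply: filterS dom => x Hx n _; exact: Hx.
Unshelve. all: by end_near. Qed.

End convolution_limit.

(** * Truncation *)

Section truncation.
Local Open Scope ereal_scope.
Context d (T : measurableType d) (R : realType).
Implicit Types mu nu : probability T R.

Lemma measurable_le_fun (f : T -> R) (r : R) : measurable_fun setT f ->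
  measurable [set x | (f x <= r)%R].
Proof.
move=> mf; rewrite (_ : mkset _ = f @^-1` `]-oo, r]%classic).
  by rewrite -[X in measurable X]setTI; exact: mf.
by apply/seteqP; split => u /=; rewrite in_itv.
Qed.

(** Conditioning on [f <= n], an event of mass above [1 / q] for large [n], multiplies masses by at
    most [q]. *)
Lemma truncation_exists mu (f : T -> R) (q : R) : measurable_fun setT f -> (1 < q)%R ->
  exists (r : R) (nu : probability T R), nu [set x | (r < f x)%R] = 0 /\
    forall A, measurable A -> nu A <= q%:E * mu A.
Proof.
move=> mf q1; have q0 : (0 < q)%R by lra.
pose B n := [set x | (f x <= n%:R)%R].
have mB n : measurable (B n) by exact: measurable_le_fun.
have BT : \bigcup_n B n = setT.
  apply/seteqP; split => // x _; exists (Num.bound `|f x|%R) => //.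
  exact: le_trans (ler_norm _) (ltW (archi_boundP (normr_ge0 _))).
have := @nondecreasing_cvg_mu _ _ _ mu B mB.
rewrite BT => /(_ measurableT) cv.
have {cv} : (mu \o B) x @[x --> \oo] --> 1.
  rewrite -(probability_setT mu); apply: cv => n m nm; apply/subsetPset => x /=.
  by move=> /le_trans; apply; rewrite ler_nat.
move=> /fine_cvgP[_ /cvgr_gt] /(_ (q^-1)%R) [|n _ /(_ n (leqnn n)) /=]; first by rewrite invf_lt1.
rewrite -lte_fin fineK ?fin_num_measure// => mn.
have n0 : 0 < mu (B n) by apply: le_lt_trans mn; rewrite lee_fin invr_ge0 ltW.
have fB : mu (B n) \is a fin_num by rewrite fin_num_measure.
exists n%:R%R, (mnormalize (mrestr mu (mB n)) mu).
have E A : mnormalize (mrestr mu (mB n)) mu A = mu (A `&` B n) * ((fine (mu (B n)))^-1)%:E.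
  rewrite /mnormalize /= /mrestr /= setTI gt_eqF//=.
  by case: eqP => [h|//]; move: fB; rewrite h.
split.
  apply: (etrans (E _)); rewrite (_ : _ `&` _ = set0) ?measure0 ?mul0e//.
  by apply/seteqP; split => // x [/= h1 h2]; move: h1; rewrite ltNge h2.
move=> A mA; apply: (@le_trans _ _ (mu (A `&` B n) * ((fine (mu (B n)))^-1)%:E)).
  by rewrite -E.
rewrite muleC; apply: lee_pmul => //.
- by rewrite lee_fin invr_ge0 fine_ge0.
- rewrite lee_fin -[leRHS]invrK lef_pV2 ?posrE ?invr_gt0// ?fine_gt0 ?n0 ?ltey_eq ?fB//.
  by rewrite -lee_fin fineK// ltW.
- by apply: le_measure; rewrite ?inE//; exact: measurableI.
Qed.

(** Domination on [A] bounds the difference from above, domination on its complement bounds it from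
    below. *)
Lemma dominated_prob_close mu nu (q : R) A : (1 <= q)%R ->
  (forall A, measurable A -> nu A <= q%:E * mu A) -> measurable A ->
  (`|fine (nu A) - fine (mu A)| <= q - 1)%R.
Proof.
move=> q1 numu mA; have mC := measurableC mA.
have := numu _ mA; have := numu _ mC; rewrite !probability_setC//.
have := probability_le1 mu mA; have := probability_le1 nu mA.
have : 0 <= mu A by []. have : 0 <= nu A by [].
have : mu A \is a fin_num by rewrite fin_num_measure.
have : nu A \is a fin_num by rewrite fin_num_measure.
move: (mu A) (nu A) => [a| |] [b| |]//= _ _.
rewrite -!EFinB -!EFinM !lee_fin ler_norml => ? ? ? ? ? ?; apply/andP; split; nra.
Qed.

End truncation.

Lemma ge0_integral_pair_dominated d (T : measurableType d) (R : realType)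
    (m nu : {sigma_finite_measure set T -> \bar R}) (q : R) (k : T * T -> \bar R) :
  0 <= q -> (forall A, measurable A -> (nu A <= q%:E * m A)%E) ->
  measurable_fun setT k -> (forall p, (0 <= k p)%E) ->
  (\int[nu \x nu]_p k p <= (q ^+ 2)%:E * \int[m \x m]_p k p)%E.
Proof.
move=> q0 num mk k0.
have mkx x : measurable_fun setT (fun y => k (x, y)) by exact: measurableT_comp.
have mG (m' : {sigma_finite_measure set T -> \bar R}) :
    measurable_fun setT (fun x => \int[m']_y k (x, y))%E.
  exact: (measurable_fun_fubini_tonelli_F k).
have G0 (m' : {sigma_finite_measure set T -> \bar R}) x : (0 <= \int[m']_y k (x, y))%E.
  by apply: integral_ge0.
rewrite !fubini_tonelli1// /fubini_F/=.
apply: (@le_trans _ _ (\int[nu]_x (q%:E * \int[m]_y k (x, y)))%E).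
  apply: ge0_le_integral => //.
  - exact: measurable_funeM.
  - by move=> x _; apply: ge0_integral_dominated.
rewrite ge0_integralZl// expr2 EFinM -muleA; apply: lee_wpmul2l => //.
exact: ge0_integral_dominated.
Qed.

Section regularization.
Context (R : realType) (F : ambient R) (P : planar F) (beta beta' C0 : R).
Variable V : F -> R.
Hypothesis beta0 : 0 < beta.
Hypothesis beta_lt : beta < beta'.
Hypothesis V_cont : continuous (fun z => V (ret P z)).
Hypothesis V_growth : forall x, beta' * log1 x - C0 <= V x.
Local Notation W := (reduced_potential beta C0 V).
Local Notation E := (total_energy beta C0 V).
Local Notation EM := (cutoff_energy beta C0 V).
Local Notation k := (log_kernel beta).
Local Open Scope ereal_scope.
Implicit Types mu nu : probability F R.

Let k0 (p : F * F) : 0 <= k p.1 p.2. Proof. exact: (log_kernel_ge0 P). Qed.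
Let W0 (y : F) : (0 <= W y)%R.
Proof. by rewrite (reduced_potential_ge0 P beta_lt V_growth). Qed.
Let W0E (y : F) : 0 <= (W y)%:E.
Proof. by rewrite lee_fin. Qed.
Let mk : measurable_fun setT (fun p : F * F => k p.1 p.2).
Proof. exact: (measurable_log_kernel P). Qed.
Let mW : measurable_fun setT (EFin \o W).
Proof. by apply/measurable_EFinP; exact: (measurable_reduced_potential beta C0 V_cont). Qed.

Lemma total_energy_dominated mu nu (q : R) : (1 <= q)%R ->
  (forall A, measurable A -> nu A <= q%:E * mu A) -> E nu <= (q ^+ 2)%:E * E mu.
Proof.
move=> q1 numu; have q0 : (0 <= q)%R by lra.
have I1 : 0 <= \int[mu]_x (W x)%:E by exact: integral_ge0.
have I2 : 0 <= \int[mu \x mu]_p k p.1 p.2 by exact: integral_ge0.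
rewrite ge0_muleDr//; apply: leeD.
  apply: (le_trans (ge0_integral_dominated q0 numu mW _)) => //.
  by apply: lee_wpmul2r => //; rewrite lee_fin ler_eXnr.
exact: ge0_integral_pair_dominated.
Qed.

(** On these pairs the kernel is at least [beta / 2 * t], while its integral is at most [e];
    Markov's inequality. *)
Lemma near_diagonal_le mu (e t : R) : E mu = e%:E -> (0 < t)%R ->
  (mu \x mu) [set p | (dist p.1 p.2 < expR (- t))%R] <= (2 * e / (beta * t))%:E.
Proof.
move=> muE t0; pose a := (beta / 2 * t)%R.
have a0 : (0 < a)%R by rewrite mulr_gt0// divr_gt0.
have mD : measurable [set p : F * F | (dist p.1 p.2 < expR (- t))%R].
  rewrite (_ : mkset _ = (fun p : F * F => dist p.1 p.2) @^-1` `]-oo, (expR (- t))%R[%classic).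
    by rewrite -[X in measurable X]setTI; exact: (measurable_dist P).
  by apply/seteqP; split => u /=; rewrite in_itv.
have mA : measurable [set p : F * F | a%:E <= k p.1 p.2].
  by have := emeasurable_fun_c_infty measurableT mk a%:E; rewrite setTI.
apply: (@le_trans _ _ ((mu \x mu) [set p | a%:E <= k p.1 p.2])).
  apply: le_measure; rewrite ?inE// => -[x y] /= dt.
  apply: (log_kernelP P beta0 (Q := fun k => (_ <= k)%E)) => [|d0]; first exact: leey.
  rewrite lee_fin ler_pM2l ?divr_gt0//.
  have := log1_ge0 P x; have := log1_ge0 P y.
  have : (ln (dist x y) <= - t)%R by rewrite -ler_expR lnK// ltW.
  lra.
rewrite -(lee_pmul2l (x := a%:E))//.
apply: (le_trans (ge0_markov _ a0 mk k0)).
apply: (@le_trans _ _ e%:E).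
  by rewrite -muE leeDr//; exact: integral_ge0.
rewrite -EFinM lee_fin.
suff -> : (a * (2 * e / (beta * t)) = e)%R by [].
by rewrite /a; field; rewrite !gt_eqF.
Qed.

Section boundary_null.
Variables (U Ui Uc : set F).
Hypotheses (mU : measurable U) (mUi : measurable Ui) (mUc : measurable Uc).
Hypotheses (UiU : Ui `<=` U) (UUc : U `<=` Uc).
Hypotheses (oUi : open (ret P @^-1` Ui)) (oUc : open (ret P @^-1` (~` Uc))).

Lemma regularization_compact mu (r e d : R) : mu [set x | (r < modulus x)%R] = 0 ->
  E mu = e%:E -> mu (Uc `\` Ui) = 0 -> (0 < d)%R ->
  exists (nu : probability F R) (c : R), [/\ (0 <= c)%R,
    forall A, measurable A -> nu A <= c%:E * vol F A,
    E nu <= (e + d)%:E & (`|fine (nu U) - fine (mu U)| <= d)%R].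
Proof.
move=> mur muE bd0 d0.
have I1 : 0 <= \int[mu]_x (W x)%:E by exact: integral_ge0.
have I2 : 0 <= \int[mu \x mu]_p k p.1 p.2 by exact: integral_ge0.
have e0 : (0 <= e)%R by rewrite -lee_fin -muE adde_ge0.
have [nu nuE] := boolp.choice (fun n => convolution_exists P mu (noise P n.+1%:R^-1)).
(* Close pairs cost [7 * beta] times their mass, hence at most [14 * e / t], which has to be at most
   [d / 4]. The summand [1] keeps [t] positive when [e = 0]. *)
pose t := (56 * e / d + 1)%R.
have t0 : (0 < t)%R by rewrite ltr_wpDl// divr_ge0 ?mulr_ge0// ltW.
pose s := expR (- t).
have s0 : (0 < s)%R by exact: expR_gt0.
pose D := [set p : F * F | (dist p.1 p.2 < s)%R].
have mD : measurable D.
  rewrite (_ : D = (fun p : F * F => dist p.1 p.2) @^-1` `]-oo, s[%classic).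
    by rewrite -[X in measurable X]setTI; exact: (measurable_dist P).
  by apply/seteqP; split => u /=; rewrite in_itv.
have muD : (7 * beta)%:E * (mu \x mu) D <= (d / 4)%:E.
  apply: (@le_trans _ _ ((7 * beta)%:E * (2 * e / (beta * t))%:E)).
    by apply: lee_wpmul2l; [rewrite lee_fin mulr_ge0// ltW|exact: near_diagonal_le].
  rewrite -EFinM lee_fin.
  have -> : (7 * beta * (2 * e / (beta * t)) = 14 * e / t)%R by field; rewrite !gt_eqF.
  rewrite ler_pdivrMr// /t.
  have -> : (d / 4 * (56 * e / d + 1) = 14 * e + d / 4)%R by field; rewrite gt_eqF.
  by rewrite lerDl divr_ge0// ltW.
have cvW : \int[nu n]_x (W x)%:E @[n --> \oo] --> \int[mu]_x (W x)%:E.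
  have [C HC] := bounded_on_balls (r + 2) (reduced_potential_continuous (beta := beta) (C0 := C0) V_cont).
  apply: (convolution_cvg nuE (C := C) (r := r)) => //.
  - exact/measurable_EFinP.
  - apply: aeW => x; apply: (radially_continuousP (P := P)).
    by have := @reduced_potential_continuous _ _ P beta C0 V V_cont (emb P x); rewrite /continuous_at embK.
have cvU : nu n U @[n --> \oo] --> mu U.
  have intE (m : probability F R) : m U = \int[m]_x (\1_U x)%:E.
    by rewrite integral_indic// setIT.
  under eq_fun do rewrite intE; rewrite intE.
  apply: (convolution_cvg nuE (C := 1%R) (r := r)) => //.
  (* The indicator of [U] is locally constant on [Ui] and off [Uc]; what remains is a null set. *)
  exists (Uc `\` Ui); split => //; first exact: measurableD.
    move=> x /= nc; apply: contrapT => nx; apply: nc; apply: (radially_continuousP (P := P)).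
    have [Ux|nUx] := pselect (Ui x).
      apply: cvg_near_cst; have : nbhs (emb P x) (ret P @^-1` Ui).
        by apply: open_nbhs_nbhs; split => //; rewrite /preimage/= embK.
      by apply: filterS => z /UiU Uz; rewrite !indicE !mem_set//; exact: UiU.
    have ncx : ~ Uc x by move=> Ucx; apply: nx.
    apply: cvg_near_cst; have : nbhs (emb P x) (ret P @^-1` (~` Uc)).
      by apply: open_nbhs_nbhs; split => //; rewrite /preimage/= embK.
    by apply: filterS => z nUcz; rewrite !indicE !memNset// => /UUc.
have Wfin : \int[mu]_x (W x)%:E \is a fin_num.
  rewrite ge0_fin_numE//; apply: (@le_lt_trans _ _ (E mu)); first by rewrite leeDl.
  by rewrite muE ltry.
pose w := fine (\int[mu]_x (W x)%:E).
have near_W : \forall n \near \oo, \int[nu n]_x (W x)%:E <= (w + d / 4)%:E.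
  move: cvW; rewrite -(fineK Wfin) -/w => /fine_cvgP[fW /cvgr_le] /(_ (w + d / 4)%R) H.
  have /H : (w < w + d / 4)%R by rewrite ltrDl divr_gt0.
  move=> h; near=> n; rewrite -[leLHS]fineK; last by near: n.
  by rewrite lee_fin; near: n.
have near_U : \forall n \near \oo, (`|fine (nu n U) - fine (mu U)| <= d)%R.
  have : mu U \is a fin_num by rewrite fin_num_measure.
  move: cvU => /[swap] /fineK <- /fine_cvgP[_ /cvgrPdist_le] /(_ _ d0).
  by apply: filterS => n; rewrite distrC.
pose z n : R := (n.+1%:R^-1)%R.
have z0 n : (0 < z n)%R by rewrite invr_gt0.
have [n [hW hU hs hz]] : exists n, [/\ \int[nu n]_x (W x)%:E <= (w + d / 4)%:E,
    (`|fine (nu n U) - fine (mu U)| <= d)%R, (8 * z n <= s)%R &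
    (beta / 2 * (4 * z n + 8 * z n / s) <= d / 4)%R].
  have : \forall n \near \oo, [/\ \int[nu n]_x (W x)%:E <= (w + d / 4)%:E,
    (`|fine (nu n U) - fine (mu U)| <= d)%R, (8 * z n <= s)%R &
    (beta / 2 * (4 * z n + 8 * z n / s) <= d / 4)%R].
    near=> n; split.
    - by near: n.
    - by near: n.
    - rewrite /z ler_pdivrMr// -ler_pdivrMl// mulrC; near: n; exact: near_ler_nat.
    - have aux (N s' : R) : N != 0%R -> s' != 0%R ->
          (beta / 2 * (4 * N^-1 + 8 * N^-1 / s') = beta * (2 + 4 / s') / N)%R.
        by move=> N0 s0'; field; rewrite s0' N0.
      rewrite /z aux ?pnatr_eq0 ?gt_eqF//.
      rewrite ler_pdivrMr// -ler_pdivrMl ?divr_gt0// mulrC; near: n; exact: near_ler_nat.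
  by move=> [n _ /(_ n (leqnn n))]; exists n.
exists (nu n), (density P (z n)); split => //.
- exact: (density_ge0 P (z0 n)).
- exact: (convolution_dominated (z0 n) (nuE n)).
have z1 : (0 < z n <= 1)%R by rewrite z0/= invf_le1// ler1n.
apply: (total_energy_le P beta0 beta_lt V_growth) => M.
rewrite /cutoff_energy.
have mgM : measurable_fun setT (fun p : F * F => (cutoff_kernel beta M p.1 p.2)%:E).
  by apply/measurable_EFinP; exact: (measurable_cutoff_kernel P beta).
have gM0 (p : F * F) : 0 <= (cutoff_kernel beta M p.1 p.2)%:E.
  by rewrite lee_fin (cutoff_kernel_ge0 P beta0).
rewrite (convolution_pair (nuE n) mgM gM0).
pose c := (beta / 2 * (4 * z n + 8 * z n / s))%R.
pose g (p : F * F) := k p.1 p.2 + (cst c%:E p + (7 * beta)%:E * (\1_D p)%:E).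
have c0 : (0 <= c)%R.
  by rewrite /c mulr_ge0 ?divr_ge0// ?addr_ge0// ?divr_ge0 ?mulr_ge0// ltW.
have b7 : 0 <= (7 * beta)%:E by rewrite lee_fin mulr_ge0// ltW.
have m1D : measurable_fun setT (fun p : F * F => (\1_D p : R)%:E).
  by apply/measurable_EFinP; exact: measurable_indic.
have m7 : measurable_fun setT (fun p : F * F => (7 * beta)%:E * (\1_D p : R)%:E).
  exact: measurable_funeM.
have p7 (p : F * F) : 0 <= (7 * beta)%:E * (\1_D p : R)%:E by rewrite mule_ge0// lee_fin.
have m8 : measurable_fun setT (fun p : F * F => cst c%:E p + (7 * beta)%:E * (\1_D p : R)%:E).
  exact: emeasurable_funD.
have p8 (p : F * F) : 0 <= cst c%:E p + (7 * beta)%:E * (\1_D p : R)%:E.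
  by rewrite adde_ge0//= lee_fin.
have mg : measurable_fun setT g by exact: emeasurable_funD.
have g0 p : 0 <= g p by rewrite adde_ge0.
have gint : \int[mu \x mu]_p g p <= \int[mu \x mu]_p k p.1 p.2 + (d / 2)%:E.
  rewrite ge0_integralD// leeD2l// ge0_integralD//.
  rewrite (integral_cst_prob (mu \x mu)) ge0_integralZl// integral_indic// setIT.
  have -> : (d / 2 = d / 4 + d / 4)%R by field.
  by rewrite EFinD leeD// lee_fin.
apply: (@le_trans _ _ ((w + d / 4)%:E + (\int[mu \x mu]_p k p.1 p.2 + (d / 2)%:E))); last first.
  move: muE; rewrite /total_energy -(fineK Wfin) -/w.
  case: (\int[mu \x mu]_p k p.1 p.2) => [y| |]//.
  by rewrite -!EFinD => -[<-]; rewrite lee_fin; lra.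
apply: leeD; first exact: hW.
apply: le_trans gint; rewrite fubini_tonelli1// /fubini_F/=.
have mk2 := measurable_noise_kernel_mean P beta0 M (z n).
have q0 := noise_kernel_mean_ge0 P beta0 M (z n).
apply: ge0_le_integral => //.
- by move=> x _; apply: integral_ge0 => y _; exact: (q0 (x, y)).
- exact: (measurable_fun_fubini_tonelli_F (m2 := mu) _ mk2 q0).
- exact: (measurable_fun_fubini_tonelli_F (m2 := mu) _ mg g0).
move=> x _; apply: ge0_le_integral.
- exact: measurableT.
- by move=> y _; exact: (q0 (x, y)).
- by apply: (measurableT_comp mk2 (g := fun y => (x, y))); exact: measurable_fun_pair.
- by apply: (measurableT_comp mg (g := fun y => (x, y))); exact: measurable_fun_pair.
move=> y _; apply: (le_trans (noise_kernel_le P beta0 M x y z1 hs)).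
rewrite /g/= leeD2l// -EFinM -EFinD lee_fin lerD2l ler_wpM2l ?mulr_ge0 ?(ltW beta0)//.
by rewrite indicE; case: (ltP (dist x y) s) => // ds; rewrite mem_set.
Unshelve. all: by end_near. Qed.

Lemma regularization mu (d : R) : E mu < +oo -> mu (Uc `\` Ui) = 0 -> (0 < d)%R ->
  exists (nu : probability F R) (c : R), [/\ (0 <= c)%R,
    forall A, measurable A -> nu A <= c%:E * vol F A,
    E nu <= E mu + d%:E & (`|fine (nu U) - fine (mu U)| <= d)%R].
Proof.
move=> Eoo bd0 d0.
have E0 m : 0 <= E m by exact: (total_energy_ge0 P beta0 beta_lt V_growth).
have Efin : E mu \is a fin_num by rewrite ge0_fin_numE.
pose e := fine (E mu); have e0 : (0 <= e)%R by exact: fine_ge0.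
(* As [t <= 1], the factor [(1 + t) ^+ 2] raises the energy by at most [3 * t * e], hence by at most
   [d / 2], and the mass of [U] moves by at most [t], hence by at most [d / 6]. *)
pose t := Num.min 1%R (d / (6 * (e + 1)))%R.
have e6 : (0 < 6 * (e + 1))%R by rewrite mulr_gt0// ltr_wpDl.
have t0 : (0 < t)%R by rewrite lt_min ltr01 divr_gt0.
have t1 : (t <= 1)%R by rewrite ge_min lexx.
have td : (t * (6 * (e + 1)) <= d)%R by rewrite -ler_pdivlMr// ge_min lexx orbT.
have q1 : (1 < 1 + t)%R by rewrite ltrDl.
have [r [mu' [mu'r mu'le]]] := truncation_exists mu (measurable_modulus P) q1.
have Ele := total_energy_dominated (ltW q1) mu'le.
have E'fin : E mu' \is a fin_num.
  by rewrite ge0_fin_numE// (le_lt_trans Ele)// -(fineK Efin) -EFinM ltry.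
have d2 : (0 < d / 2)%R by rewrite divr_gt0.
have bd' : mu' (Uc `\` Ui) = 0.
  apply/eqP; rewrite -measure_le0; apply: (le_trans (mu'le _ _)).
    exact: measurableD.
  by rewrite bd0 mule0.
have [nu [c [c0 nuc nuE nuU]]] := regularization_compact mu'r (esym (fineK E'fin)) bd' d2.
exists nu, c; split => //.
  apply: (le_trans nuE); rewrite EFinD fineK//.
  apply: (@le_trans _ _ (((1 + t) ^+ 2)%:E * E mu + (d / 2)%:E)); first by rewrite leeD2r.
  rewrite -(fineK Efin) -/e -EFinM -!EFinD lee_fin expr2; nra.
have := dominated_prob_close (ltW q1) mu'le mU.
have := ler_normD (fine (nu U) - fine (mu' U))%R (fine (mu' U) - fine (mu U))%R.
rewrite addrA subrK => h1 h2; apply: (le_trans h1).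
have : (t * (6 * (e + 1)) >= t * 6)%R by move: t0 e0; nra.
by move: nuU h2 td; lra.
Qed.

End boundary_null.

End regularization.

(** * Large deviations on a planar space *)

Section asymptotics.
Local Open Scope ereal_scope.
Context (R : realType).
Implicit Types u : (\bar R)^nat.

Lemma limn_esup_le_near u (l : \bar R) : (\forall n \near \oo, u n <= l) -> limn_esup u <= l.
Proof.
move=> ul; apply: (@le_trans _ _ (ereal_sup (u @` [set n | u n <= l]))).
  by apply: ereal_inf_lbound; exists [set n | u n <= l].
by apply: ub_ereal_sup => _ [n /= unl <-].
Qed.

Lemma limn_einf_ge_near u (l : \bar R) : (\forall n \near \oo, l <= u n) -> l <= limn_einf u.
Proof.
move=> lu; rewrite /limn_einf leeNr; apply: limn_esup_le_near.
by apply: filterS lu => n; rewrite leeN2.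
Qed.

Lemma lee_all_below (x y : \bar R) : (forall a : R, a%:E < y -> x <= (- a)%:E) -> x <= - y.
Proof.
case: y => [r| |] H; last by rewrite leey.
- apply/lee_addgt0Pr => e e0.
  rewrite -EFinN -EFinD (_ : - r + e = - (r - e))%R; last by ring.
  by apply: H; rewrite lte_fin gtrBl.
- move: H; case: x => [x| |] H //=.
    by have := H (1 - x)%R (ltry _); rewrite lee_fin => h; exfalso; move: h; lra.
  by have := H 0%R (ltry _).
Qed.

(** For arbitrary sets: the integral of a nonnegative function is a supremum over the simple
    functions below it. This covers events that bear on the empirical measure through an arbitrary
    set of measures. *)
Lemma ge0_integral_subset d (T : measurableType d) (m : {measure set T -> \bar R})
  (A B : set T) (f : T -> \bar R) : (forall x, 0 <= f x) -> A `<=` B ->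
  \int[m]_(x in A) f x <= \int[m]_(x in B) f x.
Proof.
move=> f0 AB; rewrite (integral_mkcond A) (integral_mkcond B).
have fr0 D x : 0 <= (f \_ D) x by rewrite patchE; case: ifP.
rewrite !ge0_integralTE//; apply: ub_ereal_sup => _ [h /= hf <-].
apply: ereal_sup_ubound; exists h => //= x; apply: (le_trans (hf x)).
rewrite !patchE; case: ifPn => [|_]; last by case: ifP.
by rewrite inE => /AB Bx; rewrite mem_set.
Qed.

End asymptotics.

(** * Minimal energy and the partition function *)

Section ensemble_asymptotics.
Context (R : realType) (F : ambient R) (P : planar F) (beta beta' C0 : R).
Variable V : F -> R.
Hypothesis beta0 : 0 < beta.
Hypothesis beta_lt : beta < beta'.
Hypothesis C0_ge0 : 0 <= C0.
Hypothesis V_ge0 : forall x, 0 <= V x.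
Hypothesis V_cont : continuous (fun z => V (ret P z)).
Hypothesis V_growth : forall x, beta' * log1 x - C0 <= V x.
Local Notation W := (reduced_potential beta C0 V).
Local Notation E := (total_energy beta C0 V).
Local Notation EM := (cutoff_energy beta C0 V).
Local Open Scope ereal_scope.
Implicit Types mu nu : probability F R.

Let E0 mu : 0 <= E mu.
Proof. exact: (total_energy_ge0 P beta0 beta_lt V_growth). Qed.

(** A Dirac mass convolved with unit noise: the bound for the smoothed kernel holds on the
    diagonal. *)
Lemma finite_energy_exists : exists mu, E mu < +oo.
Proof.
pose x0 : F := ret P (0%R, 0%R).
pose mu : probability F R := \d_x0.
have mW : measurable_fun setT (EFin \o W).
  by apply/measurable_EFinP; exact: (measurable_reduced_potential beta C0 V_cont).
have W0 (y : F) : 0 <= (W y)%:E.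
  by rewrite lee_fin (reduced_potential_ge0 P beta_lt V_growth).
have e1 : (0 < 1 :> R)%R by exact: ltr01.
have [nu nuE] := convolution_exists P mu (noise P 1).
exists nu.
have [C HC] := bounded_on_balls (modulus x0 + 2) (reduced_potential_continuous (beta := beta) (C0 := C0) V_cont).
pose c := (beta / 2 * (log1 x0 + log1 x0 + 4 * 1 - ln 1 + 2))%R.
apply: (@le_lt_trans _ _ (`|C|%R%:E + c%:E)); last by rewrite -EFinD ltry.
apply: (total_energy_le P beta0 beta_lt V_growth) => M.
have mgM : measurable_fun setT (fun p : F * F => (cutoff_kernel beta M p.1 p.2)%:E).
  by apply/measurable_EFinP; exact: (measurable_cutoff_kernel P beta).
have gM0 (p : F * F) : 0 <= (cutoff_kernel beta M p.1 p.2)%:E.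
  by rewrite lee_fin (cutoff_kernel_ge0 P beta0).
apply: leeD.
  rewrite nuE// integral_dirac//; last exact: (measurable_convolution_inner P (noise P 1) mW W0).
  rewrite diracT mul1e; apply: noise_cst_le => //.
    exact: (measurableT_comp mW (measurable_addl P x0)).
  move=> u; rewrite mulr1 => u2; rewrite lee_fin (le_trans _ (ler_norm _))// HC//.
  by rewrite (le_trans (modulus_add P x0 u))// lerD2l.
rewrite (convolution_pair nuE mgM gM0).
have mk2 := measurable_noise_kernel_mean P beta0 M 1.
have q0 := noise_kernel_mean_ge0 P beta0 M 1.
rewrite integral_dirac//; last first.
  exact: (measurable_fun_fubini_tonelli_F (m2 := mu) _ mk2 q0).
have mk3 : measurable_fun setT (fun y => \int[noise P 1]_u \int[noise P 1]_v
    (cutoff_kernel beta M (add P x0 u) (add P y v))%:E).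
  by apply: (measurableT_comp mk2 (g := fun y => (x0, y))); exact: measurable_fun_pair.
rewrite diracT mul1e (integral_dirac x0 measurableT mk3) diracT mul1e.
apply: (noise_kernel_near P beta0).
by rewrite ltr01 lexx.
Qed.

Lemma total_inf_fin_num : total_inf beta C0 V \is a fin_num.
Proof.
rewrite ge0_fin_numE; last exact: (total_inf_ge0 P beta0 beta_lt V_growth).
have [mu muE] := finite_energy_exists; apply: le_lt_trans muE.
by apply: ereal_inf_lbound; exists mu.
Qed.

Definition e_min : R := fine (total_inf beta C0 V).

Lemma e_minE : e_min%:E = total_inf beta C0 V.
Proof. exact: (fineK total_inf_fin_num). Qed.

Lemma e_min_le mu : e_min%:E <= E mu.
Proof. by rewrite e_minE; apply: ereal_inf_lbound; exists mu. Qed.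

Lemma near_minimizer (d : R) : (0 < d)%R -> exists mu, E mu < (e_min + d)%:E.
Proof.
move=> d0; have : total_inf beta C0 V < (e_min + d)%:E by rewrite -e_minE lte_fin ltrDl.
by move=> /ereal_inf_lt[_ [mu _ <-]] muE; exists mu.
Qed.

Lemma I_beta_min mu : I_beta beta V mu = E mu - e_min%:E.
Proof.
by rewrite (I_betaE beta0 beta_lt C0_ge0 V_ge0 V_cont V_growth)// ?e_minE//; exact: total_inf_fin_num.
Qed.

(** The open-set part of the portmanteau theorem, along the filter [UU]. *)
Definition open_limit (UU : set_system nat) (nu : nat -> probability F R) mu :=
  forall (G : set F) (c : R), open (ret P @^-1` G) -> measurable G ->
    (\forall n \near UU, nu n G <= c%:E) -> mu G <= c%:E.

(** If every level failed, one offending measure per level would give a sequence whose compactness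
    limit is excluded. The single level obtained for all of [S] makes the upper bound on the weight
    uniform. *)
Lemma cutoff_energy_gap (S : set (probability F R)) (a : R) :
  (forall (nu : nat -> probability F R) mu UU, (forall n, S (nu n)) -> UltraFilter UU -> E mu <= a%:E ->
     open_limit UU nu mu -> False) ->
  exists M, forall nu, S nu -> a%:E < EM M nu.
Proof.
move=> H; apply: contrapT => /forallNP nex.
have {nex} ex M : exists nu, S nu /\ EM M nu <= a%:E.
  apply: contrapT => h; apply: (nex M) => nu Snu; rewrite ltNge; apply/negP => le.
  by apply: h; exists nu.
have [nu nuP] := boolp.choice ex.
have [mu [UU [UUF _ muE lim]]] := energy_compactness beta0 beta_lt V_cont V_growth
  (fun n => (nuP n).2).
by apply: (H nu mu UU) => // n; exact: (nuP n).1.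
Qed.

Definition weight_mass (n : nat) (A : set (n.+1.-tuple F)) : \bar R :=
  \int[tuple_measure (vol F) n.+1]_(x in A) (ensemble_weight beta V x)%:E.

Lemma weight_mass_le n (A B : set (n.+1.-tuple F)) : A `<=` B ->
  weight_mass A <= weight_mass B.
Proof. by apply: ge0_integral_subset => x; rewrite lee_fin weight_ge0. Qed.

Lemma partition_upper (eta : R) : (0 < eta)%R ->
  \forall n \near \oo, partition_function beta V n.+1 <=
    (expR (n.+1%:R ^+ 2 * (C0 - e_min + eta)))%:E.
Proof.
move=> eta0; have eta2 : (0 < eta / 2)%R by rewrite divr_gt0.
have [nu mu UU _ _|M HM] := @cutoff_energy_gap setT (e_min - eta / 2)%R.
  by move=> /(le_trans (e_min_le mu)); rewrite lee_fin; lra.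
have := weight_integral_bound beta0 beta_lt V_cont V_growth M (e_min - eta / 2)%R eta2.
apply: filterS => n /(_ setT measurableT) h.
apply: (le_trans (h _)) => [x _|]; first exact/ltW/HM.
by rewrite lee_fin ler_expR; apply: ler_wpM2l; [exact: exprn_ge0|lra].
Qed.

Lemma partition_lower (eta : R) : (0 < eta)%R ->
  \forall n \near \oo, (expR (n.+1%:R ^+ 2 * (C0 - e_min - eta)))%:E <=
    partition_function beta V n.+1.
Proof.
move=> eta0; have eta3 : (0 < eta / 3)%R by rewrite divr_gt0.
have [mu muE] := near_minimizer eta3.
have muoo : E mu < +oo by apply: lt_trans muE _; rewrite ltry.
have [|||nu [c [c0 nuc nuE _]]] := regularization beta0 beta_lt V_cont V_growth
   (U := setT) (Ui := setT) (Uc := setT) measurableT measurableT measurableT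
   (fun _ => id) (fun _ => id) _ _ muoo _ eta3.
- by rewrite preimage_setT; exact: openT.
- by rewrite setCT preimage_set0; exact: open0.
- by rewrite setDv measure0.
have nufin : E nu \is a fin_num.
  by rewrite ge0_fin_numE// (le_lt_trans nuE)// -(fineK (_ : E mu \is a fin_num)) ?ge0_fin_numE// -EFinD ltry.
have nule : (fine (E nu) <= e_min + eta / 3 + eta / 3)%R.
  rewrite -lee_fin fineK// (le_trans nuE)// [leRHS]EFinD leeD2r//.
  exact: ltW.
have := weight_integral_lower_dominated beta0 beta_lt V_cont V_growth nuc c0
  (esym (fineK nufin)) measurableT ltr01 eta3.
apply: filterS => n h.
have -> : partition_function beta V n.+1 = @weight_mass n setT by [].
apply: (@le_trans _ _ (expR (n.+1%:R ^+ 2 * (C0 - fine (E nu) - eta / 3)))%:E).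
  by rewrite lee_fin ler_expR; apply: ler_wpM2l; [exact: exprn_ge0|lra].
by apply: (le_trans h); exact: weight_mass_le.
Qed.

End ensemble_asymptotics.

(** * Large deviation bounds and the rate function *)

Section large_deviation_principle.
Context (R : realType) (F : ambient R) (P : planar F) (beta beta' C0 : R).
Variable V : F -> R.
Hypothesis beta0 : 0 < beta.
Hypothesis beta_lt : beta < beta'.
Hypothesis C0_ge0 : 0 <= C0.
Hypothesis V_ge0 : forall x, 0 <= V x.
Hypothesis V_cont : continuous (fun z => V (ret P z)).
Hypothesis V_growth : forall x, beta' * log1 x - C0 <= V x.
Variables (U Ui Uc : set F).
Hypotheses (mU : measurable U) (mUi : measurable Ui) (mUc : measurable Uc).
Hypotheses (UiU : Ui `<=` U) (UUc : U `<=` Uc).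
Hypotheses (oUi : open (ret P @^-1` Ui)) (oUc : open (ret P @^-1` (~` Uc))).
(* [M] restricts the infimum defining the rate function and [M'] the empirical measures in the
   upper bound: on the plane both are [M1*], on the line [M'] is everything. *)
Variables (M M' : set (probability F R)).
Hypothesis MM' : M `<=` M'.
Hypothesis M_null : forall mu, M mu -> mu (Uc `\` Ui) = 0%E.
Hypothesis M_limit : forall (nu : nat -> probability F R) mu UU, UltraFilter UU ->
  (forall n, M' (nu n)) -> open_limit P UU nu mu ->
  (total_energy beta C0 V mu < +oo)%E -> M mu.
Local Notation W := (reduced_potential beta C0 V).
Local Notation E := (total_energy beta C0 V).
Local Notation EM := (cutoff_energy beta C0 V).
Local Notation emin := (e_min beta C0 V).
Local Notation mass := (@weight_mass R F beta V _).
Local Notation gam := (gamma beta V M U).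
Local Open Scope ereal_scope.
Implicit Types mu : probability F R.

Let IE mu : I_beta beta V mu = E mu - emin%:E.
Proof. exact: (I_beta_min beta0 beta_lt C0_ge0 V_ge0 V_cont V_growth). Qed.

Lemma gamma_le mu x : M mu -> mu U = x%:E -> gam x <= E mu - emin%:E.
Proof. by move=> Mmu muU; rewrite -IE; apply: ereal_inf_lbound; exists mu. Qed.

Lemma gamma_ge0 x : 0 <= gam x.
Proof.
apply: le_ereal_inf_tmp => _ [mu _ <-]; rewrite IE sube_ge0//.
exact: (e_min_le beta0 beta_lt V_cont V_growth).
Qed.

(** Upper bounds on the open sets [Ui] and complement of [Uc] enclose [mu U], because the set
    between [Ui] and [Uc] is null. *)
Lemma open_limit_U UU (nu : nat -> probability F R) mu (l : R) : UltraFilter UU ->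
  open_limit P UU nu mu -> mu (Uc `\` Ui) = 0 ->
  fine (nu n U) @[n --> UU] --> l -> mu U = l%:E.
Proof.
move=> UUF lim mu0 cl.
have fin (m : probability F R) A : measurable A -> m A \is a fin_num.
  by move=> mA; rewrite fin_num_measure.
have muUi : mu U <= mu Ui.
  rewrite -[leRHS]adde0 -mu0 -measureU//; last 2 first.
  - exact: measurableD.
  - by apply/seteqP; split => // x [? []].
  apply: le_measure; rewrite ?inE//; first exact/measurableU/measurableD.
  move=> x Ux; have [Ix|nIx] := pselect (Ui x); [by left|right].
  by split => //; exact: UUc.
have muUc : mu (~` U) <= mu (~` Uc).
  rewrite -[leRHS]adde0 -mu0 -measureU//; last 3 first.
  - exact: measurableC.
  - exact: measurableD.
  - by apply/seteqP; split => // x [? []].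
  apply: le_measure; rewrite ?inE//; first exact: measurableC.
    by apply: measurableU; [exact: measurableC|exact: measurableD].
  move=> x nUx; have [cx|ncx] := pselect (Uc x); [right|by left].
  by split => // /UiU.
have up (e : R) : (0 < e)%R -> mu U <= (l + e)%:E.
  move=> e0; apply: (le_trans muUi); apply: (lim _ _ oUi mUi).
  have := cl => /cvgr_le /(_ (l + e)%R); rewrite ltrDl => /(_ e0).
  apply: filterS => n le; apply: (@le_trans _ _ (nu n U)).
    by apply: le_measure; rewrite ?inE.
  by rewrite -(fineK (fin _ _ mU)) lee_fin.
have dn (e : R) : (0 < e)%R -> mu (~` U) <= (1 - l + e)%:E.
  move=> e0; apply: (le_trans muUc); apply: (lim _ _ oUc (measurableC mUc)).
  have := cl => /cvgr_ge /(_ (l - e)%R); rewrite gtrBl => /(_ e0).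
  apply: filterS => n ge; apply: (@le_trans _ _ (nu n (~` U))).
    by apply: le_measure; rewrite ?inE//; [exact: measurableC|exact: measurableC|exact: subsetC].
  rewrite probability_setC// -(fineK (fin _ _ mU)) -EFinB lee_fin; lra.
have muUE := fineK (fin mu _ mU).
apply/eqP; rewrite eq_le; apply/andP; split; apply/lee_addgt0Pr => e e0; first exact: up.
have := dn e e0; rewrite probability_setC// -muUE -EFinB -EFinD !lee_fin; lra.
Qed.

Lemma fractionE n (x : n.+1.-tuple F) : fraction_in_U U x = (count_in R U x / n.+1%:R)%R.
Proof.
rewrite /fraction_in_U /empirical (eq_bigr (fun i => (\1_U (tnth x i))%:E)).
  by rewrite sumEFin -EFinM /= mulrC.
by move=> i _; rewrite diracE indicE.
Qed.

Lemma measurable_fraction n : measurable_fun setT (@fraction_in_U R F U n).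
Proof.
rewrite (_ : @fraction_in_U R F U n = fun x => (count_in R U x / n.+1%:R)%R).
  by apply: measurable_funM => //; exact: measurable_count.
by apply/funext => x; exact: fractionE.
Qed.

Lemma fraction01 n (x : n.+1.-tuple F) : (0 <= fraction_in_U U x <= 1)%R.
Proof.
pose m : probability F R := empirical x.
have h : m U \is a fin_num by rewrite fin_num_measure.
rewrite -[fraction_in_U U x]/(fine (m U)) fine_ge0 ?measure_ge0//= -lee_fin fineK//.
exact: probability_le1.
Qed.

Lemma log_prob_ge (A : set R) n (b : R) :
  (expR (n.+1%:R ^+ 2 * b))%:E <= ensemble beta V [set x : n.+1.-tuple F | A (fraction_in_U U x)] ->
  b%:E <= log_prob_fraction beta V U A n.
Proof.
move=> h; have N0 : (0 < n.+1%:R ^+ 2 :> R)%R by rewrite exprn_gt0.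
rewrite /log_prob_fraction -(lee_pmul2l (x := (n.+1%:R ^+ 2)%:E))//.
have NN : (n.+1%:R ^+ 2)%:E * (n.+1%:R ^- 2)%:E = 1 :> \bar R.
  by rewrite -EFinM divff// gt_eqF.
rewrite muleA NN mul1e -EFinM.
rewrite -[X in X%:E <= _]expRK -lne_EFin ?expR_gt0// lee_lne//.
- by rewrite in_itv/= leey andbT lee_fin expR_ge0.
- by rewrite in_itv/= leey andbT (le_trans _ h)// lee_fin expR_ge0.
Qed.

Lemma log_prob_le (A : set R) n (b : R) :
  0 <= ensemble beta V [set x : n.+1.-tuple F | A (fraction_in_U U x)] ->
  ensemble beta V [set x : n.+1.-tuple F | A (fraction_in_U U x)] <= (expR (n.+1%:R ^+ 2 * b))%:E ->
  log_prob_fraction beta V U A n <= b%:E.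
Proof.
move=> h0 h; have N0 : (0 < n.+1%:R ^+ 2 :> R)%R by rewrite exprn_gt0.
rewrite /log_prob_fraction -(lee_pmul2l (x := (n.+1%:R ^+ 2)%:E))//.
have NN : (n.+1%:R ^+ 2)%:E * (n.+1%:R ^- 2)%:E = 1 :> \bar R.
  by rewrite -EFinM divff// gt_eqF.
rewrite muleA NN mul1e -EFinM.
rewrite -[X in _ <= X%:E]expRK -lne_EFin ?expR_gt0// lee_lne//.
- by rewrite in_itv/= leey andbT.
- by rewrite in_itv/= leey andbT lee_fin expR_ge0.
Qed.

Let near_partition (eta : R) : (0 < eta)%R ->
  \forall n \near \oo, exists z : R, [/\ partition_function beta V n.+1 = z%:E,
    (expR (n.+1%:R ^+ 2 * (C0 - emin - eta)) <= z)%R &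
    (z <= expR (n.+1%:R ^+ 2 * (C0 - emin + eta)))%R].
Proof.
move=> eta0.
have h1 := partition_upper beta0 beta_lt V_cont V_growth eta0.
have h2 := partition_lower beta0 beta_lt V_cont V_growth eta0.
near=> n.
have lo : (expR (n.+1%:R ^+ 2 * (C0 - emin - eta)))%:E <= partition_function beta V n.+1.
  by near: n.
have up : partition_function beta V n.+1 <= (expR (n.+1%:R ^+ 2 * (C0 - emin + eta)))%:E.
  by near: n.
exists (fine (partition_function beta V n.+1)).
have fZ : partition_function beta V n.+1 \is a fin_num.
  rewrite ge0_fin_numE; first by rewrite (le_lt_trans up)// ltry.
  by rewrite (le_trans _ lo)// lee_fin expR_ge0.
by rewrite fineK//; split => //; rewrite -lee_fin fineK.
Unshelve. all: by end_near. Qed.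

Lemma mul_ensemble n (A : set (n.+1.-tuple F)) (z : R) :
  partition_function beta V n.+1 = z%:E -> (0 < z)%R ->
  z%:E * ensemble beta V A = mass A.
Proof.
move=> Zz z0; have zz : z%:E * (z^-1)%:E = 1 :> \bar R by rewrite -EFinM divff// gt_eqF.
by rewrite /ensemble Zz/= muleA zz mul1e.
Qed.

Lemma lower_bound_at (O : set R) mu (x e eta d : R) :
  M mu -> E mu = e%:E -> mu U = x%:E -> (0 < eta)%R -> (0 < d)%R ->
  (forall y, (0 <= y <= 1)%R -> (`|y - x| < d)%R -> O y) ->
  \forall n \near \oo, (emin - e - eta)%:E <= log_prob_fraction beta V U O n.
Proof.
move=> Mmu muE muU eta0 d0 Oxd.
have muoo : E mu < +oo by rewrite muE ltry.
(* A third of [eta] goes to each of regularization, sampling and partition function; half of [d]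
   goes to the change of mass and half to the fluctuation of the fraction. *)
pose t := Num.min (eta / 3)%R (d / 2)%R.
have t0 : (0 < t)%R by rewrite lt_min !divr_gt0.
have t1 : (t <= eta / 3)%R by rewrite ge_min lexx.
have t2 : (t <= d / 2)%R by rewrite ge_min lexx orbT.
have [nu [c [c0 nuc nuE nuU]]] := regularization beta0 beta_lt V_cont V_growth
  mU mUi mUc UiU UUc oUi oUc muoo (M_null Mmu) t0.
have E0 := total_energy_ge0 P beta0 beta_lt V_growth nu.
have nufin : E nu \is a fin_num by rewrite ge0_fin_numE// (le_lt_trans nuE)// muE -EFinD ltry.
have nule : (fine (E nu) <= e + t)%R.
  by rewrite -lee_fin fineK// (le_trans nuE)// muE -EFinD.
have d2 : (0 < d / 2)%R by rewrite divr_gt0.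
have h1 := weight_integral_lower_dominated beta0 beta_lt V_cont V_growth nuc c0
  (esym (fineK nufin)) mU d2 t0.
have h2 := near_partition t0.
near=> n; apply: log_prob_ge.
have [z [Zz zlo zup]] : exists z : R, [/\ partition_function beta V n.+1 = z%:E,
    (expR (n.+1%:R ^+ 2 * (C0 - emin - t)) <= z)%R &
    (z <= expR (n.+1%:R ^+ 2 * (C0 - emin + t)))%R] by near: n.
have z0 : (0 < z)%R by apply: lt_le_trans zlo; exact: expR_gt0.
rewrite -(lee_pmul2l (x := z%:E))// (mul_ensemble _ Zz)//.
apply: (@le_trans _ _ (expR (n.+1%:R ^+ 2 * (C0 - fine (E nu) - t)))%:E).
  rewrite -EFinM lee_fin; apply: (le_trans (ler_wpM2r (expR_ge0 _) zup)).
  rewrite -expRD ler_expR -mulrDr; apply: ler_wpM2l; [exact: exprn_ge0|lra].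
have h3 : (expR (n.+1%:R ^+ 2 * (C0 - fine (E nu) - t)))%:E <=
    mass [set x : n.+1.-tuple F | (`|count_in R U x / n.+1%:R - fine (nu U)| < d / 2)%R].
  by near: n.
apply: (le_trans h3); apply: weight_mass_le => y /= yd.
apply: Oxd; first exact: fraction01.
rewrite fractionE; move: nuU; rewrite muU /= => nuU.
apply: le_lt_trans (ler_distD (fine (nu U)) _ _) _; lra.
Unshelve. all: by end_near. Qed.

Theorem planar_lower_bound (O : set R) : O `<=` `[0%R, 1%R] ->
  open (O : set (subspace (`[0%R, 1%R] : set R))) -> ld_lower_bound beta V M U O.
Proof.
move=> O01 oO; rewrite /ld_lower_bound leeNl.
apply: le_ereal_inf_tmp => _ [x Ox <-]; apply: le_ereal_inf_tmp => _ [mu [Mmu muU] <-].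
rewrite IE; have E0 := total_energy_ge0 P beta0 beta_lt V_growth mu.
have [muoo|] := ltP (E mu) +oo; last by rewrite leye_eq => /eqP ->; rewrite addye ?leey.
have muE : E mu = (fine (E mu))%:E by rewrite fineK// ge0_fin_numE.
have [d d0 Oxd] : exists2 d : R, (0 < d)%R &
    forall y, (0 <= y <= 1)%R -> (`|y - x| < d)%R -> O y.
  have x01 : (`[0%R, 1%R]%classic : set R) x by exact: O01.
  have := (nbhs_subspace_ex O x01).1 => /(_ (open_nbhs_nbhs (conj oO Ox))) [Q nQ OQ].
  move/nbhs_ballP : nQ => [d /= d0 dQ]; exists d => // y y01 yd.
  suff : (O `&` `[0%R, 1%R]) y by case.
  by rewrite OQ; split; [apply: dQ; rewrite /ball/= distrC|rewrite /= in_itv].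
rewrite leeNl; apply/lee_subgt0Pr => eta eta0.
apply: limn_einf_ge_near.
have := lower_bound_at Mmu muE muU eta0 d0 Oxd.
apply: filterS => n; apply: le_trans.
by rewrite muE -EFinB lee_fin /=; lra.
Qed.

Lemma measurable_energy_level K n (a : R) :
  measurable [set x : n.+1.-tuple F | a%:E <= EM K (empirical x : probability F R)].
Proof.
have mW : measurable_fun setT W := measurable_reduced_potential beta C0 V_cont.
have mp : measurable_fun [set: n.+1.-tuple F]
    (fun x => (pair_sum beta C0 V K x / n.+1%:R ^+ 2)%R).
  apply: measurable_funM => //; apply: measurable_funD.
    apply: measurable_funM => //; apply: measurable_sum => i.
    exact: (measurableT_comp mW (measurable_tnth i)).
  apply: measurable_sum => i; apply: measurable_sum => j.
  apply: (measurableT_comp (measurable_cutoff_kernel P beta K)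
    (g := fun x : n.+1.-tuple F => (tnth x i, tnth x j))).
  by apply: measurable_fun_pair; exact: measurable_tnth.
rewrite (_ : mkset _ = (fun x => (pair_sum beta C0 V K x / n.+1%:R ^+ 2)%R) @^-1` `[a, +oo[%classic).
  by rewrite -[X in measurable X]setTI; exact: mp.
apply/seteqP; split => x /=; rewrite in_itv/= andbT;
  by rewrite (cutoff_energy_empirical beta0 beta_lt V_cont V_growth) lee_fin.
Qed.

Lemma near_powR_le (alpha eta : R) : (alpha < 2)%R -> (0 < eta)%R ->
  \forall n \near \oo, (1 + expR (n.+1%:R `^ alpha) <= expR (n.+1%:R ^+ 2 * eta))%R.
Proof.
move=> a2 eta0; have c0 : (0 < 2 - alpha)%R by rewrite subr_gt0.
have eta2 : (0 < 2 / eta)%R by rewrite divr_gt0.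
near=> n; set N : R := n.+1%:R.
have N0 : (0 < N)%R by rewrite ltr0n.
have h1 : (2 / eta <= N `^ (2 - alpha))%R.
  have -> : (2 / eta = ((2 / eta) `^ (2 - alpha)^-1) `^ (2 - alpha))%R.
    by rewrite -powRrM mulVf ?gt_eqF// powRr1// ltW.
  apply: ge0_ler_powR; rewrite ?nnegrE ?powR_ge0//; first exact: ltW.
  by rewrite /N; near: n; exact: near_ler_nat.
have h2 : (N `^ alpha * N `^ (2 - alpha) = N ^+ 2)%R.
  rewrite -powRD; last by apply/implyP => _; rewrite gt_eqF.
  by rewrite addrC subrK powR_mulrn// ltW.
have h3 : (2 / eta <= N ^+ 2)%R.
  have N1 : (1 <= N)%R by rewrite ler1n.
  have : (2 / eta <= N)%R by rewrite /N; near: n; exact: near_ler_nat.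
  by move/le_trans; apply; rewrite expr2 ler_peMr// ltW.
have p0 : (0 <= N `^ alpha)%R by exact: powR_ge0.
apply: (@le_trans _ _ (expR (1 + N `^ alpha)%R)).
  have := expR_ge1Dx (1 : R); rewrite expRD.
  have : (1 <= expR (N `^ alpha))%R by rewrite -expR0 ler_expR.
  nra.
rewrite ler_expR.
have h4 : (1 <= N ^+ 2 * (eta / 2))%R.
  by rewrite -ler_pdivrMr ?divr_gt0// (le_trans _ h3)// invf_div mul1r.
have h5 : (N `^ alpha <= N ^+ 2 * (eta / 2))%R.
  rewrite -h2 -mulrA ler_peMr// -ler_pdivrMr ?divr_gt0// mul1r invf_div//.
lra.
Unshelve. all: by end_near. Qed.

Theorem planar_upper_bound (C : set R) : C `<=` `[0%R, 1%R] ->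
  closed (C : set (subspace (`[0%R, 1%R] : set R))) ->
  negligible_outside beta V M' U C -> ld_upper_bound beta V M U C.
Proof.
move=> C01 cC [alpha [/andP[al0 al2] negl]].
have {}cC : closed C.
  rewrite (_ : C = (`[0%R, 1%R]%classic : set R) `&` C); last by rewrite setIidr.
  by rewrite closed_setSI//; exact: interval_closed.
(* Arguing with every real [a] below the infimum of the rate covers an infinite infimum too. *)
apply: lee_all_below => a aC; apply/lee_addgt0Pr => eta eta0.
have eta3 : (0 < eta / 3)%R by rewrite divr_gt0.
pose S := [set nu : probability F R | C (fine (nu U)) /\ M' nu].
(* A limit of measures in [S] with energy at most [e_min + a] would be in [M] and give [U] a mass in
   the closed set [C] where the rate is at most [a], against the choice of [a]. *)
have [nu mu UU Snu UUF muE lim|K HK] :=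
    @cutoff_energy_gap _ _ P _ _ _ _ beta0 beta_lt V_cont V_growth S (emin + a)%R.
  have muoo : E mu < +oo by rewrite (le_lt_trans muE) ?ltry.
  have Mmu : M mu by apply: M_limit lim muoo => // n; exact: (Snu n).2.
  have [|l cl] := @ultra_limit R UU (fun n => fine (nu n U)) UUF.
    by move=> k; have /C01 := (Snu k).1; rewrite /= in_itv.
  have Cl : C l.
    by apply: (closed_cvg C cC _ l cl); apply: nearW => n; exact: (Snu n).1.
  have muU := open_limit_U UUF lim (M_null Mmu) cl.
  have : gam l <= a%:E.
    apply: (le_trans (gamma_le Mmu muU)); rewrite leeBlDr//.
    by rewrite -EFinD addrC.
  apply/negP; rewrite -ltNge; apply: (lt_le_trans aC).
  by apply: ereal_inf_lbound; exists l.
apply: limn_esup_le_near.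
have h1 := weight_integral_bound beta0 beta_lt V_cont V_growth K (emin + a)%R eta3.
have h2 := near_partition eta3.
have h3 := near_powR_le al2 eta3.
near=> n.
have [z [Zz zlo zup]] : exists z : R, [/\ partition_function beta V n.+1 = z%:E,
    (expR (n.+1%:R ^+ 2 * (C0 - emin - eta / 3)) <= z)%R &
    (z <= expR (n.+1%:R ^+ 2 * (C0 - emin + eta / 3)))%R] by near: n.
have z0 : (0 < z)%R by apply: lt_le_trans zlo; exact: expR_gt0.
pose A := [set x : n.+1.-tuple F | C (fraction_in_U U x)].
(* A measurable event that contains every configuration of [A] whose empirical measure is in [M'],
   and on which the weight bound applies. *)
pose B := A `&` [set x | (emin + a)%:E <= EM K (empirical x : probability F R)].
have mA : measurable A.
  rewrite (_ : A = @fraction_in_U R F U n @^-1` C)//.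
  by rewrite -[X in measurable X]setTI; apply: measurable_fraction => //; exact: closed_measurable.
have mB : measurable B by apply: measurableI => //; exact: measurable_energy_level.
have mw : measurable_fun setT (fun x : n.+1.-tuple F => (ensemble_weight beta V x)%:E).
  by apply/measurable_EFinP; exact: (measurable_weight beta V_cont).
have mass0 D : 0 <= @weight_mass R F beta V n D.
  by apply: integral_ge0 => x _; rewrite lee_fin weight_ge0.
have massB : mass B <= (expR (n.+1%:R ^+ 2 * (C0 - (emin + a) + eta / 3)))%:E.
  have h : forall A : set (n.+1.-tuple F), measurable A ->
    (forall x, A x -> (emin + a)%:E <= EM K (empirical x : probability F R)) ->
    \int[tuple_measure (vol F) n.+1]_(x in A) (ensemble_weight beta V x)%:E <=
    (expR (n.+1%:R ^+ 2 * (C0 - (emin + a) + eta / 3)))%:E by near: n.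
  by apply: h => // x [].
have massA : mass A <= mass B + mass (A `\` B).
  rewrite {1}(_ : A = B `|` (A `\` B)); last by rewrite setDUK//; exact: subIsetl.
  rewrite /weight_mass ge0_integral_setU//.
  - exact: measurableD.
  - exact: measurable_funTS.
  - by move=> x _; rewrite lee_fin weight_ge0.
  - by apply/disj_setPS => x [? []].
(* Off [B] the empirical measure is outside [M']; the hypothesis compares this part with the
   configurations inside [M'], which lie in [B]. *)
have massAB : mass (A `\` B) <= (expR (n.+1%:R `^ alpha))%:E * mass B.
  have neg : prob_empirical beta V (measures_with_fraction_in U C `&` ~` M') n <=
      (expR (n.+1%:R `^ alpha))%:E *
      prob_empirical beta V (measures_with_fraction_in U C `&` M') n by near: n.
  have {}neg : mass [set x : n.+1.-tuple F | (measures_with_fraction_in U C `&` ~` M')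
       (empirical x : probability F R)] <= (expR (n.+1%:R `^ alpha))%:E *
     mass [set x : n.+1.-tuple F | (measures_with_fraction_in U C `&` M')
       (empirical x : probability F R)].
    move: neg; rewrite /prob_empirical /ensemble Zz/= muleCA lee_pmul2l// lte_fin invr_gt0//.
  apply: le_trans (le_trans neg _).
    apply: weight_mass_le => x [Ax nBx]; split => // Mx; apply: nBx; split => //.
    by apply/ltW/HK; split.
  apply: lee_wpmul2l; first by rewrite lee_fin expR_ge0.
  apply: weight_mass_le => x [Ax Mx]; split => //.
  by apply/ltW/HK; split.
apply: log_prob_le.
  by rewrite /ensemble Zz/=; apply: mule_ge0; [rewrite lee_fin invr_ge0 ltW|exact: mass0].
rewrite -/A -(lee_pmul2l (x := z%:E))// (mul_ensemble _ Zz)//.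
have h4 : (1 + expR (n.+1%:R `^ alpha) <= expR (n.+1%:R ^+ 2 * (eta / 3)))%R by near: n.
apply: (@le_trans _ _ ((1 + expR (n.+1%:R `^ alpha))%:E * mass B)).
  apply: (le_trans massA); rewrite EFinD ge0_muleDl ?lee_fin ?expR_ge0// mul1e.
  by rewrite leeD2l.
apply: (@le_trans _ _ ((expR (n.+1%:R ^+ 2 * (eta / 3)))%:E *
    (expR (n.+1%:R ^+ 2 * (C0 - (emin + a) + eta / 3)))%:E)).
  by apply: lee_pmul => //; rewrite lee_fin addr_ge0// expR_ge0.
rewrite -!EFinM lee_fin -expRD; apply: (le_trans _ (ler_wpM2r (expR_ge0 _) zlo)).
by rewrite -expRD ler_expR -!mulrDr; apply: ler_wpM2l; [exact: exprn_ge0|lra].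
Unshelve. all: by end_near. Qed.

(** Otherwise near-minimisers for fractions tending to [x] would have bounded energy, and their
    limit would be a competitor for [gam x] with too small a value. *)
Lemma gamma_lsc_at x (a : R) : (0 <= x <= 1)%R -> a%:E < gam x ->
  exists2 d : R, (0 < d)%R & forall y, (`|y - x| < d)%R -> a%:E < gam y.
Proof.
move=> x01 ax; apply: contrapT => nex.
(* The gap between [a] and [b] leaves room for measures that only approach the infimum [gam y]. *)
have [b ab bx] : exists2 b : R, (a < b)%R & b%:E < gam x.
  move: ax; case: (gam x) => [g| |]//.
    by rewrite lte_fin => ag; exists ((a + g) / 2)%R; rewrite ?lte_fin; lra.
  by exists (a + 1)%R; rewrite ?ltry// ltrDl.
have {nex} ex (n : nat) : exists mu : probability F R,
    [/\ M mu, (`|fine (mu U) - x| < n.+1%:R^-1)%R & E mu <= (emin + b)%:E].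
  apply: contrapT => nmu; apply: nex; exists n.+1%:R^-1%R; first by rewrite invr_gt0.
  move=> y yx; rewrite ltNge; apply/negP => gy; apply: nmu.
  have : gam y < b%:E by apply: (le_lt_trans gy).
  move=> /ereal_inf_lt[_ [mu [Mmu muU] <-]]; rewrite IE => Ib.
  exists mu; split => //; first by rewrite muU.
  by move: Ib; rewrite lteBlDr// -EFinD addrC => /ltW.
have [nu nuP] := boolp.choice ex.
have nuK n : EM n (nu n) <= (emin + b)%:E.
  have [_ _ h] := nuP n; apply: le_trans h.
  exact: (cutoff_energy_le P C0 V beta0).
have [mu [UU [UUF ooU muE lim]]] := energy_compactness beta0 beta_lt V_cont V_growth nuK.
have muoo : E mu < +oo by rewrite (le_lt_trans muE) ?ltry.
have Mmu : M mu.
  by apply: M_limit lim muoo => // n; have [h _ _] := nuP n; exact: MM'.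
have cl : fine (nu n U) @[n --> UU] --> x.
  apply: cvg_trans (_ : fine (nu n U) @[n --> \oo] --> x)%R.
    by move=> A; exact: ooU.
  apply/cvgrPdist_le => e e0; near=> n.
  rewrite distrC ltW//; have [_ h _] := nuP n; apply: (lt_le_trans h).
  rewrite -[leRHS]invrK lef_pV2 ?posrE ?invr_gt0//.
  by near: n; exact: near_ler_nat.
have := gamma_le Mmu (open_limit_U UUF lim (M_null Mmu) cl).
apply/negP; rewrite -ltNge; apply: le_lt_trans bx.
by rewrite leeBlDr// -EFinD addrC.
Unshelve. all: by end_near. Qed.

Theorem planar_good_rate : good_rate_function (`[0%R, 1%R] : set R) gam.
Proof.
split.
- by move=> x _; exact: gamma_ge0.
- move=> x a ax; have [x01|nx01] := pselect ((`[0%R, 1%R]%classic : set R) x); last first.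
    (* Points outside the segment are isolated in the subspace topology. *)
    exists [set x]; last by move=> y ->.
    by rewrite /nbhs/= -nbhs_subspace_out.
  have [d d0 Hd] := gamma_lsc_at (x := x) (a := a) x01 ax.
  exists [set y | a%:E < gam y] => //.
  rewrite /nbhs/= -nbhs_subspace_in//; apply/nbhs_ballP; exists d => // y.
  by rewrite /ball/= distrC => /Hd.
move=> a a0.
have -> : [set x | (`[0%R, 1%R]%classic : set R) x /\ gam x <= a%:E] =
    [set x | gam x <= a%:E] `&` (`[0%R, 1%R]%classic : set R).
  by apply/seteqP; split => x /= [].
apply/compact_subspaceIP; apply: (subclosed_compact _ (@segment_compact R 0%R 1%R)); last first.
  by move=> x [].
have -> : [set x | gam x <= a%:E] `&` (`[0%R, 1%R]%classic : set R) =
    ~` (~` (`[0%R, 1%R]%classic : set R) `|` [set x | (0 <= x <= 1)%R /\ a%:E < gam x]).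
  rewrite setCU setCK setIC; apply/seteqP; split => x /= [x01 ga]; split => //.
    by move=> [_]; rewrite ltNge ga.
  by rewrite leNgt; apply/negP => h; apply: ga; split => //; rewrite in_itv in x01.
apply: open_closedC; rewrite openE => x [nx|[x01 ax]].
  have : nbhs x (~` (`[0%R, 1%R]%classic : set R)).
    by apply: open_nbhs_nbhs; split => //; apply: closed_openC; exact: interval_closed.
  by apply: filterS => y ny; left.
have [d d0 Hd] := gamma_lsc_at x01 ax.
apply/nbhs_ballP; exists d => // y; rewrite /ball/= distrC => /Hd ay.
have [y01|ny01] := pselect ((`[0%R, 1%R]%classic : set R) y); [right|by left].
by split => //; move: y01; rewrite /= in_itv.
Qed.

End large_deviation_principle.

(** * The line and the plane *)

Lemma confining_growth (R : realType) (T : topologicalType) (md : T -> R) (beta : R) (V : T -> R) :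
  confining md beta V -> (forall x, 0 <= md x) ->
  exists beta' C0 : R, [/\ beta < beta', 0 <= C0 &
    forall x, beta' * ln (md x + 1) - C0 <= V x].
Proof.
move=> [V0 _ [beta' [b1 bb]]]; rewrite /limf_einf /= => lim md0.
have [r Hr] : exists r : R, forall x, r < md x ->
    1 < V x / (beta' * ln (md x)).
  move: lim; rewrite lteNr => /ereal_inf_lt[_ [B /= [r _ rB] <-]] sup1.
  exists r => x rx; rewrite -lte_fin -lteN2.
  by apply: le_lt_trans sup1; apply: ereal_sup_ubound; exists x => //; exact: rB.
have b0 : 0 < beta' by exact: lt_trans b1.
pose r0 := Num.max r 1.
have r01 : 1 <= r0 by rewrite le_max lexx orbT.
have l2 : 0 <= ln 2 :> R by apply: ln_ge0; rewrite ler1n.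
have lr0 : 0 <= ln (r0 + 1) by apply: ln_ge0; lra.
(* The first term covers the ball of radius [r0], where only [V >= 0] is used; outside it
   [1 + |x| <= 2 * |x|] costs the second. *)
exists beta', (beta' * ln (r0 + 1) + beta' * ln 2); split => //.
  by rewrite addr_ge0// mulr_ge0// ltW.
move=> x; have [xr|rx] := leP (md x) r0.
  have : ln (md x + 1) <= ln (r0 + 1) by rewrite ler_ln ?posrE ?lerD2r//; have := md0 x; lra.
  move=> /(ler_wpM2l (ltW b0)).
  have := V0 x; have : 0 <= beta' * ln 2 by rewrite mulr_ge0// ltW.
  lra.
have x1 : 1 < md x by exact: le_lt_trans rx.
have lx : 0 < ln (md x) by exact: ln_gt0.
have blx : 0 < beta' * ln (md x) by rewrite mulr_gt0.
have rmx : r < md x by apply: le_lt_trans rx; rewrite le_max lexx.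
have Vx : beta' * ln (md x) < V x by have := Hr x rmx; rewrite ltr_pdivlMr// mul1r.
have : ln (md x + 1) <= ln (md x) + ln 2.
  rewrite -lnM ?posrE//; last by lra.
  by rewrite ler_ln ?posrE; lra.
move=> /(ler_wpM2l (ltW b0)); rewrite mulrDr.
have : 0 <= beta' * ln (r0 + 1) by rewrite mulr_ge0// ltW.
lra.
Qed.

(* Dyadic decomposition: [(1 + f)^-3] is at most [8^-k] where [2^k <= 1 + f < 2^(k+1)]. *)
Lemma inv_cube_integral_fin d (T : measurableType d) (R : realType)
    (m : {measure set T -> \bar R}) (f : T -> R) (C : R) :
  measurable_fun setT f -> (forall x, 0 <= f x) ->
  (forall r : R, 1 <= r -> (m [set x | (f x <= r)%R] <= (C * r ^+ 2)%:E)%E) ->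
  (\int[m]_x ((1 + f x) ^- 3)%:E < +oo)%E.
Proof.
move=> mf f0 mC.
pose D (k : nat) := [set x | f x <= 2 ^+ k.+1].
have mD k : measurable (D k) by exact: measurable_le_fun.
have h8 k : (0 <= (8 ^- k : R)%:E)%E by rewrite lee_fin invr_ge0 exprn_ge0.
pose g (k : nat) x : \bar R := ((8 ^- k)%:E * (\1_(D k) x : R)%:E)%E.
have g0 k x : (0 <= g k x)%E by rewrite mule_ge0// lee_fin.
have m1 k : measurable_fun setT (fun x => (\1_(D k) x : R)%:E).
  by apply/measurable_EFinP; exact: measurable_indic.
have mg k : measurable_fun setT (g k) by exact: measurable_funeM.
apply: (@le_lt_trans _ _ (\int[m]_x \sum_(0 <= k <oo) g k x)%E).
  apply: ge0_le_integral => //.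
  - by move=> x _; rewrite lee_fin invr_ge0 exprn_ge0// addr_ge0.
  - apply/measurable_EFinP; rewrite (_ : (fun _ => _) = fun x => expR (- (ln (1 + f x) * 3))).
      apply: measurableT_comp => //; apply: measurable_funN; apply: measurable_funM => //.
      by apply: (measurableT_comp (@measurable_ln R)); exact: measurable_funD.
    by apply/funext => x; rewrite expRN expRM_natr lnK// posrE ltr_wpDr.
  - exact: ge0_emeasurable_sum.
  move=> x _.
  have exk : exists k, f x <= 2 ^+ k.+1.
    exists (Num.bound (f x)); apply: (le_trans (ltW (archi_boundP (f0 x)))).
    by rewrite -natrX ler_nat ltnW// ltnW// ltn_expl.
  have [k fk kmin] := ex_minnP exk.
  apply: (@le_trans _ _ (g k x)).
    rewrite /g indicE mem_set// mule1 lee_fin lef_pV2 ?posrE ?exprn_gt0//; last first.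
      by rewrite ltr_wpDr.
    have -> : 8 ^+ k = (2 ^+ k) ^+ 3 :> R by rewrite exprAC; congr (_ ^+ k); ring.
    apply: lerXn2r; rewrite ?nnegrE ?exprn_ge0 ?addr_ge0//.
    case: k fk kmin => [|k] fk kmin; first by rewrite expr0 lerDl.
    have : ~~ (f x <= 2 ^+ k.+1) by apply/negP => /kmin; rewrite ltnn.
    by rewrite -ltNge => /ltW; move/le_trans; apply; rewrite lerDr.
  by rewrite (nneseriesD1 (n := k))// leeDl// nneseries_ge0.
rewrite integral_nneseries//.
apply: (@le_lt_trans _ _ (\sum_(0 <= k <oo) (8 * C / (2 ^ (k + 1))%:R)%:E)%E).
  apply: lee_nneseries => [k _ _|k _]; first exact: integral_ge0.
  rewrite ge0_integralZl// integral_indic// setIT.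
  have := mC (2 ^+ k.+1); rewrite exprn_ege1 ?ler1n// => /(_ isT) h.
  apply: le_trans (lee_wpmul2l (h8 k) h) _; rewrite -EFinM lee_fin.
  rewrite le_eqVlt; apply/orP; left; apply/eqP.
  rewrite addn1 natrX.
  have -> : 8 ^+ k = 2 ^+ k * 2 ^+ k * 2 ^+ k :> R.
    by rewrite -!exprMn; congr (_ ^+ k); ring.
  rewrite !exprS.
  have : 2 ^+ k != 0 :> R by rewrite expf_neq0// pnatr_eq0.
  by move: (2 ^+ k : R) => q q0; field; rewrite q0.
rewrite (cvg_lim _ (cvg_geometric_eseries_half (r := 8 * C) (n := 0)))//.
exact: ltry.
Qed.

(** * Uniform noise, on the line and on the plane *)

Section uniform_noise.
Context (R : realType).
Local Notation leb := (@lebesgue_measure R).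
Local Notation T := (measurableTypeR R).
Local Open Scope ereal_scope.

Lemma measurable_translation (x : R) : measurable_fun [set: T] (fun u : T => (x + u)%R : T).
Proof. exact: measurable_funD. Qed.

(** The translated measure agrees with Lebesgue measure on half-open intervals, which determine
    it. *)
Lemma lebesgue_measure_translation (x : R) (A : set T) : measurable A ->
  leb [set u | A (x + u)%R] = leb A.
Proof.
move=> mA.
pose f : {mfun T >-> T} := HB.pack (fun u : T => (x + u)%R : T)
  (isMeasurableFun.Build _ _ _ _ _ (measurable_translation x)).
apply/esym; apply: (@lebesgue_measure_unique R (pushforward leb f)) => //.
move=> _ [[a b] _ <-] /=; rewrite /pushforward.
have -> : f @^-1` `]a, b] = `](a - x)%R, (b - x)%R]%classic.
  by apply/seteqP; split => u /=; rewrite !in_itv/= ltrBlDl lerBrDl.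
rewrite !lebesgue_measure_itv/= !lte_fin ltrD2r; case: ifP => // _.
by rewrite -!EFinD; congr EFin; ring.
Qed.

Lemma uniform_noise (e : R) : (0 < e)%R -> exists eta : probability T R,
  [/\ eta [set u | (e < `|u|)%R] = 0,
      forall (x : R) (A : set T), measurable A -> eta [set u | A (x + u)%R] <= ((2 * e)^-1)%:E * leb A &
      forall x y t, (0 < t)%R -> eta [set u | (`|x + u - y| <= e * t)%R] <= t%:E].
Proof.
move=> e0; have ab : (- e < e)%R by lra.
pose eta : probability T R := uniform_prob ab.
have etaE (A : set T) : measurable A -> eta A = ((2 * e)^-1)%:E * leb (A `&` `[(- e)%R, e]).
  move=> mA; have -> : eta A = \int[eta]_x (\1_A x)%:E by rewrite integral_indic// setIT.
  rewrite integral_uniform//; last by apply/measurable_EFinP; exact: measurable_indic.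
  rewrite integral_indic//; congr (_%:E * _); congr (_^-1)%R; ring.
have c0 : 0 <= ((2 * e)^-1)%:E :> \bar R by rewrite lee_fin invr_ge0 mulr_ge0// ltW.
have dens (x : R) (A : set T) : measurable A -> eta [set u | A (x + u)%R] <= ((2 * e)^-1)%:E * leb A.
  move=> mA; have mAx : measurable [set u : T | A (x + u)%R].
    by rewrite -[X in measurable X]setTI; exact: measurable_translation.
  rewrite etaE// -(lebesgue_measure_translation x mA); apply: lee_wpmul2l => //.
  by apply: le_measure; rewrite ?inE//; apply: measurableI.
exists eta; split => //.
  rewrite etaE; last first.
    rewrite (_ : mkset _ = (fun u : T => `|u|%R) @^-1` `]e, +oo[%classic).
      by rewrite -[X in measurable X]setTI; apply: measurableT_comp.
    by apply/seteqP; split => u /=; rewrite in_itv/= andbT.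
  rewrite (_ : _ `&` _ = set0) ?measure0 ?mule0//; apply/seteqP; split => // u /= [].
  by rewrite in_itv/= -ler_norml ltNge => /negP.
move=> x y t t0.
have -> : [set u | (`|x + u - y| <= e * t)%R] =
    [set u | `[(y - e * t)%R, (y + e * t)%R]%classic (x + u)%R].
  by apply/seteqP; split => u /=; rewrite in_itv/= ler_distl.
apply: (le_trans (dens x _ _)) => //.
have et0 : (0 < e * t)%R by rewrite mulr_gt0.
rewrite lebesgue_measure_itv/= lte_fin ifT; last by lra.
rewrite -EFinD -EFinM lee_fin (_ : (2 * e)^-1 * _ = t)%R//.
by field; rewrite gt_eqF.
Qed.

Lemma uniform_noise_integral (e : R) (eta : probability T R) (x : R) (h : T -> \bar R) :
  (0 < e)%R ->
  (forall A : set T, measurable A -> eta [set u | A (x + u)%R] <= ((2 * e)^-1)%:E * leb A) ->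
  measurable_fun setT h -> (forall z, 0 <= h z) ->
  \int[eta]_u h (x + u)%R <= ((2 * e)^-1)%:E * \int[leb]_z h z.
Proof.
move=> e0 dens mh h0.
have [m [mE mI]] := law_exists eta (measurable_translation x).
rewrite -mI//; apply: ge0_integral_dominated => //.
  by rewrite invr_ge0 mulr_ge0// ltW.
move=> A mA; apply: le_trans (dens A mA).
by rewrite le_eqVlt; apply/orP; left; apply/eqP; exact: mE.
Qed.

End uniform_noise.

Lemma uniform_noise_family (R : realType) :
  exists eta : R -> probability (measurableTypeR R) R, forall e : R, 0 < e ->
  [/\ eta e [set u | (e < `|u|)%R] = 0%E,
      forall (x : R) (A : set (measurableTypeR R)), measurable A ->
        (eta e [set u | A (x + u)%R] <= ((2 * e)^-1)%:E * lebesgue_measure A)%E &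
      forall x y t : R, 0 < t -> (eta e [set u | (`|x + u - y| <= e * t)%R] <= t%:E)%E].
Proof.
suff ex (e : R) : exists eta : probability (measurableTypeR R) R, 0 < e ->
  [/\ eta [set u | (e < `|u|)%R] = 0%E,
      forall (x : R) (A : set (measurableTypeR R)), measurable A ->
        (eta [set u | A (x + u)%R] <= ((2 * e)^-1)%:E * lebesgue_measure A)%E &
      forall x y t : R, 0 < t -> (eta [set u | (`|x + u - y| <= e * t)%R] <= t%:E)%E].
  by have [eta etaP] := boolp.choice ex; exists eta.
have [e0|] := ltP 0 e; first by have [eta] := uniform_noise e0; exists eta.
by move=> _; have [eta _] := uniform_noise (@ltr01 R); exists eta.
Qed.

Lemma real_planar (R : realType) :
  exists P : planar (real_line R), forall z, ret P z = z.1.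
Proof.
have [eta etaP] := uniform_noise_family R.
unshelve eexists (@Planar R (real_line R) (fun x : R => (x, 0%R)) (fun z => z.1)
  (fun x y : R => x + y) eta (fun e => (2 * e)^-1) _ _ _ _ _ _ _ _ _ _ _ _ _ _) => //.
- exact: measurable_id.
- exact: measurable_fst.
- exact: (@measurable_funD _ _ _ _ (@fst R R) (@snd R R)).
- move=> z; apply/cvg_ballP => e e0.
  apply: (filterS _ (nbhsx_ballx z e e0)) => w [wz _].
  by split => //; exact: ballxx.
- by move=> x y /=; apply/pair_equal_spec; rewrite addr0.
- by move=> x /=; rewrite /cmod/= expr0n addr0 sqrtr_sqr.
- by move=> x y /=; rewrite /cmod/= subrr expr0n addr0 sqrtr_sqr.
- move=> e e0; have [h _ _] := etaP e e0.
  apply/eqP; rewrite -measure_le0 -h; apply: le_measure; rewrite ?inE.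
  + rewrite (_ : mkset _ = (fun u : measurableTypeR R => `|u|%R) @^-1` `](2 * e), +oo[%classic).
      by rewrite -[X in measurable X]setTI; apply: measurableT_comp.
    by apply/seteqP; split => u /=; rewrite in_itv/= andbT.
  + rewrite (_ : mkset _ = (fun u : measurableTypeR R => `|u|%R) @^-1` `]e, +oo[%classic).
      by rewrite -[X in measurable X]setTI; apply: measurableT_comp.
    by apply/seteqP; split => u /=; rewrite in_itv/= andbT.
  + by move=> u /= ; apply: le_lt_trans; rewrite ler_pMl// ler1n.
- by move=> e e0; rewrite invr_ge0 mulr_ge0// ltW.
- by move=> e x A e0 mA; have [_ h _] := etaP e e0; exact: h.
- by move=> e x y t e0 t0; have [_ _ h] := etaP e e0; exact: h.
- have mabs : measurable_fun setT (fun x : measurableTypeR R => `|x|) by apply: measurableT_comp.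
  (* The length [2 * r] is at most [2 * r ^+ 2] for [r >= 1]. *)
  apply: (inv_cube_integral_fin (C := 2) mabs (fun x => normr_ge0 x)) => r r1.
  have -> : [set x : R | `|x| <= r] = `[- r, r]%classic.
    by apply/seteqP; split => u /=; rewrite in_itv/= ler_norml.
  have lebr : lebesgue_measure (`[(- r)%R, r]%classic : set R) = (2 * r)%:E.
    rewrite lebesgue_measure_itv/= lte_fin ifT; last by lra.
    by rewrite -EFinD; congr EFin; ring.
  by apply: (@le_trans _ _ (2 * r)%:E); [rewrite -lebr|rewrite lee_fin; nra].
Qed.

Lemma complex_planar (R : realType) :
  exists P : planar (complex_plane R), forall z, ret P z = z.
Proof.
have [eta etaP] := uniform_noise_family R.
pose T := (measurableTypeR R * measurableTypeR R)%type.
pose N (e : R) : probability T R := (eta e \x eta e)%E.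
have m1 : measurable_fun [set: T] (fun z : T => z.1 : measurableTypeR R) by exact: measurable_fst.
have m2 : measurable_fun [set: T] (fun z : T => z.2 : measurableTypeR R) by exact: measurable_snd.
have mgt (r : R) (f : T -> R) : measurable_fun setT f -> measurable [set z : T | r < f z].
  move=> mf; rewrite (_ : mkset _ = f @^-1` `]r, +oo[%classic).
    by rewrite -[X in measurable X]setTI; exact: mf.
  by apply/seteqP; split => u /=; rewrite in_itv/= andbT.
have mabs : measurable_fun setT (fun x : measurableTypeR R => `|x|) by apply: measurableT_comp.
have mgt1 (r : R) : measurable [set u : measurableTypeR R | r < `|u|].
  rewrite (_ : mkset _ = (fun u : measurableTypeR R => `|u|%R) @^-1` `]r, +oo[%classic).
    by rewrite -[X in measurable X]setTI; exact: mabs.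
  by apply/seteqP; split => u /=; rewrite in_itv/= andbT.
have mcm : measurable_fun setT (fun z : T => cmod (z : R * R)).
  exact: (measurable_cmod (X := fun z : T => z : R * R)).
have NX e (A B : set (measurableTypeR R)) : measurable A -> measurable B ->
    N e (A `*` B) = (eta e A * eta e B)%E.
  by move=> mA mB; exact: product_measure1E.
have madd (x : T) : measurable_fun setT (fun u : T => (x : R * R) + u : T).
  apply/measurable_fun_pairP; split.
    exact: (measurableT_comp (measurable_translation x.1) m1).
  exact: (measurableT_comp (measurable_translation x.2) m2).
unshelve eexists (@Planar R (complex_plane R) (fun z => z) (fun z => z)
  (fun x y : R * R => x + y) N (fun e => (2 * e)^-1 * (2 * e)^-1) _ _ _ _ _ _ _ _ _ _ _ _ _ _) => //.
- apply/measurable_fun_pairP; split.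
    by apply: measurable_funD; exact: (measurableT_comp m1).
  by apply: measurable_funD; exact: (measurableT_comp m2).
- by move=> z; exact: cvg_id.
- move=> e e0; have [h _ _] := etaP e e0; set Z := [set u | e < `|u|] in h.
  apply/eqP; rewrite -measure_le0.
  apply: (@le_trans _ _ (N e (Z `*` setT `|` setT `*` Z))).
    apply: le_measure; rewrite ?inE.
    + exact: mgt.
    + by apply: measurableU; apply: measurableX => //; exact: mgt1.
    + move=> u /= eu; apply: contrapT => /not_orP[/not_andP nu1 /not_andP nu2].
      have u1 : `|u.1| <= e by rewrite leNgt; apply/negP => u1; case: nu1.
      have u2 : `|u.2| <= e by rewrite leNgt; apply/negP => u2; case: nu2.
      by have := cmod_le u; lra.
  apply: (le_trans (measureU2 _ _ _)).
  + by apply: measurableX => //; exact: mgt1.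
  + by apply: measurableX => //; exact: mgt1.
  + rewrite [X in (X + _)%E]NX//; last exact: mgt1.
    rewrite [X in (_ + X)%E]NX//; last exact: mgt1.
    by rewrite h mul0e mule0 adde0.
- by move=> e e0; rewrite mulr_ge0// invr_ge0 mulr_ge0// ltW.
- move=> e x A e0 mA; have [_ dens _] := etaP e e0.
  pose tr (u : T) : T := (x : R * R) + u.
  have mtr : measurable_fun setT tr by exact: madd.
  pose f (z : T) : \bar R := (\1_A z)%:E.
  have f0 z : (0 <= f z)%E by rewrite lee_fin.
  have mf : measurable_fun setT f by apply/measurable_EFinP; exact: measurable_indic.
  have mfx : measurable_fun setT (fun u : T => f (tr u)).
    exact: (measurableT_comp mf mtr).
  have mAx : measurable [set u : T | A (tr u)].
    by rewrite -[X in measurable X]setTI; exact: mtr.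
  have -> : N e [set u : T | A (tr u)] = (\int[N e]_u f (tr u))%E.
    transitivity (\int[N e]_u (\1_[set u : T | A (tr u)] u)%:E)%E.
      by rewrite integral_indic// setIT.
    by apply: eq_integral => u _; rewrite /f !indicE; congr (_%:R%:E); apply/idP/idP; rewrite !inE.
  have c0 : (0 <= ((2 * e)^-1)%:E :> \bar R)%E by rewrite lee_fin invr_ge0 mulr_ge0// ltW.
  pose leb := @lebesgue_measure R.
  have volA : vol (complex_plane R) A = (\int[leb]_a \int[leb]_b f (a, b))%E.
    transitivity (\int[sf_product leb leb]_z f z)%E.
      by rewrite integral_indic// setIT.
    by rewrite (fubini_tonelli1 f).
  rewrite volA (fubini_tonelli1 (fun u : T => f (tr u)))//.
  have mfa (a : measurableTypeR R) : measurable_fun setT (fun b : measurableTypeR R => f (a, b)).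
    by apply: (measurableT_comp mf (g := fun b => (a, b))); exact: measurable_fun_pair.
  have mG : measurable_fun setT (fun a : measurableTypeR R => \int[leb]_b f (a, b))%E.
    exact: (measurable_fun_fubini_tonelli_F (m2 := leb) f).
  have G0 (a : measurableTypeR R) : (0 <= \int[leb]_b f (a, b))%E by exact: integral_ge0.
  (* The one-dimensional domination is applied to the inner variable and then to the outer one. *)
  apply: (@le_trans _ _ (\int[eta e]_a (((2 * e)^-1)%:E * \int[leb]_b f (((x : R * R).1 + a)%R, b)))%E).
    apply: ge0_le_integral => //.
    + by move=> a _; apply: integral_ge0.
    + exact: (measurable_fun_fubini_tonelli_F (m2 := eta e) (fun u : T => f (tr u))).
    + by apply: measurable_funeM; exact: (measurableT_comp mG (measurable_translation (x : R * R).1)).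
    + move=> a _.
      change (\int[eta e]_u f (((x : R * R).1 + a)%R, ((x : R * R).2 + u)%R) <=
        ((2 * e)^-1)%:E * \int[leb]_b f (((x : R * R).1 + a)%R, b))%E.
      apply: (@uniform_noise_integral R e (eta e) (x : R * R).2
        (fun b => f (((x : R * R).1 + a)%R, b))) => //; exact: dens.
  rewrite ge0_integralZl//; last exact: (measurableT_comp mG (measurable_translation (x : R * R).1)).
  rewrite EFinM -muleA; apply: lee_wpmul2l => //.
  exact: (@uniform_noise_integral R e (eta e) (x : R * R).1 _ e0 (dens _) mG G0).
- move=> e x y t e0 t0; have [_ _ near] := etaP e e0.
  set Z := [set u : measurableTypeR R | `|x.1 + u - y.1| <= e * t].
  have mZ : measurable Z.
    rewrite (_ : Z = (fun u : measurableTypeR R => `|x.1 + u - y.1|%R) @^-1` `]-oo, (e * t)]%classic).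
      rewrite -[X in measurable X]setTI; apply: (measurableT_comp mabs) => //.
      by apply: measurable_funB => //; exact: measurable_translation.
    by apply/seteqP; split => u /=; rewrite in_itv.
  (* The first coordinate alone already yields the linear bound [t]. *)
  apply: (@le_trans _ _ (N e (Z `*` setT))).
    apply: le_measure; rewrite ?inE.
    + rewrite (_ : mkset _ = (fun u : T => cmod (((x : R * R) + u) - y)) @^-1` `]-oo, (e * t)]%classic).
        rewrite -[X in measurable X]setTI.
        apply: (measurable_cmod (X := fun u : T => ((x : R * R) + u) - y)) => //.
          by apply: measurable_funB => //; exact: (measurableT_comp (measurable_translation x.1) m1).
        by apply: measurable_funB => //; exact: (measurableT_comp (measurable_translation x.2) m2).
      by apply/seteqP; split => u /=; rewrite in_itv.
    + exact: measurableX.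
    + move=> u /= h; split => //; apply: le_trans h.
      exact: (cmod_fst (((x : R * R) + u) - y)).
  rewrite [leLHS]NX// probability_setT mule1; exact: near.
- apply: (inv_cube_integral_fin (C := 4) mcm (fun z => cmod_ge0 z)) => r r1.
  have lebr : lebesgue_measure (`[(- r)%R, r]%classic : set R) = (2 * r)%:E.
    rewrite lebesgue_measure_itv/= lte_fin ifT; last by lra.
    by rewrite -EFinD; congr EFin; ring.
  apply: (@le_trans _ _ (vol (complex_plane R) ((`[- r, r] : set R) `*` (`[- r, r] : set R)))).
    apply: le_measure; rewrite ?inE.
    + exact: measurable_le_fun.
    + exact: measurableX.
    + by move=> z /= zr; split; rewrite /= in_itv/= -ler_norml; apply: le_trans zr;
        [exact: cmod_fst|exact: cmod_snd].
  apply: (@le_trans _ _ ((2 * r)%:E * (2 * r)%:E)%E); last first.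
    by rewrite -EFinM lee_fin; nra.
  rewrite -lebr le_eqVlt; apply/orP; left; apply/eqP.
  exact: (product_measure1E lebesgue_measure lebesgue_measure).
Qed.

(** * Finite energy, polar sets and neighbourhoods of the boundary *)

Section boundary_conditions.
Context (R : realType).

Lemma closed_boundary (T : topologicalType) (A : set T) : closed (boundary A).
Proof.
rewrite /boundary setDE; apply: closedI; first exact: closed_closure.
by apply: open_closedC; exact: open_interior.
Qed.

(** If [mu] charged [B], its restriction to some compact part of [B] would be nonzero, while
    domination by [mu] would keep its logarithmic energy below [+oo]. *)
Lemma polar_null (P : planar (real_line R)) (beta beta' C0 : R) (V : real_line R -> R)
    (B : set R) (mu : probability (real_line R) R) :
  0 < beta -> beta < beta' -> (forall x, beta' * log1 x - C0 <= V x) ->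
  closed B -> polar B -> (total_energy beta C0 V mu < +oo)%E -> mu B = 0%E.
Proof.
move=> beta0 beta_lt V_growth cB pB muoo.
have mB : measurable (B : set (measurableTypeR R)) by exact: closed_measurable.
(* Compact pieces of [B], as polarity is tested on compactly supported measures. *)
pose K (n : nat) : set (measurableTypeR R) := B `&` `[(- n%:R)%R, n%:R%R].
have mK n : measurable (K n) by exact: measurableI.
have mC A : (measurable (A : set (measurableTypeR R))) -> measurable (~` A) by exact: measurableC.
suff K0 n : mu (K n) = 0%E.
  have -> : B = \bigcup_n K n.
    apply/seteqP; split => [x Bx|x [n _ []]//].
    exists (Num.bound `|x|) => //; split => //; rewrite /= in_itv/= -ler_norml.
    exact/ltW/archi_boundP.
  have : mu.-negligible (\bigcup_n K n).
    by apply: negligible_bigcup => n; apply/negligibleP; [exact: mK|exact: K0].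
  by move/negligibleP => -> //; exact: bigcupT_measurable.
apply: contrapT => Kn0.
have Kfin : (mu (K n) < +oo)%E.
  by rewrite ltey_eq (fin_num_measure (mu : probability (measurableTypeR R) R)).
pose m : {finite_measure set (measurableTypeR R) -> \bar R} := mfrestr (mK n) Kfin.
have mE A : m A = mu (A `&` K n) by [].
have mle A : measurable A -> (m A <= 1%:E * mu A)%E.
  by move=> mA; rewrite mul1e mE; apply: le_measure; rewrite ?inE//; exact: measurableI.
pose k (p : real_line R * real_line R) := log_kernel beta p.1 p.2.
have mk : measurable_fun setT k := measurable_log_kernel P beta0.
have k0 p : (0 <= k p)%E by exact: (log_kernel_ge0 P beta0).
have kern := ge0_integral_pair_dominated (m := mu) (nu := m) ler01 mle mk k0.
rewrite expr1n mul1e in kern.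
have muk : (\int[mu \x mu]_p k p < +oo)%E.
  apply: le_lt_trans muoo; rewrite leeDr//; apply: integral_ge0 => x _.
  by rewrite lee_fin (reduced_potential_ge0 P beta_lt V_growth).
have mex : exists K' : set R, [/\ compact K', K' `<=` B & m (~` K') = 0%E].
  exists (B `&` `[(- n%:R)%R, n%:R%R]); split; last 2 first.
  + by move=> x [].
  + by rewrite mE -/(K n) setICl measure0.
  by rewrite setIC; apply: compact_closedI => //; exact: segment_compact.
have mT : m setT != 0%E by rewrite mE setTI; apply/eqP => h; exact: Kn0.
have := pB m mex mT; apply/eqP; rewrite lt_eqF//.
have b2 : 0 < 2 / beta by rewrite divr_gt0.
apply: (@le_lt_trans _ _ ((2 / beta)%:E * \int[m \x m]_p k p)%E); last first.
  apply: lte_mul_pinfty; rewrite ?lee_fin//; first exact: ltW.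
  exact: le_lt_trans kern muk.
rewrite -ge0_integralZl//; last by rewrite lee_fin ltW.
(* The integrand of the logarithmic energy has no sign, so its positive part is bounded;
   [- ln |x - y|] is at most [2 / beta] times the kernel because [log1] is nonnegative. *)
apply: (@le_trans _ _ (\int[m \x m]_p (fun p : R * R => - lne (`|p.1 - p.2|)%:E)^\+ p)%E).
  rewrite integralE -[leRHS]sube0; apply: leeB => //.
  by apply: integral_ge0 => p _; exact: funeneg_ge0.
apply: ge0_le_integral => //.
- apply: measurable_funepos; apply: measurableT_comp => //.
  exact: (measurable_lne_dist P beta0).
- exact: measurable_funeM.
move=> p _; rewrite funeposE ge_max; apply/andP; split; last by rewrite mule_ge0// lee_fin ltW.
have -> : lne (`|p.1 - p.2|)%:E = ((log1 (p.1 : real_line R) + log1 (p.2 : real_line R))%:E - (2 / beta)%:E * k p)%E.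
  exact: (lne_distE P beta0 p.1 p.2).
have aux (l : R) (q : \bar R) : 0 <= l -> (0 <= q)%E -> (- (l%:E - q) <= q)%E.
  move=> l0; case: q => [q|_|]; last by rewrite leeNy_eq.
    by rewrite -EFinB -EFinN !lee_fin; lra.
  exact: leey.
apply: aux; first by rewrite addr_ge0// (log1_ge0 P).
by rewrite mule_ge0// lee_fin ltW.
Qed.

Lemma thickening_open (B : set (R * R)) (e : R) : open (thickening B e).
Proof.
apply: bigcup_open => x _; rewrite (_ : mkset _ = (fun y => cmod (x - y)) @^-1` `]-oo, e[%classic).
  apply: open_comp => [y _|]; last exact: interval_open.
  apply: (continuous_comp (f := fun y : R * R => x - y) (g := @cmod R)); last exact: cmod_continuous.
  by apply: cvgB; [exact: cvg_cst|exact: cvg_id].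
by apply/seteqP; split => u /=; rewrite in_itv.
Qed.

Lemma sub_thickening (B : set (R * R)) (e : R) : 0 < e -> B `<=` thickening B e.
Proof.
by move=> e0 x Bx; exists x => //=; rewrite subrr /cmod/= expr0n addr0 sqrtr0.
Qed.

Lemma M1star_complex_null (U : set (R * R)) (delta0 : R) (mu : probability (complex_plane R) R) :
  0 < delta0 -> M1star_complex U delta0 mu -> mu (boundary U) = 0%E.
Proof.
move=> d0 muM; apply/eqP; rewrite -measure_le0; apply/lee_addgt0Pr => eps eps0.
rewrite add0e; set c := 2 * fine (hausdorff1 (boundary U)).
have mthick e : measurable (thickening (boundary U) e : set (complex_plane R)).
  by apply: open_measurable_plane; exact: thickening_open.
have mb : measurable (boundary U : set (complex_plane R)).
  rewrite -[boundary U]setCK; apply: measurableC; apply: open_measurable_plane.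
  by apply: closed_openC; exact: closed_boundary.
pose e := Num.min delta0 (eps / (`|c| + 1)).
have c1 : 0 < `|c| + 1 by rewrite ltr_wpDl.
have e0 : 0 < e by rewrite lt_min d0 divr_gt0.
have ed : e <= delta0 by rewrite ge_min lexx.
have ee : e * (`|c| + 1) <= eps by rewrite -ler_pdivlMr// ge_min lexx orbT.
apply: (@le_trans _ _ (mu (thickening (boundary U) e))).
  by apply: le_measure; rewrite ?inE//; exact: sub_thickening.
have := muM e; rewrite e0 ed -/c => /(_ isT)/le_trans; apply.
rewrite lee_fin; have := ler_norm c; nra.
Qed.

End boundary_conditions.

Theorem theorem1 (R : realType) (beta : R) (hbeta : 0 < beta) :
  (forall (V : R -> R) (U : set R),
     confining (fun x : R => `|x|) beta V ->
     measurable (U : set (measurableTypeR R)) ->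
     polar (boundary U) ->
     let F := real_line R in
     let M := M1star_real U in
     [/\ good_rate_function (`[0, 1] : set R) (@gamma R F beta V M U),
         forall O : set R, O `<=` `[0, 1] ->
           open (O : set (subspace (`[0, 1] : set R))) ->
           @ld_lower_bound R F beta V M U O &
         forall C : set R, C `<=` `[0, 1] ->
           closed (C : set (subspace (`[0, 1] : set R))) ->
           @ld_upper_bound R F beta V M U C])
  /\
  (forall (V : R * R -> R) (U : set (R * R)) (delta0 : R),
     confining (@cmod R) beta V ->
     C11_loc V ->
     measurable (U : set (measurableTypeR R * measurableTypeR R)) ->
     bounded_domain U ->
     closed (boundary U) ->
     rectifiable1 (boundary U) ->
     (hausdorff1 (boundary U) < +oo)%E ->
     0 < delta0 ->
     let F := complex_plane R in
     let M := M1star_complex U delta0 in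
     [/\ good_rate_function (`[0, 1] : set R) (@gamma R F beta V M U),
         forall O : set R, O `<=` `[0, 1] ->
           open (O : set (subspace (`[0, 1] : set R))) ->
           @ld_lower_bound R F beta V M U O &
         forall C : set R, C `<=` `[0, 1] ->
           closed (C : set (subspace (`[0, 1] : set R))) ->
           @negligible_outside R F beta V M U C ->
           @ld_upper_bound R F beta V M U C]).
Proof.
split.
- move=> V U cV mU pU F M.
  have [P retP] := real_planar R.
  have [V0 Vc _] := cV.
  have [beta' [C0 [bb C00 Vg]]] := confining_growth cV (fun x => normr_ge0 x).
  have {}V0 (x : F) : 0 <= (V : F -> R) x by exact: V0.
  have {}Vg (x : F) : beta' * log1 x - C0 <= (V : F -> R) x by exact: Vg.
  have retE (A : set R) : ret P @^-1` A = fst @^-1` A.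
    by apply/seteqP; split => z; rewrite /preimage/= retP.
  have V_cont : continuous (fun z => (V : F -> R) (ret P z)).
    rewrite (_ : (fun _ => _) = V \o fst); last by apply/funext => z; rewrite /= retP.
    by move=> z; apply: continuous_comp; [exact: cvg_fst|exact: Vc].
  have mUi : measurable (interior U : set F) by apply: open_measurable; exact: open_interior.
  have mUc : measurable (closure U : set F) by apply: closed_measurable; exact: closed_closure.
  have op (A : set R) : open A -> open (ret P @^-1` A).
    by move=> oA; rewrite retE; apply: open_comp => // z _; exact: cvg_fst.
  have oUi : open (ret P @^-1` (interior U)) by apply: op; exact: open_interior.
  have oUc : open (ret P @^-1` (~` closure U)).
    by apply: op; apply: closed_openC; exact: closed_closure.
  have UiU : interior U `<=` U := @interior_subset _ U.
  have UUc : U `<=` closure U := @subset_closure _ U.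
  have MT : M `<=` [set: probability F R] by [].
  have Mnull mu : M mu -> mu (closure U `\` interior U) = 0%E by [].
  have Mlim (nu : nat -> probability F R) mu UU : UltraFilter UU ->
      (forall n, [set: probability F R] (nu n)) -> open_limit P UU nu mu ->
      (@total_energy R F beta C0 V mu < +oo)%E -> M mu.
    move=> _ _ _ muoo; exact: (polar_null P hbeta bb Vg (@closed_boundary _ U) pU muoo).
  split.
  + exact: (planar_good_rate hbeta bb C00 V0 V_cont Vg mU mUi mUc UiU UUc oUi oUc MT Mnull Mlim).
  + move=> O O01 oO.
    exact: (planar_lower_bound hbeta bb C00 V0 V_cont Vg mU mUi mUc UiU UUc oUi oUc Mnull O01 oO).
  + move=> C C01 cC.
    apply: (planar_upper_bound hbeta bb C00 V0 V_cont Vg mU mUi mUc UiU UUc oUi oUc Mnull Mlim C01 cC).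
    (* Here [M'] is everything, so the exceptional event is empty and its probability vanishes. *)
    exists 0; split; first by rewrite lexx ltr0n.
    apply: nearW => n; rewrite setCT setI0.
    rewrite /prob_empirical {1}/ensemble (_ : [set x | _] = set0) ?integral_set0 ?mule0.
      apply: mule_ge0; first by rewrite lee_fin expR_ge0.
      have w0 n' (x : n'.-tuple F) : (0 <= (@ensemble_weight R F beta V n' x)%:E)%E.
        by rewrite lee_fin weight_ge0.
      apply: mule_ge0; last exact: integral_ge0.
      by rewrite lee_fin invr_ge0 fine_ge0// integral_ge0.
    by apply/seteqP; split.
move=> V U delta0 cV _ mU _ _ _ _ d0 F M.
have [P retP] := complex_planar R.
have [V0 Vc _] := cV.
have [beta' [C0 [bb C00 Vg]]] := confining_growth cV (@cmod_ge0 R).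
have {}V0 (x : F) : 0 <= (V : F -> R) x by exact: V0.
have {}Vg (x : F) : beta' * log1 x - C0 <= (V : F -> R) x by exact: Vg.
have retE (A : set (R * R)) : ret P @^-1` A = A.
  by apply/seteqP; split => z; rewrite /preimage/= retP.
have V_cont : continuous (fun z => (V : F -> R) (ret P z)).
  by rewrite (_ : (fun _ => _) = V)//; apply/funext => z; rewrite retP.
have mUi : measurable (interior U : set F).
  by apply: open_measurable_plane; exact: open_interior.
have mUc : measurable (closure U : set F).
  rewrite -[closure U]setCK; apply: measurableC; apply: open_measurable_plane.
  by apply: closed_openC; exact: closed_closure.
have oUi : open (ret P @^-1` (interior U)) by rewrite retE; exact: open_interior.
have oUc : open (ret P @^-1` (~` closure U)).
  by rewrite retE; apply: closed_openC; exact: closed_closure.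
have UiU : interior U `<=` U := @interior_subset _ U.
have UUc : U `<=` closure U := @subset_closure _ U.
have Mnull mu : M mu -> mu (closure U `\` interior U) = 0%E := M1star_complex_null d0.
have Mlim (nu : nat -> probability F R) mu UU : UltraFilter UU ->
    (forall n, M (nu n)) -> open_limit P UU nu mu ->
    (@total_energy R F beta C0 V mu < +oo)%E -> M mu.
  (* The thickenings are open, so each bound that defines [M] passes to the limit. *)
  move=> UUF Mnu lim _ e ed; apply: lim.
  - by rewrite retE; exact: thickening_open.
  - by apply: open_measurable_plane; exact: thickening_open.
  - by apply: nearW => n; exact: Mnu.
split.
- exact: (planar_good_rate hbeta bb C00 V0 V_cont Vg mU mUi mUc UiU UUc oUi oUc
    (@subset_refl _ M) Mnull Mlim).
- move=> O O01 oO.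
  exact: (planar_lower_bound hbeta bb C00 V0 V_cont Vg mU mUi mUc UiU UUc oUi oUc Mnull O01 oO).
- move=> C C01 cC neg.
  exact: (planar_upper_bound hbeta bb C00 V0 V_cont Vg mU mUi mUc UiU UUc oUi oUc Mnull Mlim C01 cC neg).
Qed.
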